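(* Let $P\subseteq\mathbb{R}^d$ be a full-dimensional polyhedron that does not contain lines. Then the canonical form $\Omega(\bar P)$ of the projective polytope $\bar P$ is $$\Omega(\bar P)=\mathrm{Vol}^\vee_{\mathbf z}(P)\,dz_1\,dz_2\cdots dz_d .$$
   Context: View $\mathbb{P}^d=\mathbb{R}^d\sqcup H_\infty$ with affine coordinates $\mathbf z=(z_1,\dots,z_d)$ on $\mathbb{R}^d$; $\bar P$ is the closure of $P$ in $\mathbb{P}^d(\mathbb{R})$, a projective polytope (its facets are the closures of facets of $P$, together with $\bar P\cap H_\infty$ if this has dimension $d-1$). $\bar P$ carries the orientation inherited from the standard orientation of $\mathbb{R}^d$. Canonical form (existence and uniqueness is a known theorem of Arkani-Hamed, Bai and Lam): for each full-dimensional oriented projective polytope $\bar P\subseteq\mathbb{P}^d(\mathbb{R})$ there is a unique nonzero meromorphic (rational) $d$-form $\Omega(\bar P)$ on $\mathbb{P}^d$ such that: if $d=0$, $\bar P$ is a point and $\Omega(\bar P)=\pm1$ according to its orientation; if $d>0$, $\Omega(\bar P)$ has poles exactly along the hyperplanes spanned by the facets of $\bar P$, all poles are simple, and for each facet $F$, $\mathrm{Res}_F\,\Omega(\bar P)=\Omega(F)$. Here, if locally $\Omega=\frac{df}{f}\wedge\eta+\cdots$ with $f$ a local equation of the hyperplane of $F$, then $\mathrm{Res}_F\Omega=\eta|_{f=0}$, and $F$ is oriented so that an inward normal followed by the orientation of $F$ gives the orientation of $\bar P$. Dual volume function: $h_P(\mathbf v)=-\min_{\mathbf y\in P}\langle\mathbf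 v,\mathbf y\rangle\in\mathbb{R}\cup\{\infty\}$; the normal fan $\mathcal N(P)$ consists of the cones $C_F=\{\mathbf v:h_P(\mathbf v)=-\langle\mathbf v,\mathbf y\rangle\ne\infty\ \forall\mathbf y\in F\}$, $F$ a face of $P$; and $$\mathrm{Vol}^\vee_{\mathbf z}(P)=\sum_{C=\mathrm{span}_{\ge0}(\mathbf v_{1},\dots,\mathbf v_{d})\in\mathcal T}\frac{|\det(\mathbf v_{1},\dots,\mathbf v_{d})|}{\prod_{j=1}^d\bigl(h_P(\mathbf v_{j})+\langle\mathbf v_{j},\mathbf z\rangle\bigr)},$$ where $\mathcal T$ is any triangulation of $\mathcal N(P)$ into full-dimensional simplicial cones generated by rays of $\mathcal N(P)$ (independent of $\mathcal T$ and of the scaling of generators). *)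

(* Defs.v *)
From HB Require Import structures.
From mathcomp Require Import all_boot all_order all_algebra.
From mathcomp Require Import all_classical all_reals all_analysis.
From mathcomp Require Import generic_quotient fraction.
From mathcomp Require Import -(notations) mpoly.

Set Implicit Arguments.
Unset Strict Implicit.
Unset Printing Implicit Defensive.

Import Order.TTheory GRing.Theory Num.Theory.
Import numFieldNormedType.Exports.

Local Open Scope classical_set_scope.
Local Open Scope ring_scope.

(* The notations of multinomials clash with those of analysis. *)
Notation polyn R n := (mpoly n R).
Notation ratfun R n := {fraction (mpoly n R)}.

Section RationalFunctions.
Variable R : realType.

Definition to_frac n (p : polyn R n) : ratfun R n := FracField.tofrac p.

Definition numerator n (f : ratfun R n) : polyn R n :=
  (frac (repr f)).1.

Definition denominator n (f : ratfun R n) : polyn R n :=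
  (frac (repr f)).2.

Definition rconst n (c : R) : ratfun R n := to_frac (mpolyC n c).

Definition rvar n (i : 'I_n) : ratfun R n :=
  to_frac (mpolyX R (mnm1 i)).

Definition poly_subst m n (t : 'I_n -> ratfun R m) (p : polyn R n) :
    ratfun R m :=
  mmap (@rconst m) t p.

(* f o t.  This is independent of the representation of f as a fraction when
   the components of t are algebraically independent, the only case used. *)
Definition rat_comp m n (t : 'I_n -> ratfun R m) (f : ratfun R n) :
    ratfun R m :=
  poly_subst t (numerator f) / poly_subst t (denominator f).

Definition rat_deriv n (i : 'I_n) (f : ratfun R n) : ratfun R n :=
  let p := numerator f in let q := denominator f in
  to_frac (mderiv i p * q - p * mderiv i q) / to_frac (q ^+ 2).

(* A rational n-form f(z) dz_1...dz_n in n variables is represented by its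
   coefficient f; its pullback along z = t(u) has the coefficient
   f(t(u)) * det (dt_i / du_j). *)
Definition pullback n (t : 'I_n -> ratfun R n) (f : ratfun R n) : ratfun R n :=
  rat_comp t f * \det (\matrix_(i < n, j < n) rat_deriv j (t i)).

Definition poly_dvd n (q p : polyn R n) := exists a, p = a * q.

Definition irreducible_mpoly n (q : polyn R n) :=
  q \isn't a GRing.unit /\
  forall a b, q = a * b -> a \is a GRing.unit \/ b \is a GRing.unit.

(* f has a pole of order k along the prime divisor {q = 0}, for k > 0 and q
   irreducible. *)
Definition pole_of_order n (f : ratfun R n) (q : polyn R n) (k : nat) :=
  exists a b : polyn R n,
    [/\ f = to_frac a / to_frac (q ^+ k * b), ~ poly_dvd q a & ~ poly_dvd q b].

(* p(0, u_2, ..., u_(n+1)), as a polynomial in the last n variables. *)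
Definition restrict_poly n (p : polyn R n.+1) : polyn R n :=
  mmap (@mpolyC n R)
    (fun i => if unlift ord0 i is Some j
              then mpolyX R (mnm1 j) else 0) p.

(* f du_1...du_(n+1) = (du_1 / u_1) ^ (h du_2...du_(n+1)) with h = p / q
   regular along {u_1 = 0}, and r is the restriction of h to {u_1 = 0}. *)
Definition is_residue n (f : ratfun R n.+1) (r : ratfun R n) :=
  exists p q : polyn R n.+1,
    [/\ f = (rvar ord0)^-1 * (to_frac p / to_frac q),
        restrict_poly q != 0 &
        r = to_frac (restrict_poly p) / to_frac (restrict_poly q)].

(* The polynomial function u |-> (1, u) *m c. *)
Definition affine_poly n (c : 'cV[R]_n.+1) : polyn R n :=
  mpolyC n (c ord0 0) +
  \sum_(j < n) c (lift ord0 j) 0 *: mpolyX R (mnm1 j).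

End RationalFunctions.

(* Points of P^d are the classes [x] of the nonzero x : 'rV_d.+1, and R^d is
   embedded in P^d by z |-> [(1, z)].  A rational d-form on P^d is represented
   by the coefficient f of its expression f(z) dz_1...dz_d on R^d.

   An invertible matrix g gives an affine chart of P^d, u |-> [(1, u) *m g];
   every affine chart is obtained in this way. *)
Section CanonicalForm.
Variable R : realType.

Definition lift_pt d (z : 'rV[R]_d) : 'rV[R]_d.+1 := row_mx (1 : 'rV[R]_1) z.

Definition chart_map d (g : 'M[R]_d.+1) (i : 'I_d) : ratfun R d :=
  to_frac (affine_poly (col (lift ord0 i) g)) /
  to_frac (affine_poly (col ord0 g)).

Definition form_in_chart d (g : 'M[R]_d.+1) (w : ratfun R d) : ratfun R d :=
  pullback (chart_map g) w.

(* A full-dimensional oriented projective polytope in P^d is represented by one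
   of the two opposite pointed cones C over it, and by a nonzero o : R: if x is
   in the interior of C, then tangent vectors at [x], given by vectors
   w_1, ..., w_d modulo x, are positively oriented iff
   0 < o * det (x, w_1, ..., w_d). *)

(* C lies on the side {0 <= x *m l} of the hyperplane {x *m l = 0}, and this
   hyperplane is spanned by the face of C that it cuts out. *)
Definition facet d (C : set 'rV[R]_d.+1) (l : 'cV[R]_d.+1) :=
  [/\ l != 0,
      forall x, C x -> 0 <= (x *m l) 0 0 &
      exists M : 'M[R]_(d, d.+1),
        [/\ row_free M, M *m l = 0 & forall i, C (row i M)]].

(* The chart g is such that the hyperplane of the facet l has the equation
   u_1 = 0, and the direction u_1 > 0 (row 1 of g) points inward. *)
Definition facet_chart d (l : 'cV[R]_d.+2) (g : 'M[R]_d.+2) :=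
  [/\ g \in unitmx,
      row' (lift ord0 ord0) g *m l = 0 &
      0 < (row (lift ord0 ord0) g *m l) 0 0].

(* The facet in the chart g, as a polytope in P^d with coordinates dual to the
   basis consisting of the rows of g other than row 1. *)
Definition facet_cone d (C : set 'rV[R]_d.+2) (g : 'M[R]_d.+2) :
    set 'rV[R]_d.+1 :=
  [set y | C (y *m row' (lift ord0 ord0) g)].

(* If x and w_2, ..., w_(d+1) have the coordinates y and y_2, ..., y_(d+1) on
   the rows of g other than row 1, and n is row 1 of g, then
   det (x, n, w_2, ..., w_(d+1)) = det g * det (y, y_2, ..., y_(d+1));
   so the facet, oriented by "inward normal first", has orientation
   o * det g. *)
Fixpoint canonical_form (d : nat) :
    set 'rV[R]_d.+1 -> R -> ratfun R d -> Prop :=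
  match d return set 'rV[R]_d.+1 -> R -> ratfun R d -> Prop with
  | 0 => fun C o w =>
      exists x, [/\ C x, x != 0 & w = rconst 0 (Num.sg (o * x 0 0))]
  | n.+1 => fun C o w =>
      [/\ w != 0,
          forall (g : 'M[R]_n.+2) (q : polyn R n.+1) (k : nat),
            g \in unitmx -> irreducible_mpoly q -> (0 < k)%N ->
            pole_of_order (form_in_chart g w) q k <->
            k = 1%N /\
            exists l (c : R),
              [/\ facet C l, c != 0 & q = c *: affine_poly (g *m l)] &
          forall l (g : 'M[R]_n.+2), facet C l -> facet_chart l g ->
            exists2 r, is_residue (form_in_chart g w) r &
                       canonical_form (facet_cone C g) (o * \det g) r]
  end.

(* The cone over the closure of P in P^d: for x != 0, the class [x] is in the
   closure iff x or - x is in this cone. *)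
Definition proj_closure d (P : set 'rV[R]_d) : set 'rV[R]_d.+1 :=
  closure [set x | exists t z, [/\ 0 < t, P z & x = t *: lift_pt z]].

End CanonicalForm.

Section DualVolume.
Variables (R : realType) (d : nat).
Implicit Types (P : set 'rV[R]_d) (v y : 'rV[R]_d).

Definition dotp v y : R := (v *m y^T) 0 0.

Definition polyhedron P :=
  exists (m : nat) (A : 'M[R]_(m, d)) (b : 'cV[R]_m),
    P = [set y | forall i, (A *m y^T) i 0 <= b i 0].

Definition full_dimensional P :=
  exists (y : 'rV[R]_d) (M : 'M[R]_d),
    [/\ P y, forall i, P (y + row i M) & M \in unitmx].

Definition contains_no_line P :=
  ~ exists y v, v != 0 /\ forall t : R, P (y + t *: v).

Definition support_fun P v : \bar R :=
  (- ereal_inf [set (dotp v y)%:E | y in P])%E.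

Definition face P (F : set 'rV[R]_d) :=
  F !=set0 /\
  exists v (c : R), (forall y, P y -> c <= dotp v y) /\
                    F = [set y | P y /\ dotp v y = c].

Definition normal_cone P (F : set 'rV[R]_d) : set 'rV[R]_d :=
  [set v | forall y, F y -> support_fun P v = (- dotp v y)%:E].

Definition normal_fan P : set (set 'rV[R]_d) :=
  [set normal_cone P F | F in face P].

Definition subcone (M : 'M[R]_d) (I : {set 'I_d}) : set 'rV[R]_d :=
  [set v | exists2 a : 'rV[R]_d, v = a *m M &
           forall i, 0 <= a 0 i /\ (i \notin I -> a 0 i = 0)].

Definition simplicial_cone (M : 'M[R]_d) : set 'rV[R]_d :=
  subcone M [set: 'I_d]%SET.

Definition ray v : set 'rV[R]_d := [set t *: v | t in [set t : R | 0 <= t]].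

(* The rows of T i are the generators of the i-th simplicial cone. *)
Definition fan_triangulation P (m : nat) (T : 'I_m -> 'M[R]_d) :=
  [/\ forall i, T i \in unitmx,
      forall i j, normal_fan P (ray (row j (T i))),
      forall i, exists2 C, normal_fan P C & simplicial_cone (T i) `<=` C,
      \bigcup_i simplicial_cone (T i) = \bigcup_(C in normal_fan P) C &
      forall i i', i != i' ->
        simplicial_cone (T i) <> simplicial_cone (T i') /\
        exists I I',
          simplicial_cone (T i) `&` simplicial_cone (T i') = subcone (T i) I /\
          simplicial_cone (T i) `&` simplicial_cone (T i') = subcone (T i') I'].

(* As a rational function of z; the denominators are the affine functions
   z |-> support_fun P v_j + dotp v_j z.  For a triangulation T of the normal
   fan, support_fun P v_j is finite because v_j is in a cone of the fan. *)
Definition dual_volume P (m : nat) (T : 'I_m -> 'M[R]_d) : ratfun R d :=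
  \sum_(i < m)
    rconst d `|\det (T i)| /
    \prod_(j < d) to_frac (affine_poly
      (col_mx (fine (support_fun P (row j (T i))))%:M (row j (T i))^T
       : 'cV[R]_d.+1)).

End DualVolume.

(* Main.v *)
Require Import Defs.
From HB Require Import structures.
From mathcomp Require Import all_boot all_order all_algebra perm.
From mathcomp Require Import all_classical all_reals all_analysis.
From mathcomp Require Import generic_quotient fraction.
From mathcomp Require Import -(notations) mpoly.
From mathcomp Require Import ring lra.

Set Implicit Arguments.
Unset Strict Implicit.
Unset Printing Implicit Defensive.

Import Order.TTheory GRing.Theory Num.Theory.
Import numFieldNormedType.Exports.

Local Open Scope ring_scope.

(* The cone K over the closure of P has a dual cone which, by the triangulation
   of the normal fan, is subdivided into the simplicial cones spanned by e_0
   and by the lifted rays (h_P(v_j), v_j); the dual volume is the sum over these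
   cones of |det(generators)| / prod(generators), the generators being read as
   affine functions of z.

   Such a sum is a valuation: it depends only on the signed sum of the
   indicators of the cones, and vanishes when this signed sum is zero, or
   invariant under a translation.  This is proved by induction on the dimension:
   restricted to a generic line the sum has simple poles and vanishes at
   infinity, and its residue at a generator l is the same kind of sum for the
   link of l, that is, for the difference of the limits of the signed sum along
   p + t l and p - t l.

   Hence the residue of the dual volume along a hyperplane l is the form of the
   link of l.  If l is a facet of K, the link subdivides the dual cone of that
   facet, and induction applies; otherwise the link is zero or invariant under
   a translation, and there is no pole.

   For uniqueness, the difference of two canonical forms has no poles, since by
   induction its residues vanish; but there is no nonzero regular d-form on P^d
   (for d > 0): a polynomial form has a pole at infinity of order at least
   d + 1. *)

(** Everything is done in homogeneous coordinates: a linear form l on K is read in the chart g as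
    the affine polynomial of [g *m l], and e_0 as the constant 1. A cone in d + 1 dimensions then
    has d + 1 linear factors in its denominator, exactly what the Jacobian of a change of chart
    absorbs; so one formula holds in all charts, and infinity becomes an ordinary hyperplane.

    The obstacle is that a triangulation has inner walls, along which poles cancel only in the sum.
    Following adjacent cones would require the combinatorics of links of triangulations; counting
    points only uses that the cones cover the dual cone once. Hence cones are treated as signed
    indicator functions, compared off finitely many walls. A limit of cones may contain lines, which
    is why coordinates may be unrestricted.

    The induction mentions neither P nor its fan: it is about a matrix X of generators of a cone and
    any signed family adding up to the indicator of the dual cone ([dual_decomposition]). Facets
    preserve this notion, while their families of links need not come from a triangulated normal
    fan. *)

Section LinearAlgebra.
Variable F : fieldType.

Lemma unitmx_ker n (A : 'M[F]_n) :
  (forall v : 'cV_n, A *m v = 0 -> v = 0) -> A \in unitmx.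
Proof.
move=> kerA; rewrite -unitmx_tr -row_free_unit -kermx_eq0.
apply/eqP/row_matrixP => i; rewrite row0.
apply: trmx_inj; rewrite trmx0; apply: kerA.
by rewrite -{1}[A]trmxK -trmx_mul -row_mul mulmx_ker row0 trmx0.
Qed.

Lemma row_free_ker n (B : 'M[F]_(n, n.+1)) (l p : 'cV[F]_n.+1) :
  row_free B -> l != 0 -> B *m l = 0 -> B *m p = 0 -> exists a, p = a *: l.
Proof.
move=> freeB l0 Bl0 Bp0.
have subK (v : 'cV[F]_n.+1) : B *m v = 0 -> (v^T <= kermx B^T)%MS.
  by move=> Bv; apply/sub_kermxP; rewrite -trmx_mul Bv trmx0.
have rkl : \rank l^T = 1%N by rewrite rank_rV -(inj_eq (@trmx_inj _ _ _)) trmxK trmx0 l0.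
have rkK : \rank (kermx B^T) = 1%N.
  by rewrite mxrank_ker mxrank_tr (eqP freeB) subSnn.
have : (kermx B^T <= l^T)%MS.
  have := mxrank_leqif_sup (subK _ Bl0).
  by rewrite rkl rkK => -[_ <-].
move/(submx_trans (subK _ Bp0))/sub_rVP => [a def_p].
by exists a; apply: trmx_inj; rewrite linearZ.
Qed.

Lemma mul_col'_row' m n (A : 'M[F]_(m, n.+1)) (b : 'cV[F]_n.+1) k :
  b k 0 = 0 -> col' k A *m row' k b = A *m b.
Proof.
move=> bk; apply/matrixP => i j; rewrite !mxE ord1.
rewrite (bigD1_ord k) //= bk mulr0 add0r.
by apply: eq_bigr => r _; rewrite !mxE.
Qed.

End LinearAlgebra.

(** * Signed sums of simplicial cones *)

Section SignedCones.
Variable R : realFieldType.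

Lemma colBZE n (u v : 'cV[R]_n) c i : (u - c *: v) i 0 = u i 0 - c * v i 0.
Proof. by rewrite !mxE. Qed.

Lemma row'E n m (A : 'M[R]_(n.+1, m)) k i j : row' k A i j = A (lift k i) j.
Proof. by rewrite mxE. Qed.

(* (c, V, J) stands for c times the indicator function of the set of all V *m a
   with a_j > 0 for j in J; the coordinates outside J are unrestricted. *)
Definition signed_cone n := (R * 'M[R]_n * {set 'I_n})%type.

Definition weight n (s : signed_cone n) : R := s.1.1.
Definition gens n (s : signed_cone n) : 'M[R]_n := s.1.2.
Definition bounded_dirs n (s : signed_cone n) : {set 'I_n} := s.2.

Definition coords n (s : signed_cone n) (p : 'cV[R]_n) : 'cV[R]_n :=
  invmx (gens s) *m p.

Definition in_cone n (s : signed_cone n) p : bool :=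
  [forall j, (j \in bounded_dirs s) ==> (0 < coords s p j 0)].

(** Counts are compared only at such points, where strict and weak inequalities agree. All
    coordinates are tested, bounded or not, so that the walls depend only on [gens s]. *)
Definition off_walls n (s : signed_cone n) p : bool :=
  [forall j, coords s p j 0 != 0].

Definition signed_count n (fam : seq (signed_cone n)) p : R :=
  \sum_(s <- fam) weight s * (in_cone s p)%:R.

(** The generator of this index can be exchanged for l when lam is the coordinate vector of l; the
    other generators then form a basis of the quotient by l. The default [ord0] is reached only for
    lam = 0. *)
Definition pivot n (lam : 'cV[R]_n.+1) : 'I_n.+1 :=
  odflt ord0 [pick k | lam k 0 != 0].

Lemma pivot_neq0 n (lam : 'cV[R]_n.+1) : lam != 0 -> lam (pivot lam) 0 != 0.
Proof.
move=> lam0; rewrite /pivot; case: pickP => [k //|nz]; case/eqP: lam0.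
by apply/colP => k; rewrite mxE; have /negbFE/eqP := nz k.
Qed.

(* The limit of e * (the function s) along p + t e l, for t -> +oo, as a function
   of the class of p modulo l; B identifies the quotient by l with R^n. *)
Definition link_cone n (B : 'M[R]_(n, n.+1)) (l : 'cV[R]_n.+1) (e : R)
    (s : signed_cone n.+1) : signed_cone n :=
  let lam := coords s l in
  let k := pivot lam in
  (if [forall j, (j \in bounded_dirs s) ==> (0 <= e * lam j 0)]
     then e * weight s else 0,
   B *m col' k (gens s),
   [set j | (lift k j \in bounded_dirs s) && (lam (lift k j) 0 == 0)]%SET).

Definition link n (B : 'M[R]_(n, n.+1)) l (fam : seq (signed_cone n.+1)) :=
  [seq link_cone B l 1 s | s <- fam] ++ [seq link_cone B l (-1) s | s <- fam].

Section Link.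
Variables (n : nat) (B : 'M[R]_(n, n.+1)) (l : 'cV[R]_n.+1).
Hypotheses (B_free : row_free B) (l_neq0 : l != 0) (Bl : B *m l = 0).

Lemma coords_neq0 (s : signed_cone n.+1) :
  gens s \in unitmx -> coords s l != 0.
Proof.
move=> uV; apply: contraNneq l_neq0 => l0.
by rewrite -(mulKVmx uV l) -/(coords s l) l0 mulmx0.
Qed.

Lemma link_gens_unit e (s : signed_cone n.+1) :
  gens s \in unitmx -> gens (link_cone B l e s) \in unitmx.
Proof.
move=> uV; apply: unitmx_ker => v; rewrite /gens /= -/(gens s).
set k := pivot _ => Bv0.
pose b : 'cV[R]_n.+1 := \col_i (if unlift k i is Some j then v j 0 else 0).
have bk : b k 0 = 0 by rewrite mxE unlift_none.
have rb : row' k b = v by apply/colP => j; rewrite !mxE liftK.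
have {Bv0} : B *m (gens s *m b) = 0.
  by rewrite -(mul_col'_row' _ bk) rb mulmxA.
case/(row_free_ker B_free l_neq0 Bl) => a Vb.
have {}Vb : b = a *: coords s l.
  by rewrite -(mulKmx uV b) Vb -scalemxAr.
have a0 : a = 0.
  move: bk; rewrite Vb mxE => /eqP.
  by rewrite mulf_eq0 (negbTE (pivot_neq0 (coords_neq0 uV))) orbF => /eqP.
by rewrite -rb Vb a0 scale0r; apply/colP => j; rewrite !mxE.
Qed.

(** Subtracting the multiple of l that kills the pivot coordinate of p changes nothing in the
    quotient, and leaves a combination of the generators that survive there. *)
Lemma link_coords e (s : signed_cone n.+1) p (lam := coords s l)
    (a := coords s p) (k := pivot lam) :
  gens s \in unitmx ->
  coords (link_cone B l e s) (B *m p) = row' k (a - (a k 0 / lam k 0) *: lam).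
Proof.
move=> uV; have lk : lam k 0 != 0 by apply/pivot_neq0/coords_neq0.
apply: (canLR (mulKmx (link_gens_unit e uV))).
rewrite /gens /= -/(gens s) -/lam -/k -mulmxA mul_col'_row'; last first.
  by rewrite colBZE divfK ?subrr.
rewrite mulmxBr -scalemxAr /a /lam /coords !mulKVmx //.
by rewrite mulmxBr -scalemxAr Bl scaler0 subr0.
Qed.

(** For large t, coordinate j of p + t e l has the sign of e * lam_j if lam_j is nonzero, and is the
    constant a_j otherwise. The first case decides the weight of the link, the second its bounded
    directions. *)
Lemma link_cone_limit e (s : signed_cone n.+1) p :
  e != 0 -> gens s \in unitmx -> off_walls (link_cone B l e s) (B *m p) ->
  exists t0, forall t, t0 <= t ->
    off_walls s (p + (t * e) *: l) /\
    weight (link_cone B l e s) * (in_cone (link_cone B l e s) (B *m p))%:R =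
    e * (weight s * (in_cone s (p + (t * e) *: l))%:R).
Proof.
move=> e0 uV /forallP off.
set lam := coords s l; set k := pivot lam; set a := coords s p.
have lk : lam k 0 != 0 by apply/pivot_neq0/coords_neq0.
have offj j : lam j 0 = 0 -> a j 0 != 0.
  move=> lj; have kj : k != j by apply: contraNneq lk => ->; rewrite lj.
  have [j' def_j _] := unlift_some kj.
  have := off j'; rewrite link_coords // row'E colBZE -/lam -/k -/a -def_j lj.
  by rewrite mulr0 subr0.
(* Beyond this bound t * |e lam_j| exceeds |a_j| whenever lam_j is nonzero; the other indices add 0,
   the inverse of 0 being 0. *)
exists (1 + \sum_j `|a j 0| / `|e * lam j 0|) => t t0_le.
have big j : lam j 0 != 0 -> `|a j 0| < t * `|e * lam j 0|.
  move=> lj; rewrite -ltr_pdivrMr ?normr_gt0 ?mulf_neq0 //.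
  apply: lt_le_trans t0_le; rewrite (bigD1 j) //= addrCA ltrDl.
  apply: ltr_wpDr ltr01.
  by apply: sumr_ge0 => i _; apply: divr_ge0.
have t_gt0 : 0 < t.
  apply: lt_le_trans t0_le; apply: ltr_wpDr ltr01.
  by apply: sumr_ge0 => i _; apply: divr_ge0.
have cE j : coords s (p + (t * e) *: l) j 0 = a j 0 + t * (e * lam j 0).
  by rewrite /coords mulmxDr -scalemxAr mxE [X in _ + X]mxE mulrA.
have sgP j : 0 < e * lam j 0 -> 0 < a j 0 + t * (e * lam j 0).
  move=> h; have lj : lam j 0 != 0.
    by apply: contraTneq h => ->; rewrite mulr0 ltxx.
  have := big j lj; rewrite (gtr0_norm h) => h1.
  by have := ler_norm (- a j 0); rewrite normrN; lra.
have sgN j : e * lam j 0 < 0 -> a j 0 + t * (e * lam j 0) < 0.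
  move=> h; have lj : lam j 0 != 0.
    by apply: contraTneq h => ->; rewrite mulr0 ltxx.
  have := big j lj; rewrite (ltr0_norm h) => h1.
  by have := ler_norm (a j 0); lra.
split.
  apply/forallP => j; rewrite cE.
  have [lj|lj] := eqVneq (lam j 0) 0; first by rewrite lj !mulr0 addr0 offj.
  have [/sgP/lt0r_neq0 //|/sgN/ltr0_neq0 //|] := ltrgt0P (e * lam j 0).
  by move/eqP; rewrite mulf_eq0 (negbTE e0) (negbTE lj).
rewrite {1}/weight /= -/lam; case: ifP => [/forallP pos|/forallPn [j]]; last first.
  rewrite negb_imply -ltNge => /andP [Jj /sgN neg].
  suff -> : in_cone s (p + (t * e) *: l) = false by rewrite mul0r !mulr0.
  by apply/forallPn; exists j; rewrite Jj /= cE -leNgt ltW.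
rewrite mulrA; congr (_ * _%:R); congr nat_of_bool.
apply/forallP/forallP => [in' j|ins j]; last first.
  rewrite inE -/lam -/k; apply/implyP => /andP [Jj /eqP lj].
  have := implyP (ins (lift k j)) Jj; rewrite cE lj !mulr0 addr0.
  by rewrite link_coords // row'E colBZE -/lam -/k -/a lj mulr0 subr0.
apply/implyP => Jj; rewrite cE.
have [lj|lj] := eqVneq (lam j 0) 0; last first.
  by apply: sgP; rewrite lt_def mulf_neq0 //= (implyP (pos j) Jj).
rewrite lj !mulr0 addr0.
have kj : k != j by apply: contraNneq lk => ->; rewrite lj.
have [j' def_j _] := unlift_some kj.
have := in' j'; rewrite inE -/lam -/k -def_j Jj lj eqxx /=.
by rewrite link_coords // row'E colBZE -/lam -/k -/a -def_j lj mulr0 subr0.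
Qed.

Lemma link_limit (fam : seq (signed_cone n.+1)) p :
  all (fun s => gens s \in unitmx) fam ->
  all (fun s => off_walls s (B *m p)) (link B l fam) ->
  exists t0, forall t, t0 <= t ->
    [/\ all (fun s => off_walls s (p + t *: l)) fam,
        all (fun s => off_walls s (p - t *: l)) fam &
        signed_count (link B l fam) (B *m p) =
        signed_count fam (p + t *: l) - signed_count fam (p - t *: l)].
Proof.
rewrite /signed_count /link all_cat big_cat !big_map !all_map => uV /andP[offP offN].
elim: fam uV offP offN => [_ _ _|s fam IH] /=.
  by exists 0 => t _; rewrite !big_nil subrr add0r.
move=> /andP [us uV] /andP [ps offP] /andP [ns offN].
have [t0 Ht0] := IH uV offP offN.
have [t1 Ht1] := link_cone_limit (oner_neq0 _) us ps.
have m1 : (-1 : R) != 0 by rewrite oppr_eq0 oner_neq0.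
have [t2 Ht2] := link_cone_limit m1 us ns.
exists (Num.max t0 (Num.max t1 t2)) => t.
rewrite !ge_max => /and3P [/Ht0 [h1 h2 h3] /Ht1 [h4 h5] /Ht2 [h6 h7]].
rewrite mulr1 in h4 h5; rewrite mulrN1 scaleNr in h6 h7.
split; rewrite ?h4 ?h6 //= !big_cons h5 h7.
by rewrite addrACA h3 mul1r mulN1r opprD addrACA.
Qed.

End Link.
End SignedCones.

(* The partial fraction decomposition of prod_j 1 / (a_j + b_j t), evaluated at
   t = 0. *)
Lemma prod_inv_partial_fractions (F : fieldType) n (a b : 'I_n.+1 -> F) :
  (forall j, a j != 0) -> (forall j, b j != 0) ->
  (forall j k, j != k -> a j * b k - a k * b j != 0) ->
  \prod_j (a j)^-1 =
  \sum_k (a k)^-1 * \prod_(j < n) (a (lift k j) - a k / b k * b (lift k j))^-1.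
Proof.
move=> a0 b0 ab0; pose t k := - a k / b k.
pose f j : {poly F} := (a j)%:P + b j *: 'X.
have fE j x : (f j).[x] = a j + b j * x by rewrite !hornerE.
have size_f j : (size (f j) <= 2)%N.
  by rewrite /f addrC -mul_polyC size_MXaddC; case: ifP => // _; rewrite size_polyC; case: eqP.
have ftE k j : (f j).[t k] = a j - a k / b k * b j.
  by rewrite fE /t mulNr mulrN mulrC.
have ft0 k j : j != k -> (f j).[t k] != 0.
  move=> /ab0 h; rewrite ftE; apply: contra_neq h => /eqP.
  by rewrite subr_eq0 => /eqP ->; rewrite mulrAC divfK ?subrr.
have f0 k j : (f (lift k j)).[t k] != 0 by rewrite ft0 // eq_sym neq_lift.
(* Lagrange interpolation of the constant 1 at the n + 1 distinct roots [t k] of the factors: P has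
   degree at most n, so P = 1. *)
pose P : {poly F} :=
  \sum_(k < n.+1) (\prod_(j < n) (f (lift k j)).[t k])^-1 *: \prod_(j < n) f (lift k j).
have P1 : P - 1 = 0.
  apply: (@roots_geq_poly_eq0 _ _ [seq t k | k <- enum 'I_n.+1]).
  - apply/allP => _ /mapP [k _ ->]; apply/rootP.
    rewrite hornerD hornerN hornerC horner_sum (bigD1_ord k) //=.
    rewrite hornerZ horner_prod mulVf; last by apply/prodf_neq0.
    rewrite big1 ?addr0 ?subrr // => i _.
    have kl : lift k i != k by rewrite eq_sym neq_lift.
    have [j def_k _] := unlift_some kl.
    rewrite hornerZ horner_prod [X in _ * X](bigD1 j) //= -def_k ftE.
    by rewrite divfK ?subrr ?mul0r ?mulr0.
  - rewrite map_inj_in_uniq ?enum_uniq // => i j _ _ tij.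
    apply/eqP; apply: contraT => /ft0; rewrite -tij ftE.
    by rewrite divfK ?subrr ?eqxx.
  rewrite size_map size_enum_ord (leq_trans (size_polyD _ _)) // geq_max.
  rewrite size_polyN size_poly1 andbT; apply: (leq_trans (size_sum _ _ _)); apply/bigmax_leqP => k _.
  apply: leq_trans (size_scale_leq _ _) _; apply: leq_trans (size_poly_prod_leq _ _) _.
  rewrite leq_subLR card_ord addnS ltnS.
  apply: (@leq_trans (\sum_(i < n) 2)); first exact: leq_sum.
  by rewrite sum_nat_const card_ord muln2 addnn.
have := congr1 (fun p : {poly F} => p.[0]) P1.
rewrite hornerD hornerN hornerC horner0 horner_sum => /eqP.
rewrite subr_eq0 => /eqP P0.
rewrite -[LHS]mulr1 -[X in _ * X = _]P0 mulr_sumr; apply: eq_bigr => k _.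
rewrite hornerZ horner_prod (bigD1_ord k) //= -mulrA; congr (_ * _).
have -> : \prod_(j < n) (f (lift k j)).[0] = \prod_(j < n) a (lift k j).
  by apply: eq_bigr => j _; rewrite fE mulr0 addr0.
rewrite prodfV mulrCA mulVf ?mulr1; last by apply/prodf_neq0.
by rewrite -prodfV; apply: eq_bigr => j _; rewrite ftE.
Qed.

(** * Vanishing of forms of signed cones *)

Section ScalarExtension.
Variables (R : realFieldType) (F : fieldType) (inR : {rmorphism R -> F}).

Definition scalar_linear (V : lmodType R) (f : V -> F) :=
  forall a u v, f (a *: u + v) = inR a * f u + f v.

Section ScalarLinear.
Variables (V : lmodType R) (f : V -> F).
Hypothesis f_lin : scalar_linear f.

Lemma scalar_linear0 : f 0 = 0.
Proof.
have := f_lin 1 0 0; rewrite scale1r addr0 rmorph1 mul1r.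
by move/eqP; rewrite -subr_eq subrr eq_sym => /eqP.
Qed.

Lemma scalar_linearZ a u : f (a *: u) = inR a * f u.
Proof. by rewrite -[a *: u]addr0 f_lin scalar_linear0 addr0. Qed.

End ScalarLinear.

Lemma exists_nonroot (p : {poly F}) : p != 0 -> exists c : R, p.[inR c] != 0.
Proof.
move=> p0; apply: contrapT => /forallNP noroot; case/eqP: p0.
apply: (@roots_geq_poly_eq0 _ _ [seq inR k%:R | k <- iota 0 (size p)]).
- by apply/allP => _ /mapP [k _ ->]; apply/rootP/eqP/negPn/negP/noroot.
- rewrite map_inj_in_uniq ?iota_uniq // => i j _ _ /fmorph_inj /eqP.
  by rewrite eqr_nat => /eqP.
by rewrite size_map size_iota.
Qed.

(** A vector space over an infinite field is not a finite union of proper subspaces. A point q that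
    works for [ts] is moved in a direction r: along this line each form that is not identically zero
    is a nonzero polynomial of degree at most one. *)
Lemma common_nonzero (V : lmodType R) (T : eqType) (ts : seq T) (f : T -> V -> F) :
  (forall t, scalar_linear (f t)) ->
  exists q, forall t, t \in ts -> (exists r, f t r != 0) -> f t q != 0.
Proof.
move=> f_lin; elim: ts => [|t ts [q qP]]; first by exists 0.
have [[r tr]|no] := pselect (exists r, f t r != 0); last first.
  by exists q => t'; rewrite inE => /orP [/eqP -> //|]; apply: qP.
pose good t' := `[< exists r, f t' r != 0 >].
pose P : {poly F} :=
  \prod_(t' <- t :: ts | good t') ((f t' q)%:P + f t' r *: 'X).
have P0 : P != 0.
  rewrite prodf_seq_neq0; apply/allP => t'; rewrite inE => t't.
  apply/implyP => /asboolP gt'.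
  have [/eqP ->|nt] := boolP (t' == t).
    apply: contraNneq tr => /(congr1 (fun p : {poly F} => p`_1)).
    by rewrite coefD coefC coefZ coefX coef0 add0r mulr1 => ->.
  have {}t't : t' \in ts by move: t't; rewrite (negbTE nt).
  apply: contraNneq (qP _ t't gt') => /(congr1 (fun p : {poly F} => p`_0)).
  by rewrite coefD coefC coefZ coefX coef0 mulr0 addr0 => ->.
have [c] := exists_nonroot P0; rewrite /P horner_prod prodf_seq_neq0 => /allP cP.
exists (c *: r + q) => t' /cP /implyP h /asboolP /h.
by rewrite f_lin !hornerE addrC mulrC.
Qed.

End ScalarExtension.

(** * Coordinates on the quotient by a line *)

Section HyperplaneCoordinates.
Variable F : fieldType.

(** The projection along l onto {p_J = 0}, written without coordinate J. Read as a substitution, it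
    eliminates the variable J on the hyperplane of l. *)
Definition hyper_proj n (l : 'cV[F]_n.+1) (J : 'I_n.+1) : 'M[F]_(n, n.+1) :=
  row' J (1%:M - (l J 0)^-1 *: (l *m delta_mx 0 J)).

Lemma hyper_projE n (l p : 'cV[F]_n.+1) J :
  hyper_proj l J *m p = row' J (p - (p J 0 / l J 0) *: l).
Proof.
rewrite /hyper_proj !row'Esub mul_rowsub_mx; apply: congr1.
rewrite mulmxBl mul1mx -scalemxAl -mulmxA; congr (_ - _).
have -> : delta_mx 0 J *m p = (p J 0)%:M.
  by apply/matrixP => i j; rewrite !ord1 -rowE !mxE eqxx mulr1n.
by rewrite mul_mx_scalar scalerA mulrC.
Qed.

Lemma hyper_proj_self n (l : 'cV[F]_n.+1) J :
  l J 0 != 0 -> hyper_proj l J *m l = 0.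
Proof.
move=> lJ; rewrite hyper_projE divff // scale1r subrr.
by apply/matrixP => i j; rewrite !mxE.
Qed.

Lemma hyper_proj_col' n (l : 'cV[F]_n.+1) J :
  hyper_proj l J *m col' J 1%:M = 1%:M.
Proof.
rewrite col'Esub mulmx_colsub mulmx1; apply/matrixP => i j.
rewrite !mxE big_ord1 !mxE (inj_eq (@lift_inj _ J)).
by rewrite [_ == J]eq_sym (negbTE (neq_lift J j)) andbF !mulr0 subr0.
Qed.

Lemma hyper_proj_free n (l : 'cV[F]_n.+1) J : row_free (hyper_proj l J).
Proof. by apply/row_freeP; exists (col' J 1%:M); apply: hyper_proj_col'. Qed.

Lemma exists_hyperplane_basis n (l : 'cV[F]_n.+1) :
  l != 0 -> exists B : 'M[F]_(n, n.+1), row_free B /\ B *m l = 0.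
Proof.
move=> l0; have [J lJ] : exists J, l J 0 != 0.
  apply/existsP; apply: contraNT l0 => /existsPn h.
  by apply/eqP/colP => i; rewrite mxE; apply/eqP/negPn/h.
by exists (hyper_proj l J); split; [apply: hyper_proj_free | apply: hyper_proj_self].
Qed.

Definition insert_row m n (i0 : 'I_m.+1) (q : 'rV[F]_n) (B : 'M[F]_(m, n)) :
    'M[F]_(m.+1, n) :=
  \matrix_(i, j) if unlift i0 i is Some i' then B i' j else q 0 j.

Lemma row'_insert_row m n i0 (q : 'rV[F]_n) (B : 'M[F]_(m, n)) :
  row' i0 (insert_row i0 q B) = B.
Proof. by apply/matrixP => i j; rewrite !mxE liftK. Qed.

Lemma row_insert_row m n i0 (q : 'rV[F]_n) (B : 'M[F]_(m, n)) :
  row i0 (insert_row i0 q B) = q.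
Proof. by apply/rowP => j; rewrite !mxE unlift_none. Qed.

Lemma insert_row_unit n i0 (q : 'rV[F]_n.+1) (B : 'M[F]_(n, n.+1))
    (l : 'cV[F]_n.+1) :
  row_free B -> B *m l = 0 -> (q *m l) 0 0 != 0 ->
  insert_row i0 q B \in unitmx.
Proof.
move=> freeB Bl ql; apply: unitmx_ker => v gv0.
have l0 : l != 0 by apply: contraNneq ql => ->; rewrite mulmx0 mxE.
have Bv : B *m v = 0.
  rewrite -[B](row'_insert_row i0 q) row'Esub mul_rowsub_mx gv0.
  by apply/matrixP => i j; rewrite !mxE.
have qv : q *m v = 0 by rewrite -(row_insert_row i0 q B) -row_mul gv0 row0.
have [a def_v] := row_free_ker freeB l0 Bl Bv.
have : (q *m v) 0 0 = 0 by rewrite qv mxE.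
rewrite def_v -scalemxAr mxE => /eqP; rewrite mulf_eq0 (negbTE ql) orbF.
by move/eqP->; rewrite scale0r.
Qed.

Lemma row'_unit_free n i0 (g : 'M[F]_n.+1) : g \in unitmx -> row_free (row' i0 g).
Proof.
move=> ug; apply/row_freeP; exists (invmx g *m col' i0 1%:M).
rewrite row'Esub mulmxA mul_rowsub_mx mulmxV // mul_rowsub_mx mul1mx.
by apply/matrixP => i j; rewrite !mxE (inj_eq (@lift_inj _ _)).
Qed.

End HyperplaneCoordinates.

Section ConeForms.
Variables (R : realFieldType) (F : fieldType) (inR : {rmorphism R -> F}).

(* Up to a constant, the Laplace transform of the indicator function of s; a cone
   containing a line has the form 0. *)
Definition cone_form n (ev : 'cV[R]_n -> F) (s : signed_cone R n) : F :=
  if bounded_dirs s == [set: 'I_n]%SET then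
    inR (weight s * `|\det (gens s)|) / \prod_j ev (col j (gens s))
  else 0.

Definition fam_form n ev (fam : seq (signed_cone R n)) : F :=
  \sum_(s <- fam) cone_form ev s.

(* l is proportional to a column of gens s, necessarily the pivot column. *)
Definition is_generator n (s : signed_cone R n.+1) (l : 'cV[R]_n.+1) : bool :=
  [forall j, (coords s l (lift (pivot (coords s l)) j) 0 == 0)].

Lemma col_link_gens n (B : 'M[R]_(n, n.+1)) l e (s : signed_cone R n.+1) j :
  col j (gens (link_cone B l e s)) =
  B *m col (lift (pivot (coords s l)) j) (gens s).
Proof. by apply/matrixP => r c; rewrite !mxE; apply: eq_bigr => i _; rewrite !mxE. Qed.

(** The links have a nonzero form only if all directions but the pivot are bounded and orthogonal to
    l in the basis of generators, so that l is proportional to the pivot generator. If the pivot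
    direction is unrestricted, the two links have opposite weights and cancel; if it is bounded,
    only the one with e equal to the sign of the pivot coordinate survives. *)
Lemma cone_form_link n (B : 'M[R]_(n, n.+1)) l (ev : 'cV_n -> F) s
    (k := pivot (coords s l)) :
  l != 0 -> gens s \in unitmx ->
  cone_form ev (link_cone B l 1 s) + cone_form ev (link_cone B l (-1) s) =
  if (bounded_dirs s == [set: 'I_n.+1]%SET) && is_generator s l then
    inR (weight s * Num.sg (coords s l k 0) * `|\det (B *m col' k (gens s))|) /
    \prod_j ev (B *m col (lift k j) (gens s))
  else 0.
Proof.
move=> l0 uV; have lk : coords s l k 0 != 0 by apply/pivot_neq0/coords_neq0.
rewrite /is_generator -/k.
set J' := [set j | (lift k j \in bounded_dirs s) && (coords s l (lift k j) 0 == 0)]%SET.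
have bd e : bounded_dirs (link_cone B l e s) = J' by [].
have [JT|JNT] := eqVneq J' [set: 'I_n]%SET; last first.
  rewrite /cone_form !bd (negbTE JNT) addr0; case: ifP => // /andP [/eqP bs /forallP h].
  case/eqP: JNT; apply/setP => j; rewrite inE bs !inE /=; exact: h.
have J'P j : (lift k j \in bounded_dirs s) && (coords s l (lift k j) 0 == 0).
  by have := finset.in_setT j; rewrite -JT inE.
have -> : [forall j, coords s l (lift k j) 0 == 0] = true.
  by apply/forallP => j; have /andP [] := J'P j.
have cE e : cone_form ev (link_cone B l e s) =
    inR (weight (link_cone B l e s) * `|\det (B *m col' k (gens s))|) /
    \prod_j ev (B *m col (lift k j) (gens s)).
  rewrite /cone_form bd JT eqxx /gens /= -/(gens s) -/k; congr (_ / _).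
  by apply: eq_bigr => j _; rewrite -(col_link_gens _ _ e).
rewrite andbT !cE -mulrDl -rmorphD -mulrDl.
have wE e : weight (link_cone B l e s) =
    if (k \in bounded_dirs s) ==> (0 <= e * coords s l k 0) then e * weight s else 0.
  rewrite /weight /=; congr (if _ then _ else _); apply/forallP/idP => [|h j]; first exact.
  have [->//|kj] := eqVneq j k; rewrite eq_sym in kj.
  have [j' -> _] := unlift_some kj; have /andP [_ /eqP ->] := J'P j'.
  by rewrite mulr0 lexx implybT.
have kE : (bounded_dirs s == [set: 'I_n.+1]%SET) = (k \in bounded_dirs s).
  apply/eqP/idP => [->|kJ]; first by rewrite inE.
  apply/setP => j; rewrite [RHS]inE; have [->//|kj] := eqVneq j k; rewrite eq_sym in kj.
  by have [j' -> _] := unlift_some kj; have /andP [] := J'P j'.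
rewrite kE !wE !mul1r !mulN1r oppr_ge0; case: (k \in _) => /=; last first.
  by rewrite subrr mul0r rmorph0 mul0r.
have [h|h|h] := ltgtP (coords s l k 0) 0; last by rewrite h eqxx in lk.
  by rewrite ltr0_sg // mulrN1 add0r.
by rewrite gtr0_sg // mulr1 addr0.
Qed.

Lemma is_generatorE n l (s : signed_cone R n.+1) (k := pivot (coords s l)) :
  gens s \in unitmx -> is_generator s l ->
  l = coords s l k 0 *: col k (gens s).
Proof.
move=> uV /forallP ext.
rewrite -[LHS](mulKVmx uV) -/(coords s l); apply/colP => i.
rewrite [LHS]mxE (bigD1_ord k) //= big1 ?addr0 => [|j _]; last first.
  by rewrite (eqP (ext j)) mulr0.
by rewrite [RHS]mxE [X in _ = _ * X]mxE mulrC.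
Qed.

(** Compares volume upstairs with volume in the quotient by l. As l is proportional to column k of
    [gens s], column k of [g *m gens s] has its only nonzero entry in row i0, and the determinant is
    expanded along it. *)
Lemma extreme_det n i0 (g : 'M[R]_n.+1) l s (k := pivot (coords s l)) :
  row' i0 g *m l = 0 -> l != 0 -> gens s \in unitmx -> is_generator s l ->
  `|\det g| * `|\det (gens s)| * `|coords s l k 0| =
  `|(row i0 g *m l) 0 0| * `|\det (row' i0 g *m col' k (gens s))|.
Proof.
move=> Bl l0 uV ext.
have lk : coords s l k 0 != 0 by apply/pivot_neq0/coords_neq0.
have lE : l = coords s l k 0 *: col k (gens s) by apply: is_generatorE.
have gl i : i != i0 -> (g *m l) i 0 = 0.
  rewrite eq_sym => ii; have [i' -> _] := unlift_some ii.
  have := congr1 (fun A : 'cV_n => A i' 0) Bl.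
  by rewrite row'Esub mul_rowsub_mx !mxE.
have gV i : coords s l k 0 * (g *m gens s) i k = (g *m l) i 0.
  by rewrite [in RHS]lE -scalemxAr colEsub mulmx_colsub -colEsub [RHS]mxE [X in _ = _ * X]mxE.
rewrite -!normrM -det_mulmx mulrC (expand_det_col _ k) (bigD1 i0) //=.
rewrite big1 ?addr0 => [|i ii]; last first.
  have := gV i; rewrite gl // => /eqP; rewrite mulf_eq0 (negbTE lk) /= => /eqP ->.
  by rewrite mul0r.
rewrite mulrA gV /cofactor.
have -> : row' i0 (col' k (g *m gens s)) = row' i0 g *m col' k (gens s).
  by rewrite !row'Esub !col'Esub mul_rowsub_mx mulmx_colsub.
rewrite !normrM normrX normrN1 expr1n mul1r.
by rewrite -row_mul [in RHS]mxE.
Qed.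

End ConeForms.

Section ProductSums.
Variables (R : realFieldType) (F : fieldType) (inR : {rmorphism R -> F}).

(** A common representative for all generators on the line of v, so that proportional generators of
    different cones can be collected. *)
Definition normalize n (q : 'rV[R]_n) (v : 'cV[R]_n) : 'cV[R]_n :=
  ((q *m v) 0 0)^-1 *: v.

Lemma normalize_generator n (q : 'rV[R]_n.+1) s (l : 'cV[R]_n.+1) k :
  gens s \in unitmx -> (q *m l) 0 0 = 1 -> (q *m col k (gens s)) 0 0 != 0 ->
  (normalize q (col k (gens s)) == l) =
  is_generator s l && (k == pivot (coords s l)).
Proof.
move=> uV ql qV; apply/eqP/andP => [<-|[gl /eqP kE]].
  set l' := normalize _ _.
  have cE : coords s l' = ((q *m col k (gens s)) 0 0)^-1 *: delta_mx k 0.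
    by rewrite /l' /normalize /coords -scalemxAr colE mulKmx.
  have l'0 : l' != 0.
    rewrite /l' /normalize scaler_eq0 invr_eq0 (negbTE qV) /=.
    by apply: contraNneq qV => ->; rewrite mulmx0 mxE.
  have := pivot_neq0 (coords_neq0 l'0 uV).
  set r := pivot _; rewrite cE !mxE eqxx andbT.
  case: (r =P k) => [rk _|_]; last by rewrite mulr0 eqxx.
  split; last by rewrite rk.
  apply/forallP => j; rewrite -/r cE !mxE rk eqxx andbT.
  by rewrite [_ == k]eq_sym (negbTE (neq_lift k j)) mulr0.
have lE := is_generatorE uV gl; rewrite -kE in lE.
have := ql; rewrite {1}lE -scalemxAr mxE => e1.
by rewrite /normalize -(mulfK qV (coords s l k 0)) e1 mul1r in lE *.
Qed.

(** The second alternative describes functions that come from the quotient by w. It arises from a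
    supporting hyperplane whose face is too small to be a facet: the dual cone of that face contains
    a line modulo l. *)
Definition degenerate n (fam : seq (signed_cone R n)) :=
  (forall p, all (fun s => off_walls s p) fam -> signed_count fam p = 0) \/
  (exists w, w != 0 /\ forall p t, all (fun s => off_walls s p) fam ->
     all (fun s => off_walls s (p + t *: w)) fam ->
     signed_count fam (p + t *: w) = signed_count fam p).

(** Invariance under w passes to the image of w in the quotient. If w is proportional to l this
    image is 0, but then p + t l and p - t l differ by a multiple of w, the two limits agree, and
    the link counts to zero. *)
Lemma degenerate_link n (B : 'M[R]_(n, n.+1)) (l : 'cV[R]_n.+1) fam :
  row_free B -> l != 0 -> B *m l = 0 ->
  all (fun s => gens s \in unitmx) fam ->
  degenerate fam -> degenerate (link B l fam).
Proof.
move=> freeB l0 Bl uV deg.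
have lift_p (p : 'cV[R]_n) : exists p', B *m p' = p.
  by exists (pinvmx B *m p); rewrite mulmxA (mulmxVp freeB) mul1mx.
case: deg => [deg0|[w [w0 wP]]].
  left=> p; have [p' <-] := lift_p p => off.
  have [t ht] := link_limit freeB l0 Bl uV off.
  have [off1 off2 ->] := ht t (lexx t).
  by rewrite !deg0 // subrr.
have [Bw|Bw] := eqVneq (B *m w) 0.
  left=> p; have [p' <-] := lift_p p => off.
  have [t ht] := link_limit freeB l0 Bl uV off.
  have [off1 off2 ->] := ht t (lexx t).
  have [a wE] := row_free_ker freeB l0 Bl Bw.
  have a0 : a != 0 by apply: contraNneq w0 => a0; rewrite wE a0 scale0r.
  have e : p' + t *: l = p' - t *: l + (2 * t / a) *: w.
    rewrite wE scalerA divfK // -addrA; congr (_ + _).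
    by rewrite -scaleNr -scalerDl; congr (_ *: _); ring.
  by rewrite e wP ?subrr // -e.
right; exists (B *m w); split=> // p t.
have [p' <-] := lift_p p; rewrite scalemxAr -mulmxDr => off1 off2.
have [t1 h1] := link_limit freeB l0 Bl uV off1.
have [t2 h2] := link_limit freeB l0 Bl uV off2.
have [|off1a off1b ->] := h1 (Num.max t1 t2); first by rewrite le_max lexx.
have [|off2a off2b ->] := h2 (Num.max t1 t2); first by rewrite le_max lexx orbT.
by move: off2a off2b; rewrite ![p' + _ *: w + _]addrAC => off2a off2b; rewrite !wP.
Qed.

(** The functional p -> ev p - ev l * (q *m p) kills l, because q *m l = 1; it is therefore an
    evaluation [ev'] on the quotient. The factors left over by the partial fraction at l are its
    values at the generators of the link, and [extreme_det] converts the volumes. *)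
Lemma partial_fraction_term n (q : 'rV[R]_n.+1) (B : 'M[R]_(n, n.+1)) l s
    (ev : 'cV[R]_n.+1 -> F) (ev' : 'cV[R]_n -> F) :
  scalar_linear inR ev -> row_free B -> B *m l = 0 -> (q *m l) 0 0 = 1 ->
  gens s \in unitmx -> (forall k, (q *m col k (gens s)) 0 0 != 0) -> ev l != 0 ->
  (forall p, ev' (B *m p) = ev p - ev l * inR ((q *m p) 0 0)) ->
  \sum_k (if (bounded_dirs s == [set: 'I_n.+1]%SET) &&
             (normalize q (col k (gens s)) == l) then
    inR (weight s * `|\det (gens s)|) * ((ev (col k (gens s)))^-1 *
     \prod_(j < n) (ev (col (lift k j) (gens s)) -
       ev (col k (gens s)) / inR ((q *m col k (gens s)) 0 0) *
       inR ((q *m col (lift k j) (gens s)) 0 0))^-1) else 0) =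
  (inR `|\det (insert_row ord0 q B)| * ev l)^-1 *
  (cone_form inR ev' (link_cone B l 1 s) + cone_form inR ev' (link_cone B l (-1) s)).
Proof.
move=> ev_lin freeB Bl ql uV qV evl ev'E.
have l0 : l != 0.
  by apply: contraTneq (oner_neq0 R) => l0; rewrite -ql l0 mulmx0 mxE eqxx.
rewrite cone_form_link //.
have [full|] := boolP (_ == [set: _]%SET); last first.
  by rewrite /= mulr0 => _; apply: big1.
set k0 := pivot (coords s l) => /=.
under eq_bigr do rewrite normalize_generator //.
rewrite (bigD1 k0) //= eqxx andbT [X in _ + X]big1 ?addr0 => [|k kk]; last first.
  by rewrite -/k0 (negbTE kk) andbF.
case: ifP => [gl|]; last by rewrite mulr0.
set lam := coords s l k0 0.
have lam0 : lam != 0 by apply/pivot_neq0/coords_neq0.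
have lE : l = lam *: col k0 (gens s) by apply: is_generatorE.
have qk : (q *m col k0 (gens s)) 0 0 = lam^-1.
  have := ql; rewrite {1}lE -scalemxAr mxE => /(canRL (mulKf lam0)).
  by rewrite mulr1.
have evk : ev (col k0 (gens s)) = ev l / inR lam.
  by rewrite lE (scalar_linearZ ev_lin) mulrC mulKf // fmorph_eq0.
have ug : insert_row ord0 q B \in unitmx.
  by apply: (insert_row_unit _ freeB Bl); rewrite ql oner_neq0.
have gB : row' ord0 (insert_row ord0 q B) *m l = 0 by rewrite row'_insert_row.
have := extreme_det gB l0 uV gl.
rewrite row_insert_row row'_insert_row ql normr1 mul1r -/k0 -/lam => detE.
have g0 : `|\det (insert_row ord0 q B)| != 0.
  by rewrite normr_eq0 -unitfE -unitmxE.
rewrite -detE [X in _ * (_ / X)](_ : _ = \prod_(j < n) (ev (col (lift k0 j) (gens s)) -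
   ev (col k0 (gens s)) / inR ((q *m col k0 (gens s)) 0 0) *
   inR ((q *m col (lift k0 j) (gens s)) 0 0))); last first.
  apply: eq_bigr => j _; rewrite ev'E evk qk fmorphV invrK divfK //.
  by rewrite fmorph_eq0.
rewrite prodfV evk; set P := \prod_(j < n) _.
have -> : weight s * Num.sg lam * (`|\det (insert_row ord0 q B)| * `|\det (gens s)| * `|lam|)
   = `|\det (insert_row ord0 q B)| * (weight s * `|\det (gens s)| * lam).
  by rewrite [in RHS](numEsg lam); ring.
rewrite !rmorphM invf_div !invfM.
have : inR `|\det (insert_row ord0 q B)| != 0 by rewrite fmorph_eq0.
move: (inR `|\det (insert_row ord0 q B)|) => D D0.
move: (P^-1) => Pi; field; by rewrite D0 evl.
Qed.

(** The generic line is t -> ev + t * q, and the form is wanted at t = 0. In dimension 0 the form is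
    just the image of the signed count, and there is no nonzero w. *)
Lemma fam_form_eq0 n (fam : seq (signed_cone R n)) (ev : 'cV[R]_n -> F) :
  scalar_linear inR ev -> all (fun s => gens s \in unitmx) fam ->
  (forall s j, s \in fam -> ev (col j (gens s)) != 0) ->
  degenerate fam -> fam_form inR ev fam = 0.
Proof.
elim: n fam ev => [|n IH] fam ev ev_lin uV ev0 deg.
  case: deg => [deg0|[w [w0 _]]]; last by case/eqP: w0; apply/colP; case.
  have /deg0/(congr1 inR) : all (fun s => off_walls s (0 : 'cV[R]_0)) fam.
    by apply/allP => s _; apply/forallP; case.
  rewrite rmorph0 rmorph_sum => h; rewrite -[RHS]h.
  apply: eq_bigr => s _; rewrite /cone_form det_mx00 normr1 big_ord0 invr1 !mulr1.
  rewrite [in_cone _ _](_ : _ = true) ?mulr1; last by apply/forallP; case.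
  by rewrite ifT //; apply/eqP/setP; case.
pose G := [seq col j (gens s) | s <- fam, j <- enum 'I_n.+1].
have GP s j : s \in fam -> col j (gens s) \in G.
  by move=> sf; apply: allpairs_f; rewrite ?mem_enum.
have Gev v : v \in G -> ev v != 0 by case/allpairsP => -[s j] [/= sf _ ->]; apply: ev0.
have Gn0 v : v \in G -> v != 0.
  by move/Gev; apply: contraNneq => ->; rewrite (scalar_linear0 ev_lin).
(* If this vanishes at q, the factors of v and w have the same pole on the line. It vanishes for all
   q only if v and w are proportional, so a generic q separates all normalized generators. *)
pose phi (vw : 'cV[R]_n.+1 * 'cV[R]_n.+1) (q : 'rV[R]_n.+1) : F :=
  ev vw.1 * inR ((q *m vw.2) 0 0) - ev vw.2 * inR ((q *m vw.1) 0 0).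
have phi_lin vw : scalar_linear inR (phi vw).
  move=> a u v; rewrite /phi !mulmxDl -!scalemxAl !mxE !rmorphD !rmorphM /=; ring.
pose psi (v : 'cV[R]_n.+1) (q : 'rV[R]_n.+1) : F := inR ((q *m v) 0 0).
have psi_lin v : scalar_linear inR (psi v).
  by move=> a u u'; rewrite /psi mulmxDl -scalemxAl !mxE rmorphD rmorphM.
pose chi (x : 'cV[R]_n.+1 * 'cV[R]_n.+1 + 'cV[R]_n.+1) :=
  match x with inl vw => phi vw | inr v => psi v end.
have [|q qP] := @common_nonzero _ _ inR _ _
    ([seq inl (v, w) | v <- G, w <- G] ++ [seq inr v | v <- G]) chi.
  by case.
have qG v : v \in G -> (q *m v) 0 0 != 0.
  move=> vG; have := qP (inr v); rewrite /= /psi fmorph_eq0; apply.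
    by rewrite mem_cat map_f ?orbT.
  have [i vi] : exists i, v i 0 != 0.
    apply/existsP; apply: contraNT (Gn0 v vG) => /existsPn h.
    by apply/eqP/colP => i; rewrite mxE; apply/eqP/negPn/h.
  by exists (delta_mx 0 i); rewrite -rowE mxE fmorph_eq0.
have qGG v w : v \in G -> w \in G -> normalize q v != normalize q w ->
    ev v * inR ((q *m w) 0 0) - ev w * inR ((q *m v) 0 0) != 0.
  move=> vG wG nvw; apply: (qP (inl (v, w))).
    by rewrite mem_cat allpairs_f.
  apply: contrapT => /forallNP none; case/eqP: nvw.
  have prop i : ev v * inR (w i 0) = ev w * inR (v i 0).
    have /negP/negPn/eqP := none (delta_mx 0 i).
    by rewrite /= /phi -!rowE !mxE => /eqP; rewrite subr_eq0 => /eqP.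
  have [i wi] : exists i, w i 0 != 0.
    apply/existsP; apply: contraNT (Gn0 w wG) => /existsPn h.
    by apply/eqP/colP => i; rewrite mxE; apply/eqP/negPn/h.
  have evv : ev v = ev w * inR (v i 0 / w i 0).
    by rewrite fmorph_div mulrA -prop mulfK // fmorph_eq0.
  have [c vE] : exists c, v = c *: w.
    exists (v i 0 / w i 0); apply/colP => j; rewrite [RHS]mxE; apply: (fmorph_inj inR); apply: (mulfI (Gev w wG)).
    by rewrite -prop evv -mulrA -rmorphM.
  have qvE : (q *m v) 0 0 = c * (q *m w) 0 0.
    by rewrite [in LHS]vE -scalemxAr mxE.
  have := qG v vG; rewrite /normalize qvE mulf_eq0 negb_or => /andP [c0 qw].
  by rewrite [in LHS]vE scalerA invfM mulrAC mulVf ?mul1r.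
rewrite /fam_form.
pose T (s : signed_cone R n.+1) (k : 'I_n.+1) : F :=
    inR (weight s * `|\det (gens s)|) * ((ev (col k (gens s)))^-1 *
     \prod_(j < n) (ev (col (lift k j) (gens s)) -
       ev (col k (gens s)) / inR ((q *m col k (gens s)) 0 0) *
       inR ((q *m col (lift k j) (gens s)) 0 0))^-1).
(* The poles on the line: one for each class of proportional generators, possibly shared by many
   cones. *)
pose L := undup [seq normalize q v | v <- G].
transitivity (\sum_(s <- fam) \sum_(l <- L) \sum_k
   if (bounded_dirs s == [set: 'I_n.+1]%SET) &&
             (normalize q (col k (gens s)) == l) then T s k else 0).
  apply: eq_big_seq => s sf; rewrite exchange_big /cone_form; case: ifP => _ /=; last first.
    by rewrite big1 // => k _; rewrite big1.
  rewrite -prodfV (@prod_inv_partial_fractions _ _ _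
     (fun j => inR ((q *m col j (gens s)) 0 0))) => [|j|j|j k jk].
  - rewrite mulr_sumr; apply: eq_bigr => k _.
    rewrite (bigD1_seq (normalize q (col k (gens s)))) ?undup_uniq //=; last first.
      by rewrite mem_undup map_f // GP.
    rewrite eqxx [X in _ + X]big1 ?addr0 // => l nl.
    by rewrite eq_sym (negbTE nl).
  - exact: ev0.
  - by rewrite fmorph_eq0 qG // GP.
  apply: qGG; rewrite ?GP //; apply: contraNneq jk => njk.
  have qn : (q *m normalize q (col k (gens s))) 0 0 = 1.
    by rewrite /normalize -scalemxAr mxE mulVf ?qG ?GP.
  have us := allP uV s sf.
  move/eqP: njk; rewrite (normalize_generator us qn) ?qG ?GP // => /andP [_ /eqP ->].
  have := eqxx (normalize q (col k (gens s))).
  by rewrite (normalize_generator us qn) ?qG ?GP // => /andP [_ /eqP <-].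
rewrite exchange_big big_seq big1 // => l.
rewrite mem_undup => /mapP [v vG lE].
have ql : (q *m l) 0 0 = 1 by rewrite lE /normalize -scalemxAr mxE mulVf ?qG.
have evl : ev l != 0.
  by rewrite lE (scalar_linearZ ev_lin) mulf_neq0 ?Gev // fmorph_eq0 invr_eq0 qG.
have l0 : l != 0 by apply: contraNneq evl => ->; rewrite (scalar_linear0 ev_lin).
have [B [freeB Bl]] := exists_hyperplane_basis l0.
(* [pinvmx B] chooses a lift from the quotient; the choice is harmless because the functional
   vanishes at l. *)
pose ev' (p : 'cV[R]_n) :=
  ev (pinvmx B *m p) - ev l * inR ((q *m (pinvmx B *m p)) 0 0).
have ev'_lin : scalar_linear inR ev'.
  move=> a u w; rewrite /ev' !mulmxDr -!scalemxAr ev_lin !mxE !rmorphD !rmorphM /=; ring.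
have ev'E p : ev' (B *m p) = ev p - ev l * inR ((q *m p) 0 0).
  have [|a aE] := row_free_ker freeB l0 Bl (_ : B *m (pinvmx B *m (B *m p) - p) = 0).
    by rewrite mulmxBr (mulmxA B (pinvmx B)) (mulmxVp freeB) mul1mx subrr.
  move/eqP: aE; rewrite subr_eq => /eqP; rewrite /ev' => ->.
  have scaleDE (c : R) (u w : 'M[R]_1) : (c *: u + w) 0 0 = c * u 0 0 + w 0 0.
    by rewrite !mxE.
  rewrite mulmxDr -scalemxAr ev_lin scaleDE ql mulr1 rmorphD /=; ring.
under eq_big_seq => s sf.
  rewrite (partial_fraction_term ev_lin freeB Bl ql (allP uV s sf) _ evl ev'E); last first.
    by move=> k; rewrite qG // GP.
  over.
rewrite -mulr_sumr big_split /=.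
have -> : \sum_(s <- fam) cone_form inR ev' (link_cone B l 1 s) +
    \sum_(s <- fam) cone_form inR ev' (link_cone B l (-1) s) =
    fam_form inR ev' (link B l fam).
  by rewrite /fam_form /link big_cat !big_map.
rewrite IH ?mulr0 //.
- by apply/allP => s'; rewrite mem_cat => /orP [] /mapP [s sf ->];
    apply: link_gens_unit => //; apply: (allP uV).
(* A zero here would give another generator of s the same pole as l, which the choice of q
   excludes. *)
- have col_ne s (sf : s \in fam) j :
      ev' (B *m col (lift (pivot (coords s l)) j) (gens s)) != 0.
    have cG := GP s (lift (pivot (coords s l)) j) sf.
    have nn : normalize q (col (lift (pivot (coords s l)) j) (gens s)) != normalize q v.
      rewrite -lE (normalize_generator (allP uV s sf) ql) ?qG //.
      by rewrite [_ == pivot _]eq_sym (negbTE (neq_lift _ _)) andbF.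
    apply: contraNneq (qGG _ _ cG vG nn); rewrite ev'E {2}lE.
    rewrite (scalar_linearZ ev_lin) fmorphV => e0.
    apply/eqP; rewrite -[RHS](mulr0 (inR ((q *m v) 0 0))) -[X in _ = _ * X]e0.
    by field; rewrite fmorph_eq0 qG.
  by move=> s' j; rewrite mem_cat => /orP [] /mapP [s sf ->];
    rewrite col_link_gens; apply: col_ne.
exact: degenerate_link.
Qed.

End ProductSums.

(** * Rational functions and projective charts *)

Section Specialization.
Variables (A : idomainType) (K : fieldType) (phi : {rmorphism A -> K}).
Implicit Types (f g : {fraction A}) (v w : K).

Local Notation "x %:F" := (@FracField.tofrac A x).

(* f is regular along the kernel of phi, with value v. *)
Definition specializes f v :=
  exists a b, [/\ f = a%:F / b%:F, phi b != 0 & v = phi a / phi b].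

Lemma rmorph_neq0 (a : A) : phi a != 0 -> a != 0.
Proof. by apply: contraNneq => ->; rewrite rmorph0. Qed.

Lemma specializes_uniq f v w : specializes f v -> specializes f w -> v = w.
Proof.
move=> [a [b [-> b0 ->]]] [c [d [e d0 ->]]].
have bF : b%:F != 0 by rewrite tofrac_eq0 rmorph_neq0.
have dF : d%:F != 0 by rewrite tofrac_eq0 rmorph_neq0.
move/eqP: e; rewrite eqr_div // -!rmorphM /= tofrac_eq => /eqP /(congr1 phi).
by rewrite !rmorphM => e; apply/eqP; rewrite eqr_div // e.
Qed.

Lemma specializes_tofrac a : specializes a%:F (phi a).
Proof. by exists a, 1; rewrite !rmorph1 !divr1; split=> //; apply: oner_neq0. Qed.

Lemma specializesD f g v w :
  specializes f v -> specializes g w -> specializes (f + g) (v + w).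
Proof.
move=> [a [b [-> b0 ->]]] [c [d [-> d0 ->]]].
have bF : b%:F != 0 by rewrite tofrac_eq0 rmorph_neq0.
have dF : d%:F != 0 by rewrite tofrac_eq0 rmorph_neq0.
exists (a * d + c * b), (b * d).
by rewrite !(rmorphM, rmorphD) mulf_neq0 // !addf_div.
Qed.

Lemma specializesM f g v w :
  specializes f v -> specializes g w -> specializes (f * g) (v * w).
Proof.
move=> [a [b [-> b0 ->]]] [c [d [-> d0 ->]]].
exists (a * c), (b * d).
by rewrite !rmorphM mulf_neq0 // !mulf_div.
Qed.

Lemma specializesV f v : v != 0 -> specializes f v -> specializes f^-1 v^-1.
Proof.
move=> v0 [a [b [-> b0 e]]]; exists b, a; rewrite e !invf_div; split => //.
by apply: contraNneq v0 => a0; rewrite e a0 mul0r.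
Qed.

Lemma specializesB f g v w :
  specializes f v -> specializes g w -> specializes (f - g) (v - w).
Proof.
move=> fv gw; rewrite -[- g]mulN1r -[- w]mulN1r; apply: specializesD => //.
apply: specializesM => //; rewrite -(rmorphN1 phi) -(rmorphN1 (@FracField.tofrac A)).
exact: specializes_tofrac.
Qed.

Lemma specializes0 : specializes 0 0.
Proof.
by exists 0, 1; rewrite !rmorph1 !rmorph0 !mul0r; split=> //; apply: oner_neq0.
Qed.

Lemma specializes_sum I (r : seq I) (P : pred I) (f : I -> {fraction A}) (v : I -> K) :
  (forall i, P i -> specializes (f i) (v i)) ->
  specializes (\sum_(i <- r | P i) f i) (\sum_(i <- r | P i) v i).
Proof.
move=> fv; apply: big_rec2 => [|i w g Pi]; last by apply: specializesD; apply: fv.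
by rewrite -(rmorph0 phi) -(@tofrac0 A); apply: specializes_tofrac.
Qed.

Lemma specializes_prod I (r : seq I) (P : pred I) (f : I -> {fraction A}) (v : I -> K) :
  (forall i, P i -> specializes (f i) (v i)) ->
  specializes (\prod_(i <- r | P i) f i) (\prod_(i <- r | P i) v i).
Proof.
move=> fv; apply: big_rec2 => [|i w g Pi]; last by apply: specializesM; apply: fv.
by rewrite -(rmorph1 phi) -(@tofrac1 A); apply: specializes_tofrac.
Qed.

Lemma specializesX f v n : specializes f v -> specializes (f ^+ n) (v ^+ n).
Proof.
move=> fv; elim: n => [|n IH]; last by rewrite !exprS; apply: specializesM.
by rewrite !expr0 -(rmorph1 phi) -(@tofrac1 A); apply: specializes_tofrac.
Qed.

End Specialization.

Lemma fraction_num_den (A : idomainType) (f : {fraction A}) :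
  f = FracField.tofrac (frac (repr f)).1 / FracField.tofrac (frac (repr f)).2.
Proof.
set x := repr f; have d0 : (frac x).2 != 0 by apply: denom_ratioP.
apply: (canRL (mulfK _)); first by rewrite tofrac_eq0.
rewrite -[f in LHS]reprK -/x.
rewrite -[_ * _]/(FracField.mul _ _) !piE; apply/eqmodP.
rewrite /= FracField.equivfE /FracField.mulf.
by rewrite !numden_Ratio ?mulf_neq0 ?oner_eq0 // !mulr1 mulrC.
Qed.

Section Polynomials.
Variable R : realType.

Lemma denominator_neq0 n (f : ratfun R n) : denominator f != 0.
Proof. exact: denom_ratioP. Qed.

HB.instance Definition _ n :=
  GRing.RMorphism.copy (@to_frac R n) (@FracField.tofrac (mpoly n R)).

HB.instance Definition _ n :=
  GRing.RMorphism.copy (@rconst R n) (@to_frac R n \o @mpolyC n R).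

HB.instance Definition _ m n (t : 'I_n -> ratfun R m) :=
  GRing.RMorphism.copy (poly_subst t) (mmap (@rconst R m) t).

Lemma rmorph_mpolyE n (S : comNzRingType) (phi : {rmorphism mpoly n R -> S}) p :
  phi p = mmap (phi \o @mpolyC n R) (fun i => phi (mpolyX R (mnm1 i))) p.
Proof.
rewrite {1}[p]mpolyE rmorph_sum; apply: eq_bigr => m _.
rewrite -mul_mpolyC rmorphM mpolyXE_id rmorph_prod /=; congr (_ * _).
by apply: eq_bigr => i _; rewrite rmorphXn.
Qed.

End Polynomials.

Section AffinePolynomials.
Variable R : realType.

Lemma affine_polyP n a (u v : 'cV[R]_n.+1) :
  affine_poly (a *: u + v) = a *: affine_poly u + affine_poly v.
Proof.
rewrite /affine_poly !mxE mpolyCD mpolyCM mul_mpolyC scalerDr addrACA.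
congr (_ + _); rewrite scaler_sumr -big_split /=; apply: eq_bigr => j _.
by rewrite !mxE scalerDl scalerA.
Qed.

Lemma affine_poly0 n : affine_poly (0 : 'cV[R]_n.+1) = 0.
Proof.
rewrite /affine_poly mxE mpolyC0 add0r big1 // => j _.
by rewrite mxE scale0r.
Qed.

Lemma affine_polyZ n a (u : 'cV[R]_n.+1) : affine_poly (a *: u) = a *: affine_poly u.
Proof. by rewrite -[a *: u]addr0 affine_polyP affine_poly0 addr0. Qed.

Lemma affine_poly_mulmx m n (g : 'M[R]_(m.+1, n)) (v : 'cV[R]_n) :
  affine_poly (g *m v) = \sum_i v i 0 *: affine_poly (col i g).
Proof.
have -> : g *m v = \sum_i v i 0 *: col i g.
  apply/colP => i; rewrite mxE summxE; apply: eq_bigr => j _.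
  by rewrite !mxE mulrC.
elim/big_rec2: _ => [|i p u _ <-]; first exact: affine_poly0.
exact: affine_polyP.
Qed.

Lemma mcoeff_affine0 n (v : 'cV[R]_n.+1) : mcoeff (@mnm0 n) (affine_poly v) = v ord0 0.
Proof.
rewrite /affine_poly mcoeffD mcoeffC eqxx mulr1 raddf_sum /= big1 ?addr0 // => j _.
by rewrite mcoeffZ mcoeffX mnm1_eq0 mulr0.
Qed.

Lemma mcoeff_affine1 n (v : 'cV[R]_n.+1) j :
  mcoeff (mnm1 j) (affine_poly v) = v (lift ord0 j) 0.
Proof.
rewrite /affine_poly mcoeffD mcoeffC mnm1_eq0 mulr0 add0r raddf_sum /= (bigD1 j) //=.
rewrite mcoeffZ mcoeffXU eqxx mulr1 big1 ?addr0 // => i ij.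
by rewrite mcoeffZ mcoeffXU (negbTE ij) mulr0.
Qed.

Lemma affine_poly_eq0 n (v : 'cV[R]_n.+1) : (affine_poly v == 0) = (v == 0).
Proof.
apply/eqP/eqP => [v0|->]; last exact: affine_poly0.
apply/colP => i; rewrite mxE; case: (unliftP ord0 i) => [j ->|->].
  by rewrite -mcoeff_affine1 v0 mcoeff0.
by rewrite -mcoeff_affine0 v0 mcoeff0.
Qed.

Lemma affine_poly_delta0 n : affine_poly (delta_mx ord0 0 : 'cV[R]_n.+1) = 1.
Proof.
rewrite /affine_poly mxE eqxx big1 ?addr0 // => j _.
by rewrite mxE andbT scale0r.
Qed.

Lemma affine_poly_delta1 n j :
  affine_poly (delta_mx (lift ord0 j) 0 : 'cV[R]_n.+1) = mpolyX R (mnm1 j).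
Proof.
rewrite /affine_poly mxE /= mpolyC0 add0r (bigD1 j) //= big1 ?addr0 => [|i ij].
  by rewrite mxE !eqxx scale1r.
by rewrite mxE (inj_eq (@lift_inj _ _)) (negbTE ij) scale0r.
Qed.

Lemma rmorph_affine n (S : comNzRingType) (phi : {rmorphism mpoly n R -> S}) v :
  phi (affine_poly v) =
  phi (mpolyC n (v ord0 0)) +
  \sum_j phi (mpolyC n (v (lift ord0 j) 0)) * phi (mpolyX R (mnm1 j)).
Proof.
rewrite rmorphD rmorph_sum; congr (_ + _); apply: eq_bigr => j _ /=.
by rewrite -mul_mpolyC rmorphM.
Qed.

Lemma mderiv_affine n j (v : 'cV[R]_n.+1) :
  mderiv j (affine_poly v) = mpolyC n (v (lift ord0 j) 0).
Proof.
rewrite /affine_poly mderivD mderivC add0r raddf_sum /= (bigD1 j) //=.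
rewrite mderivZ mderivX mnm1E eqxx -{1}[mnm1 j]add0m addmK mpolyX0 scale1r big1 ?addr0 => [|i ij].
  by rewrite -mul_mpolyC mulr1.
by rewrite mderivZ mderivX mnm1E (negbTE ij) scale0r scaler0.
Qed.

End AffinePolynomials.

Section Charts.
Variables (R : realType) (n : nat).
Implicit Types (g : 'M[R]_n.+1) (f : ratfun R n).

Local Notation aff v := (to_frac (affine_poly v)).

Lemma poly_substC m (t : 'I_n -> ratfun R m) c : poly_subst t (mpolyC n c) = rconst m c.
Proof. exact: mmapC. Qed.

Lemma poly_substX m (t : 'I_n -> ratfun R m) i : poly_subst t (mpolyX R (mnm1 i)) = t i.
Proof. by rewrite /poly_subst mmapX mmap1U. Qed.

Lemma to_frac_eq0 (p : mpoly n R) : (to_frac p == 0) = (p == 0).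
Proof. exact: tofrac_eq0. Qed.

Lemma to_frac_inj : injective (@to_frac R n).
Proof. by move=> p q /eqP; rewrite /to_frac tofrac_eq => /eqP. Qed.

Lemma rconstE (c : R) : rconst n c = @to_frac R n (mpolyC n c). Proof. by []. Qed.

Lemma to_fracZ c (p : mpoly n R) : to_frac (c *: p) = rconst n c * to_frac p.
Proof. by rewrite -mul_mpolyC rmorphM. Qed.

(** [rat_deriv] is defined on the chosen numerator and denominator; differentiating the
    cross-multiplied equality of two fractions shows that the choice is irrelevant. *)
Lemma rat_derivE j (a b : mpoly n R) : b != 0 ->
  rat_deriv j (to_frac a / to_frac b) =
  to_frac (mderiv j a * b - a * mderiv j b) / to_frac (b ^+ 2).
Proof.
move=> b0; rewrite /rat_deriv; set f := to_frac a / _.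
have d0 : denominator f != 0 by apply: denominator_neq0.
have := fraction_num_den f; rewrite -[(frac _).1]/(numerator f) -[(frac _).2]/(denominator f).
move: (numerator f) (denominator f) d0 => p q q0.
move/eqP; rewrite /f eqr_div ?to_frac_eq0 // -!rmorphM /= => /eqP/to_frac_inj e.
have /(congr1 (mderiv j)) := e; rewrite !mderivM => e'.
apply/eqP; rewrite eqr_div ?to_frac_eq0 ?expf_neq0 // -!rmorphM /=; apply/eqP; congr to_frac.
move: (mderiv j a) (mderiv j b) (mderiv j p) (mderiv j q) e' => a' b' p' q' e'.
have -> : (p' * q - p * q') * b ^+ 2 = (p' * b + p * b') * (b * q) - (p * b) * (b * q' + b' * q).
  by ring.
by rewrite -e' -e; ring.
Qed.

Lemma quotient_rule_simpl (K : fieldType) (x y a b : K) : b != 0 ->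
  (x * b - a * y) / b ^+ 2 = b^-1 * (x - y * (a / b)).
Proof. by move=> b0; field. Qed.

(** Adding u times the lower rows to the first row turns it into a * (1, t); column operations then
    clear t, and the corner a splits off. *)
Lemma det_block_shear (K : comNzRingType) d (u t : 'rV[K]_d) (a : K)
    (G : 'M[K]_(1 + d)) :
  ulsubmx G + u *m dlsubmx G = a%:M ->
  ursubmx G + u *m drsubmx G = a *: t ->
  \det G = a * \det (drsubmx G - dlsubmx G *m t).
Proof.
move=> e1 e2; pose U := block_mx (1%:M : 'M[K]_1) u 0 (1%:M : 'M[K]_d).
pose W := block_mx (1%:M : 'M[K]_1) (- t) 0 (1%:M : 'M[K]_d).
have -> : \det G = \det (U *m G *m W).
  by rewrite !det_mulmx !det_ublock !det1 !mul1r mulr1.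
rewrite -{1}[G]submxK !mulmx_block !mul1mx !mul0mx !add0r !mulmx1 !mulmx0 !addr0.
rewrite e1 e2 mul_scalar_mx scalerN addNr det_lblock det_scalar1.
by rewrite mulmxN addrC.
Qed.

Lemma to_frac_affine (c : 'cV[R]_n.+1) :
  aff c = rconst n (c ord0 0) + \sum_j rconst n (c (lift ord0 j) 0) * rvar R j.
Proof. by rewrite (rmorph_affine (@to_frac R n)). Qed.

(** By the quotient rule the Jacobian matrix is, up to transposition, b^-1 times the block that
    remains after the shear of g by the vector of variables, where b is the common denominator of
    the chart. The scaling gives b^-n, and the corner one more factor b^-1. *)
Lemma chart_jacobian g : g \in unitmx ->
  \det (\matrix_(i < n, j < n) rat_deriv j (chart_map g i)) =
  rconst n (\det g) / aff (col ord0 g) ^+ n.+1.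
Proof.
move=> ug; set b := aff (col ord0 g).
have b0 : b != 0.
  rewrite /b to_frac_eq0 affine_poly_eq0; apply: contraTneq ug => g0.
  by rewrite unitmxE (expand_det_col _ ord0) big1 ?unitr0 // => i _;
    move/colP/(_ i): g0; rewrite !mxE => ->; rewrite mul0r.
pose G : 'M[ratfun R n]_(1 + n) := map_mx (@rconst R n) g.
pose u : 'rV[ratfun R n]_n := \row_j rvar R j.
pose t : 'rV[ratfun R n]_n := \row_i chart_map g i.
have aE i : aff (col i g) = G ord0 i + \sum_j G (lift ord0 j) i * u ord0 j.
  rewrite to_frac_affine !mxE; congr (_ + _); apply: eq_bigr => j _.
  by rewrite !mxE.
have GE : rconst n (\det g) = \det G by rewrite det_map_mx.
have ulE : ulsubmx G 0 0 = G ord0 ord0.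
  by rewrite !mxE; congr (rconst _ (g _ _)); apply: val_inj.
have urE i : ursubmx G 0 i = G ord0 (lift ord0 i).
  by rewrite !mxE; congr (rconst _ (g _ _)); apply: val_inj.
have dlE k : dlsubmx G k 0 = G (lift ord0 k) ord0.
  by rewrite !mxE; congr (rconst _ (g _ _)); apply: val_inj.
have drE k i : drsubmx G k i = G (lift ord0 k) (lift ord0 i).
  by rewrite !mxE; congr (rconst _ (g _ _)); apply: val_inj.
have e1 : ulsubmx G + u *m dlsubmx G = b%:M.
  apply/matrixP => i j; rewrite !ord1 [RHS]mxE eqxx mulr1n /b aE [LHS]mxE ulE.
  congr (_ + _); rewrite [LHS]mxE.
  by apply: eq_bigr => k _; rewrite mulrC dlE.
have e2 : ursubmx G + u *m drsubmx G = b *: t.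
  apply/matrixP => i j; rewrite !ord1 [RHS]mxE [t _ _]mxE /chart_map -/b mulrC divfK //.
  rewrite aE [LHS]mxE urE; congr (_ + _); rewrite [LHS]mxE.
  by apply: eq_bigr => k _; rewrite mulrC drE.
have -> : \matrix_(i, j) rat_deriv j (chart_map g i) =
    b^-1 *: (drsubmx G - dlsubmx G *m t)^T.
  apply/matrixP => i j.
  have b0' : affine_poly (col ord0 g) != 0 by rewrite -to_frac_eq0.
  rewrite [LHS]mxE rat_derivE // !mderiv_affine.
  have -> : (b^-1 *: (drsubmx G - dlsubmx G *m t)^T) i j =
      b^-1 * (drsubmx G j i - dlsubmx G j 0 * t 0 i).
    rewrite [LHS]mxE; congr (_ * _); rewrite [LHS]mxE [LHS]mxE; congr (_ + _).
    by rewrite [LHS]mxE; congr (- _); rewrite [LHS]mxE big_ord1.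
  rewrite [t _ _]mxE /chart_map.
  rewrite drE dlE [G _ _]mxE [G _ _]mxE ![col _ g _ _]mxE.
  rewrite rmorphB !rmorphM /= -!rconstE -/b.
  exact: quotient_rule_simpl.
rewrite detZ det_tr GE (det_block_shear e1 e2) exprS exprVn.
by rewrite invfM [b * \det _]mulrC mulrA mulfK // mulrC.
Qed.

End Charts.

Section ChartForms.
Variables (R : realType) (n : nat).
Implicit Types (g : 'M[R]_n.+1) (f w : ratfun R n).

Local Notation aff v := (to_frac (affine_poly v)).

Lemma affine_frac_linear : scalar_linear (@rconst R n) (fun v => aff v).
Proof.
by move=> a u v; rewrite affine_polyP rmorphD /= to_fracZ.
Qed.

Lemma unitmx_mul_neq0 g m (v : 'M[R]_(n.+1, m)) : g \in unitmx -> v != 0 -> g *m v != 0.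
Proof.
by move=> ug; apply: contraNneq => gv; rewrite -(mulKmx ug v) gv mulmx0.
Qed.

Lemma col_unit_neq0 g j : g \in unitmx -> col j g != 0.
Proof.
move=> ug; rewrite colE; apply: unitmx_mul_neq0 => //.
by apply/eqP => /colP/(_ j); rewrite !mxE !eqxx => /eqP; rewrite oner_eq0.
Qed.

Lemma affine_frac_neq0 (v : 'cV[R]_n.+1) : v != 0 -> aff v != 0.
Proof. by rewrite to_frac_eq0 affine_poly_eq0. Qed.

Lemma chart_subst_affine g v : g \in unitmx ->
  poly_subst (chart_map g) (affine_poly v) = aff (g *m v) / aff (col ord0 g).
Proof.
move=> ug; have b0 : aff (col ord0 g) != 0 by apply/affine_frac_neq0/col_unit_neq0.
rewrite (rmorph_affine (poly_subst (chart_map g))) /= poly_substC.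
rewrite affine_poly_mulmx rmorph_sum big_ord_recl mulrDl /= to_fracZ mulfK //.
congr (_ + _); rewrite mulr_suml; apply: eq_bigr => j _ /=.
by rewrite poly_substC poly_substX to_fracZ mulrA.
Qed.

Lemma poly_subst_rvar (p : mpoly n R) : poly_subst (@rvar R n) p = to_frac p.
Proof. by rewrite (rmorph_mpolyE (@to_frac R n)). Qed.

Lemma specializes_poly_subst m (K : fieldType) (phi : {rmorphism mpoly n R -> K})
    (t : 'I_m -> ratfun R n) (v : 'I_m -> K) (p : mpoly m R) :
  (forall i, specializes phi (t i) (v i)) ->
  specializes phi (poly_subst t p) (mmap (phi \o @mpolyC n R) v p).
Proof.
move=> tv; apply: specializes_sum => mm _; apply: specializesM.
  exact: specializes_tofrac.
by apply: specializes_prod => i _; apply: specializesX.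
Qed.

(** The chart of [invmx g] undoes the chart of g: under the substitution it defines, [chart_map g i]
    specializes to the variable i. *)
Lemma chart_subst_eq0 g p : g \in unitmx ->
  (poly_subst (chart_map g) p == 0) = (p == 0).
Proof.
move=> ug; apply/eqP/eqP => [p0|->]; last exact: rmorph0.
have uV : invmx g \in unitmx by rewrite unitmx_inv.
pose phi : {rmorphism mpoly n R -> ratfun R n} := poly_subst (chart_map (invmx g)).
have sp i : specializes phi (chart_map g i) (rvar R i).
  exists (affine_poly (col (lift ord0 i) g)), (affine_poly (col ord0 g)).
  have c0 j : aff (col j g) != 0 by apply/affine_frac_neq0/col_unit_neq0.
  have c0' j : aff (col j (invmx g)) != 0 by apply/affine_frac_neq0/col_unit_neq0.
  have e0 : invmx g *m col ord0 g = delta_mx ord0 0 by rewrite colE mulKmx.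
  have ei : invmx g *m col (lift ord0 i) g = delta_mx (lift ord0 i) 0.
    by rewrite colE mulKmx.
  split=> //; rewrite /phi /= !chart_subst_affine // e0 affine_poly_delta0.
    by rewrite rmorph1 mulf_neq0 ?oner_neq0 ?invr_eq0.
  by rewrite ei affine_poly_delta1 rmorph1 mul1r invrK divfK.
have := specializes_poly_subst p sp.
rewrite p0 => /(specializes_uniq (specializes_tofrac phi 0)).
rewrite rmorph0 => e; apply: (@to_frac_inj R n); rewrite rmorph0 e -poly_subst_rvar.
by apply: eq_bigr => mm _; rewrite /phi /= poly_substC.
Qed.

(** With uniqueness of specializations, this lets [rat_comp] be computed from any representation of
    f whose denominator survives. *)
Lemma specializes_rat_comp g f : g \in unitmx ->
  specializes (poly_subst (chart_map g)) f (rat_comp (chart_map g) f).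
Proof.
move=> ug; exists (numerator f), (denominator f); split=> //.
  exact: fraction_num_den.
by rewrite /= chart_subst_eq0 // denominator_neq0.
Qed.

Lemma rat_comp_eq g f v : g \in unitmx ->
  specializes (poly_subst (chart_map g)) f v -> rat_comp (chart_map g) f = v.
Proof. by move=> ug; apply: specializes_uniq; apply: specializes_rat_comp. Qed.

Lemma form_in_chartE g w : g \in unitmx ->
  form_in_chart g w =
  rat_comp (chart_map g) w * (rconst n (\det g) / aff (col ord0 g) ^+ n.+1).
Proof. by move=> ug; rewrite /form_in_chart /pullback chart_jacobian. Qed.

Lemma form_in_chartB g w w' : g \in unitmx ->
  form_in_chart g (w - w') = form_in_chart g w - form_in_chart g w'.
Proof.
move=> ug; rewrite !form_in_chartE // -mulrBl; congr (_ * _).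
by apply: rat_comp_eq => //; apply: specializesB; apply: specializes_rat_comp.
Qed.

Lemma form_in_chart0 g : g \in unitmx -> form_in_chart g 0 = 0.
Proof. by move=> ug; have := form_in_chartB 0 0 ug; rewrite !subrr. Qed.

Lemma form_in_chart1 w : form_in_chart 1%:M w = w.
Proof.
rewrite form_in_chartE ?unitmx1 // col1 affine_poly_delta0 det1 !rmorph1.
rewrite expr1n divr1 mulr1; apply: rat_comp_eq; first exact: unitmx1.
exists (numerator w), (denominator w).
have tE (p : mpoly n R) : poly_subst (chart_map (1%:M : 'M[R]_n.+1)) p = to_frac p.
  rewrite -poly_subst_rvar; apply: eq_bigr => mm _; congr (_ * _).
  apply: eq_bigr => i _; rewrite /chart_map !col1 affine_poly_delta0.
  by rewrite affine_poly_delta1 rmorph1 divr1.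
rewrite /= !tE; split; [exact: fraction_num_den | | exact: fraction_num_den].
by rewrite to_frac_eq0 denominator_neq0.
Qed.

Lemma specializes_rconst g c :
  specializes (poly_subst (chart_map g)) (rconst n c) (rconst n c).
Proof.
have := specializes_tofrac (poly_subst (chart_map g)) (mpolyC n c).
by rewrite /= poly_substC.
Qed.

(** Homogeneity: each of the n + 1 generators in a denominator contributes one factor
    [aff (col ord0 g)] to the numerator, and together they cancel the denominator of the
    Jacobian. *)
Lemma form_in_chart_fam g (fam : seq (signed_cone R n.+1)) :
  g \in unitmx -> all (fun s => gens s \in unitmx) fam ->
  form_in_chart g (fam_form (@rconst R n) (fun v => aff v) fam) =
  rconst n (\det g) * fam_form (@rconst R n) (fun v => aff (g *m v)) fam.
Proof.
move=> ug /allP uV; have b0 : aff (col ord0 g) != 0.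
  exact/affine_frac_neq0/col_unit_neq0.
rewrite form_in_chartE //.
rewrite (@rat_comp_eq g _ (fam_form (@rconst R n) (fun v => aff (g *m v)) fam *
  aff (col ord0 g) ^+ n.+1)) //.
  by rewrite -mulrA [_ ^+ _ * _]mulrCA mulfV ?expf_neq0 // mulr1 mulrC.
rewrite /fam_form mulr_suml big_seq [in X in specializes _ _ X]big_seq.
apply: specializes_sum => s /uV us; rewrite /cone_form; case: ifP => _; last first.
  by rewrite mul0r; apply: specializes0.
rewrite mulrAC -mulrA; apply: specializesM.
  exact: specializes_rconst.
have -> : aff (col ord0 g) ^+ n.+1 / \prod_j aff (g *m col j (gens s)) =
    \prod_j (aff (g *m col j (gens s)) / aff (col ord0 g))^-1.
  rewrite -[X in _ ^+ X]card_ord -prodr_const -prodfV -big_split /=.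
  by apply: eq_bigr => j _; rewrite invf_div.
rewrite -[X in specializes _ X _]prodfV; apply: specializes_prod => j _; rewrite -chart_subst_affine //.
apply: specializesV; last exact: specializes_tofrac.
by rewrite /= chart_subst_eq0 // affine_poly_eq0 col_unit_neq0.
Qed.

End ChartForms.

(** * Restriction to hyperplanes, and poles along them *)

Section AffineSubstitution.
Variable R : realType.

Definition affine_subst m n (Q : 'M[R]_(m.+1, n.+1)) (p : mpoly n R) : mpoly m R :=
  mmap (@mpolyC m R) (fun i => affine_poly (col (lift ord0 i) Q)) p.

HB.instance Definition _ m n (Q : 'M[R]_(m.+1, n.+1)) :=
  GRing.RMorphism.copy (affine_subst Q)
    (mmap (@mpolyC m R) (fun i => affine_poly (col (lift ord0 i) Q))).

Lemma affine_substC m n (Q : 'M[R]_(m.+1, n.+1)) c :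
  affine_subst Q (mpolyC n c) = mpolyC m c.
Proof. exact: mmapC. Qed.

Lemma affine_subst_affine m n (Q : 'M[R]_(m.+1, n.+1)) v :
  col ord0 Q = delta_mx ord0 0 ->
  affine_subst Q (affine_poly v) = affine_poly (Q *m v).
Proof.
move=> Q0; rewrite (rmorph_affine (affine_subst Q)) /= affine_poly_mulmx.
rewrite big_ord_recl Q0 affine_poly_delta0 affine_substC -mul_mpolyC mulr1.
congr (_ + _); apply: eq_bigr => j _ /=.
by rewrite affine_substC -mul_mpolyC /affine_subst mmapX mmap1U.
Qed.

Lemma restrict_polyE n (p : mpoly n.+1 R) :
  restrict_poly p = affine_subst (row' (lift ord0 ord0) 1%:M) p.
Proof.
apply: eq_bigr => mm _; congr (_ * _); apply: eq_bigr => i _; congr (_ ^+ _).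
set L := lift ord0 ord0.
have colE' : col (lift ord0 i) (row' L 1%:M) = row' L (delta_mx (lift ord0 i) 0) :> 'cV[R]_n.+1.
  by apply/colP => r; rewrite !mxE andbT.
rewrite colE'; case: (unliftP ord0 i) => [j ->|->].
  rewrite -affine_poly_delta1; congr affine_poly; apply/colP => r; rewrite !mxE eqxx !andbT.
  congr (_%:R); congr nat_of_bool; rewrite -!val_eqE /= /bump /=.
  by case: (nat_of_ord r).
have -> : row' L (delta_mx (lift ord0 ord0) 0) = 0 :> 'cV[R]_n.+1.
  by apply/colP => r; rewrite !mxE eq_sym (negbTE (neq_lift L r)).
by rewrite affine_poly0.
Qed.

Lemma row'1_col0 n :
  col ord0 (row' (lift ord0 ord0) (1%:M : 'M[R]_n.+2)) = delta_mx ord0 0.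
Proof.
apply/colP => r; rewrite !mxE andbT.
congr (_%:R); congr nat_of_bool; rewrite -!val_eqE /= /bump /=.
by case: (nat_of_ord r).
Qed.

End AffineSubstitution.

Section Hyperplane.
Variables (R : realType) (n : nat) (L : 'cV[R]_n.+2) (J : 'I_n.+2).
Hypotheses (J_neq0 : J != ord0) (LJ : L J 0 != 0).

Let Q := hyper_proj L J.
Let C : 'M[R]_(n.+2, n.+1) := col' J 1%:M.

Lemma lift_neq0 : lift J ord0 = ord0.
Proof.
apply: val_inj => /=; rewrite /bump leqn0.
by have := J_neq0; rewrite -val_eqE /= => /negbTE ->.
Qed.

Lemma hyper_proj_col0 : col ord0 Q = delta_mx ord0 0.
Proof.
rewrite colE hyper_projE [delta_mx _ _ J 0]mxE (negbTE J_neq0) mul0r scale0r subr0.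
apply/colP => i; rewrite !mxE !andbT -(inj_eq (@lift_inj _ J)).
by rewrite lift_neq0.
Qed.

Lemma hyper_incl_col0 : col ord0 C = delta_mx ord0 0.
Proof. by apply/colP => i; rewrite !mxE lift_neq0 andbT. Qed.

(** Restriction to {L = 0}, parametrized by the coordinates other than J. Its values lie in a field
    and its kernel is generated by [affine_poly L], so it shows at once that L is prime and which
    fractions are regular along L. *)
Definition hyper_rmorph : {rmorphism mpoly n.+1 R -> ratfun R n} :=
  @to_frac R n \o affine_subst Q.

Lemma hyper_rmorph_affine v : hyper_rmorph (affine_poly v) = to_frac (affine_poly (Q *m v)).
Proof. by rewrite /= affine_subst_affine // hyper_proj_col0. Qed.

Lemma hyper_rmorph_self : hyper_rmorph (affine_poly L) = 0.
Proof. by rewrite hyper_rmorph_affine hyper_proj_self // affine_poly0 rmorph0. Qed.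

(** Modulo L the variable J can be eliminated, and Q followed by C does just that. The property is
    stable under sums and products, so constants and variables suffice. *)
Lemma hyper_decompose (p : mpoly n.+1 R) :
  poly_dvd (affine_poly L) (p - affine_subst C (affine_subst Q p)).
Proof.
pose D (p : mpoly n.+1 R) :=
  poly_dvd (affine_poly L) (p - affine_subst C (affine_subst Q p)).
have DD p1 p2 : D p1 -> D p2 -> D (p1 + p2).
  move=> [a1 e1] [a2 e2]; exists (a1 + a2).
  by rewrite mulrDl -e1 -e2 !rmorphD; ring.
have DM p1 p2 : D p1 -> D p2 -> D (p1 * p2).
  move=> [a1 e1] [a2 e2].
  exists (a1 * p2 + affine_subst C (affine_subst Q p1) * a2).
  by rewrite mulrDl mulrAC -e1 -mulrA -e2 !rmorphM; ring.
have DC c : D (mpolyC _ c).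
  by exists 0; rewrite !affine_substC mul0r subrr.
have DX i : D (mpolyX R (mnm1 i)).
  rewrite /D -affine_poly_delta1; set v := delta_mx _ _.
  rewrite !affine_subst_affine ?hyper_proj_col0 ?hyper_incl_col0 //.
  (* The multiple of L that removes coordinate J from v; it is zero unless v is the eliminated
     variable. *)
  exists (mpolyC _ (v J 0 / L J 0)); rewrite mul_mpolyC -affine_polyZ.
  rewrite hyper_projE mul_col'_row'; last by rewrite colBZE divfK ?subrr.
  by rewrite mul1mx -scaleN1r addrC -affine_polyP scaleN1r opprB subrK.
rewrite -/(D p) [p]mpolyE; apply: (big_ind D); [by rewrite -(mpolyC0 _ R); apply: DC | exact: DD | move=> mm _].
rewrite -mul_mpolyC mpolyXE_id; apply: (DM) => //.
apply: (big_ind D); [by rewrite -(mpolyC1 _ R); apply: DC | exact: DM | move=> i _].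
elim: (mm i) => [|k IH]; first by rewrite expr0 -(mpolyC1 _ R); apply: DC.
rewrite exprS; exact: (DM _ _ (DX i) IH).
Qed.

Lemma hyper_kernel (p : mpoly n.+1 R) :
  hyper_rmorph p = 0 -> poly_dvd (affine_poly L) p.
Proof.
move/eqP; rewrite /= to_frac_eq0 => /eqP Qp0.
by have := hyper_decompose p; rewrite Qp0 rmorph0 subr0.
Qed.

End Hyperplane.

(** Here k is the pole order minus one: the equation compares l * f = p / q, regular along l, with f
    = a / (c * l ^ (k + 1) * b). *)
Lemma simple_pole_arith (A : idomainType) (K : fieldType) (phi : {rmorphism A -> K})
    (l a b c p q : A) k :
  phi l = 0 -> phi a != 0 -> phi q != 0 -> a * q = p * (c * l ^+ k * b) ->
  k = 0%N /\ phi p / phi q != 0.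
Proof.
move=> l0 a0 q0 /(congr1 phi); rewrite !rmorphM => e.
have := mulf_neq0 a0 q0; rewrite e; case: k {e} => [|k].
  rewrite mulf_eq0 negb_or => /andP [p0 _]; split=> //.
  by rewrite mulf_neq0 ?invr_eq0.
by rewrite exprS rmorphM l0 mul0r mulr0 mul0r mulr0 eqxx.
Qed.

Section HyperplanePoles.
Variables (R : realType) (n : nat).
Implicit Types (L : 'cV[R]_n.+2) (J : 'I_n.+2) (p q a b : mpoly n.+1 R).

Lemma hyper_dvdP L J p : J != ord0 -> L J 0 != 0 ->
  poly_dvd (affine_poly L) p <-> hyper_rmorph L J p = 0.
Proof.
move=> J0 LJ; split=> [[a ->]|]; last exact: hyper_kernel.
by rewrite rmorphM hyper_rmorph_self // mulr0.
Qed.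

Lemma affine_not_unit L J : J != ord0 -> L J 0 != 0 ->
  affine_poly L \isn't a GRing.unit.
Proof.
move=> J0 LJ; apply/negP => /mulVr /(congr1 (hyper_rmorph L J)) /eqP.
by rewrite rmorphM rmorph1 hyper_rmorph_self // mulr0 eq_sym oner_eq0.
Qed.

Lemma mpoly_unitP q : q \is a GRing.unit -> exists2 c : R, c != 0 & q = mpolyC _ c.
Proof.
move/andP => [/eqP qE uq]; exists (mcoeff (@mnm0 n.+1) q); last exact: qE.
by rewrite -unitfE.
Qed.

Lemma irreducible_associate L J q : J != ord0 -> L J 0 != 0 ->
  irreducible_mpoly q -> poly_dvd (affine_poly L) q ->
  exists2 c, c != 0 & q = c *: affine_poly L.
Proof.
move=> J0 LJ [_ irr] [a qE]; case: (irr _ _ qE) => [/mpoly_unitP [c c0 aE]|].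
  by exists c => //; rewrite qE aE mul_mpolyC.
by rewrite (negbTE (affine_not_unit J0 LJ)).
Qed.

Lemma poly_dvdZ c p q : c != 0 -> poly_dvd (c *: q) p <-> poly_dvd q p.
Proof.
move=> c0; split=> [[a ->]|[a ->]]; first by exists (c *: a); rewrite -scalerAl scalerAr.
by exists (c^-1 *: a); rewrite -scalerAl -scalerAr scalerA mulVf // scale1r.
Qed.

Lemma pole_specializes L J c f k v : J != ord0 -> L J 0 != 0 -> c != 0 -> (0 < k)%N ->
  pole_of_order f (c *: affine_poly L) k ->
  specializes (hyper_rmorph L J) (to_frac (affine_poly L) * f) v ->
  k = 1%N /\ v != 0.
Proof.
move=> J0 LJ c0; case: k => // k _ [a [b [fE na nb]]] [p [q [e q0 vE]]].
have l0 : affine_poly L != 0.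
  by rewrite affine_poly_eq0; apply: contraNneq LJ => ->; rewrite mxE.
have b0 : b != 0.
  by apply/eqP => b0; apply: nb; exists 0; rewrite b0 mul0r.
have q0' : q != 0 by apply: rmorph_neq0 q0.
have ql0 : c *: affine_poly L != 0 by rewrite scaler_eq0 negb_or c0.
have {}e : a * q = p * (mpolyC _ (c ^+ k.+1) * affine_poly L ^+ k * b).
  move: e; rewrite fE mulrA -!rmorphM => /eqP.
  rewrite eqr_div ?to_frac_eq0 ?mulf_neq0 ?expf_neq0 // -!rmorphM => /eqP /to_frac_inj.
  move=> e; apply: (mulfI l0); rewrite [LHS]mulrA e exprZn [affine_poly L ^+ _.+1]exprS.
  by rewrite -!mul_mpolyC; ring.
have a0 : hyper_rmorph L J a != 0.
  by apply: contra_notN na => /eqP a0; apply/poly_dvdZ => //; apply/(hyper_dvdP _ J0 LJ).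
rewrite vE.
by have [-> ] := simple_pole_arith (hyper_rmorph_self J0 LJ) a0 q0 e.
Qed.

Lemma specializes_pole L J c f v : J != ord0 -> L J 0 != 0 -> c != 0 -> v != 0 ->
  specializes (hyper_rmorph L J) (to_frac (affine_poly L) * f) v ->
  pole_of_order f (c *: affine_poly L) 1.
Proof.
move=> J0 LJ c0 v0 [p [q [e q0 vE]]].
have l0 : to_frac (affine_poly L) != 0.
  by rewrite to_frac_eq0 affine_poly_eq0; apply: contraNneq LJ => ->; rewrite mxE.
exists (c *: p), q; split.
- rewrite expr1 -scalerAl !to_fracZ rmorphM.
  rewrite -mulf_div divff ?mul1r; last first.
    by rewrite rconstE to_frac_eq0 mpolyC_eq0.
  by rewrite invfM mulrCA -e mulKf.
- move/(poly_dvdZ _ _ c0)/(hyper_dvdP _ J0 LJ) => /eqP.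
  rewrite -mul_mpolyC rmorphM mulf_eq0 /= affine_substC -rconstE fmorph_eq0 (negbTE c0).
  by move=> p0; case/eqP: v0; rewrite vE /= (eqP p0) mul0r.
move/(poly_dvdZ _ _ c0)/(hyper_dvdP _ J0 LJ) => q0'.
by rewrite q0' eqxx in q0.
Qed.

(** A substitute for unique factorization: an affine polynomial is the kernel of a morphism to a
    field, so it divides N or q. In the first case it is cancelled from both sides; in the second it
    is associated with q. *)
Lemma irreducible_factor_affine (Ls : seq 'cV[R]_n.+2) q a N :
  irreducible_mpoly q -> ~ poly_dvd q a -> all (fun L => L != 0) Ls ->
  a * \prod_(L <- Ls) affine_poly L = N * q ->
  exists L J c, [/\ L \in Ls, J != ord0, L J 0 != 0, c != 0 & q = c *: affine_poly L].
Proof.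
move=> irr na; elim: Ls N => [|L Ls IH] N /=.
  by rewrite big_nil mulr1 => _ aE; case: na; exists N.
case/andP => L0 Ls0; rewrite big_cons.
have [/existsP [J /andP [J0 LJ]]|/existsPn noJ] :=
    boolP [exists J, (J != ord0) && (L J 0 != 0)]; last first.
  (* In this case L is the hyperplane at infinity of the chart, a nonzero constant that can be
     scaled away. *)
  have LE : affine_poly L = mpolyC _ (L ord0 0).
    rewrite /affine_poly big1 ?addr0 // => j _.
    by have /negPn/eqP -> := noJ (lift ord0 j); rewrite scale0r.
  have L00 : L ord0 0 != 0.
    by move: L0; rewrite -affine_poly_eq0 LE mpolyC_eq0.
  rewrite LE mul_mpolyC -scalerAr => e.
  have [|L' [J [c [L'Ls ? ? ? ?]]]] := IH ((L ord0 0)^-1 *: N) Ls0.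
    by rewrite -scalerAl -e scalerA mulVf // scale1r.
  by exists L', J, c; rewrite inE L'Ls orbT.
move=> e; have := congr1 (hyper_rmorph L J) e.
rewrite !rmorphM hyper_rmorph_self // mul0r mulr0 => /esym/eqP.
rewrite mulf_eq0 => /orP [/eqP/(hyper_kernel J0 LJ) [N' NE]|/eqP/(hyper_kernel J0 LJ) dq].
  have [|L' [J' [c [L'Ls ? ? ? ?]]]] := IH N' Ls0.
    have l0 : affine_poly L != 0 by rewrite affine_poly_eq0.
    by apply: (mulfI l0); rewrite mulrCA e NE; ring.
  by exists L', J', c; rewrite inE L'Ls orbT.
have [c c0 qE] := irreducible_associate J0 LJ irr dq.
by exists L, J, c; rewrite inE eqxx.
Qed.

(** L is prime: it divides one of two factors whose product is L, and the other factor is then a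
    unit. *)
Lemma affine_irreducible L J : J != ord0 -> L J 0 != 0 ->
  irreducible_mpoly (affine_poly L).
Proof.
move=> J0 LJ; split; first exact: (affine_not_unit J0 LJ).
have l0 : affine_poly L != 0.
  by rewrite affine_poly_eq0; apply: contraNneq LJ => ->; rewrite mxE.
move=> a b ab; have /eqP := congr1 (hyper_rmorph L J) ab.
rewrite rmorphM hyper_rmorph_self // eq_sym mulf_eq0.
case/orP => /eqP/(hyper_kernel J0 LJ) [c cE]; [right|left]; apply/unitrPr; exists c;
  by apply: (mulIf l0); rewrite mul1r {2}ab cE; ring.
Qed.

Lemma irreducible_affine_nonconst L e : L != 0 ->
  irreducible_mpoly (e *: affine_poly L) -> exists J, J != ord0 /\ L J 0 != 0.
Proof.
move=> L0 irr; have e0 : e != 0.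
  apply/eqP => e0; have [_ /(_ 0 0)] := irr.
  by rewrite e0 scale0r mulr0 unitr0 => /(_ erefl) [].
apply: contrapT => /forallNP noJ; have [nu _] := irr; case/negP: nu.
have LE : affine_poly L = mpolyC _ (L ord0 0).
  rewrite /affine_poly big1 ?addr0 // => j _.
  have /not_andP [|] := noJ (lift ord0 j); first by rewrite eq_sym neq_lift.
  by move/negP/negPn/eqP => ->; rewrite scale0r.
have L00 : L ord0 0 != 0.
  by rewrite -(mpolyC_eq0 n.+1) -LE affine_poly_eq0.
apply/unitrPr; exists (mpolyC _ (e * L ord0 0)^-1).
rewrite LE -mul_mpolyC -!mpolyCM.
rewrite (mulfV (mulf_neq0 e0 L00)); exact: mpolyC1.
Qed.

End HyperplanePoles.

Lemma is_generator_of_ker (R : realFieldType) n (B : 'M[R]_(n, n.+1)) l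
    (s : signed_cone R n.+1) k :
  row_free B -> l != 0 -> B *m l = 0 -> gens s \in unitmx ->
  B *m col k (gens s) = 0 -> is_generator s l.
Proof.
move=> freeB l0 Bl uV /(row_free_ker freeB l0 Bl) [a kE].
have cE : delta_mx k 0 = a *: coords s l :> 'cV_n.+1.
  by rewrite /coords scalemxAr -kE colE mulKmx.
have e1 : a * coords s l k 0 = 1.
  by have /colP/(_ k) := cE; rewrite mxE !eqxx mxE => <-.
have a0 : a != 0.
  by apply: contraTneq (oner_neq0 R) => a0; rewrite -e1 a0 mul0r eqxx.
have cz j : j != k -> coords s l j 0 = 0.
  move=> jk; have /colP/(_ j) := cE; rewrite mxE (negbTE jk) [RHS]mxE => /esym/eqP.
  by rewrite mulf_eq0 (negbTE a0) => /eqP.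
have pk : pivot (coords s l) = k.
  apply/eqP; apply: contraT => /cz e.
  by have := pivot_neq0 (coords_neq0 l0 uV); rewrite e eqxx.
by apply/forallP => j; rewrite pk cz // eq_sym neq_lift.
Qed.

Lemma cancel_factor (K : fieldType) (x y a b : K) :
  a != 0 -> x * a * (y / (a * b)) = x * y / b.
Proof. by move=> a0; rewrite invfM mulrACA -!mulrA; congr (_ * (_ * _)); rewrite mulrA mulfV ?mul1r. Qed.

(** * Residues of forms of signed cones *)

Section Residues.
Variables (R : realType) (n : nat) (g g' : 'M[R]_n.+2) (i0 : 'I_n.+2).
Variables (Q : 'M[R]_(n.+1, n.+2)) (l : 'cV[R]_n.+2).
Variable phi : {rmorphism mpoly n.+1 R -> ratfun R n}.

Local Notation aff v := (to_frac (affine_poly v)).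

Let B := row' i0 g'.
Let ql := (row i0 g' *m l) 0 0.

Hypotheses (ug : g \in unitmx) (ug' : g' \in unitmx).
Hypotheses (BE : Q *m g = B) (Bl : B *m l = 0) (l0 : l != 0).
Hypothesis phi_affine : forall v, phi (affine_poly v) = aff (Q *m v).
Hypothesis phiC : forall c, phi (mpolyC _ c) = rconst n c.

(** If l is not a generator of s, no denominator vanishes on the hyperplane and the factor l makes
    the product 0. If it is, l cancels the pivot factor and the others restrict to the generators of
    the link. The constant comes from [extreme_det]. Both residues in facet charts and arbitrary
    hyperplanes of a chart are instances, for different phi and Q. *)
Lemma cone_form_specializes s : gens s \in unitmx ->
  specializes phi
    (aff (g *m l) * cone_form (@rconst R n.+1) (fun v => aff (g *m v)) s)
    (rconst n (`|ql| / `|\det g'|) *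
     (cone_form (@rconst R n) (fun v => aff v) (link_cone B l 1 s) +
      cone_form (@rconst R n) (fun v => aff v) (link_cone B l (-1) s))).
Proof.
move=> uV; have freeB : row_free B by apply: row'_unit_free.
have spv v : specializes phi (aff (g *m v)) (aff (B *m v)).
  by rewrite -BE -mulmxA -phi_affine; apply: specializes_tofrac.
have spc c : specializes phi (rconst n.+1 c) (rconst n c).
  by rewrite -phiC; apply: specializes_tofrac.
have spl : specializes phi (aff (g *m l)) 0.
  by have := spv l; rewrite Bl affine_poly0 rmorph0.
rewrite cone_form_link // /cone_form; case: ifP => full; last first.
  by rewrite !mulr0; apply: specializes0.
have [ext|ext] /= := boolP (is_generator s l); last first.
  rewrite mulr0 -[X in specializes _ _ X](mul0r (rconst n (weight s * `|\det (gens s)|) /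
    \prod_j aff (B *m col j (gens s)))).
  apply: specializesM => //; apply: specializesM => //.
  apply: specializesV; last by apply: specializes_prod => j _; apply: spv.
  apply/prodf_neq0 => j _; rewrite affine_frac_neq0 //.
  by apply: contraNneq ext => /(is_generator_of_ker freeB l0 Bl uV).
set k := pivot (coords s l); set lam := coords s l k 0.
have lam0 : lam != 0 by apply/pivot_neq0/coords_neq0.
have lE : l = lam *: col k (gens s) by apply: is_generatorE.
have Bk : B *m col k (gens s) = 0.
  have := Bl; rewrite {1}lE -scalemxAr => /eqP.
  by rewrite scaler_eq0 (negbTE lam0) => /eqP.
have detE : `|\det g'| * `|\det (gens s)| * `|lam| = `|ql| * `|\det (B *m col' k (gens s))|.
  exact: extreme_det.
have g'0 : `|\det g'| != 0 by rewrite normr_eq0 -unitfE -unitmxE.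
have V0 j : col j (gens s) != 0 by apply: col_unit_neq0.
have gV0 j : aff (g *m col j (gens s)) != 0.
  by apply/affine_frac_neq0/unitmx_mul_neq0.
have -> : aff (g *m l) * (rconst n.+1 (weight s * `|\det (gens s)|) /
     \prod_j aff (g *m col j (gens s))) =
   rconst n.+1 (lam * (weight s * `|\det (gens s)|)) /
     \prod_(j < n.+1) aff (g *m col (lift k j) (gens s)).
  rewrite {1}lE -scalemxAr affine_polyZ to_fracZ (bigD1_ord k) //=.
  by rewrite cancel_factor // -rmorphM.
have -> : rconst n (`|ql| / `|\det g'|) *
   (rconst n (weight s * Num.sg lam * `|\det (B *m col' k (gens s))|) /
     \prod_j aff (B *m col (lift k j) (gens s))) =
   rconst n (lam * (weight s * `|\det (gens s)|)) /
     \prod_(j < n.+1) aff (B *m col (lift k j) (gens s)).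
  rewrite mulrA -rmorphM; congr (rconst _ _ / _).
  have -> : `|ql| / `|\det g'| * (weight s * Num.sg lam * `|\det (B *m col' k (gens s))|) =
    weight s * Num.sg lam * (`|ql| * `|\det (B *m col' k (gens s))|) / `|\det g'| by ring.
  by rewrite -detE [in RHS](numEsg lam); field.
apply: specializesM => //; apply: specializesV; last first.
  by apply: specializes_prod => j _; apply: spv.
apply/prodf_neq0 => j _; rewrite affine_frac_neq0 //.
apply/eqP => /(row_free_ker freeB l0 Bl) [a aE].
have := congr1 (mulmx (invmx (gens s))) aE.
rewrite lE -!scalemxAr !colE !(mulKmx uV) => /colP/(_ (lift k j)).
rewrite !mxE eqxx /= [_ == k]eq_sym (negbTE (neq_lift k j)) !mulr0.
by move/eqP; rewrite oner_eq0.
Qed.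

Lemma fam_form_specializes (fam : seq (signed_cone R n.+2)) :
  all (fun s => gens s \in unitmx) fam ->
  specializes phi
    (aff (g *m l) * fam_form (@rconst R n.+1) (fun v => aff (g *m v)) fam)
    (rconst n (`|ql| / `|\det g'|) *
     fam_form (@rconst R n) (fun v => aff v) (link B l fam)).
Proof.
move/allP => uV.
have -> : fam_form (@rconst R n) (fun v => aff v) (link B l fam) =
    \sum_(s <- fam) (cone_form (@rconst R n) (fun v => aff v) (link_cone B l 1 s) +
      cone_form (@rconst R n) (fun v => aff v) (link_cone B l (-1) s)).
  by rewrite big_split /= /fam_form /link big_cat !big_map.
rewrite /fam_form !mulr_sumr big_seq [X in specializes _ _ X]big_seq; apply: specializes_sum => s /uV.
exact: cone_form_specializes.
Qed.

End Residues.

(** * Dual cones and their links *)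

Section GeneratedCones.
Variable R : realType.

Lemma row_full_kerP m n (A : 'M[R]_(m, n)) :
  row_full A <-> (forall v : 'cV_n, A *m v = 0 -> v = 0).
Proof.
split=> [/row_fullP [A' A'A] v Av|kerA].
  by rewrite -[v]mul1mx -A'A -mulmxA Av mulmx0.
rewrite /row_full -mxrank_tr -[_ == _]/(row_free A^T) -kermx_eq0.
apply/eqP/row_matrixP => i; rewrite row0; apply: trmx_inj; rewrite trmx0; apply: kerA.
by rewrite -{1}[A]trmxK -trmx_mul -row_mul mulmx_ker row0 trmx0.
Qed.

Definition pos_hull N n (X : 'M[R]_(N, n)) (x : 'rV[R]_n) : Prop :=
  exists c : 'rV[R]_N, (forall i, 0 <= c 0 i) /\ x = c *m X.

Definition nonneg_on N n (X : 'M[R]_(N, n)) (p : 'cV[R]_n) : bool :=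
  [forall i, 0 <= (X *m p) i 0].

(* The rows of X not orthogonal to l are replaced by 0, so as to keep the size. *)
Definition tight N n (X : 'M[R]_(N, n)) (l : 'cV[R]_n) : 'M[R]_(N, n) :=
  \matrix_(i, j) (if (X *m l) i 0 == 0 then X i j else 0).

Lemma tight_mul N n (X : 'M[R]_(N, n)) l (v : 'cV[R]_n) i :
  (tight X l *m v) i 0 = if (X *m l) i 0 == 0 then (X *m v) i 0 else 0.
Proof.
rewrite mxE; under eq_bigr do rewrite mxE.
case: ifP => _; first by rewrite [RHS]mxE.
by rewrite big1 // => j _; rewrite mul0r.
Qed.

Lemma tight_self N n (X : 'M[R]_(N, n)) l : tight X l *m l = 0.
Proof. by apply/colP => i; rewrite tight_mul [RHS]mxE; case: eqP. Qed.

Lemma tightN N n (X : 'M[R]_(N, n)) l : tight X (- l) = tight X l.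
Proof.
apply/matrixP => i j; rewrite [LHS]mxE [RHS]mxE.
by have -> : (X *m - l) i 0 = - (X *m l) i 0; rewrite ?oppr_eq0 // mulmxN mxE.
Qed.

Lemma row_tight N n (X : 'M[R]_(N, n)) l i :
  row i (tight X l) = if (X *m l) i 0 == 0 then row i X else 0.
Proof. by apply/rowP => j; rewrite !mxE; case: ifP; rewrite !mxE. Qed.

Lemma pos_hull_row N n (X : 'M[R]_(N, n)) i : pos_hull X (row i X).
Proof. by exists (delta_mx 0 i); rewrite -rowE; split=> // j; rewrite mxE ler0n. Qed.

Lemma pos_hull0 N n (X : 'M[R]_(N, n)) : pos_hull X 0.
Proof. by exists 0; rewrite mul0mx; split=> // i; rewrite mxE. Qed.

Lemma pos_hull_tight N n (X : 'M[R]_(N, n)) l x :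
  nonneg_on X l -> pos_hull X x -> x *m l = 0 -> pos_hull (tight X l) x.
Proof.
move=> /forallP Xl [c [c0 ->]]; rewrite -mulmxA => /matrixP/(_ 0 0).
rewrite mxE [RHS]mxE => /eqP; rewrite psumr_eq0 => [/allP cXl|i _]; last exact: mulr_ge0.
exists c; split=> //; apply/rowP => j; rewrite !mxE; apply: eq_bigr => i _.
rewrite [tight _ _ _ _]mxE; case: ifP => // Xi.
have := cXl i; rewrite mem_index_enum => /(_ isT) /=.
by rewrite mulf_eq0 Xi orbF => /eqP ->; rewrite !mul0r.
Qed.

Lemma nonneg_on_hull N n (X : 'M[R]_(N, n)) l :
  nonneg_on X l <-> (forall x, pos_hull X x -> 0 <= (x *m l) 0 0).
Proof.
split=> [/forallP Xl x [c [c0 ->]]|h].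
  by rewrite -mulmxA mxE; apply: sumr_ge0 => i _; apply: mulr_ge0.
apply/forallP => i; have := h _ (pos_hull_row X i).
by rewrite -row_mul mxE.
Qed.

Lemma rank_tight_le N n (X : 'M[R]_(N, n.+1)) l : l != 0 -> (\rank (tight X l) <= n)%N.
Proof.
move=> l0; have : (\rank (tight X l) < n.+1)%N; last by rewrite ltnS.
rewrite ltn_neqAle rank_leq_col andbT; apply: contra_neqN l0 => full.
by have /row_full_kerP := full; apply; apply: tight_self.
Qed.

(** A face is generated by the rows of X that lie on it, so the independent points required by
    [facet] can be chosen among these rows. *)
Lemma facet_pos_hull N n (X : 'M[R]_(N, n.+1)) l :
  facet (pos_hull X) l <->
  [/\ l != 0, nonneg_on X l & \rank (tight X l) = n].
Proof.
split=> [[l0 /nonneg_on_hull Xl [M [freeM Ml KM]]]|[l0 Xl rk]].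
  split=> //; apply/eqP; rewrite eqn_leq rank_tight_le //=.
  apply: (@leq_trans (\rank M)); first by rewrite (eqP freeM).
  apply: mxrankS; apply/row_subP => i.
  have [|c [_ ->]] := pos_hull_tight Xl (KM i).
    by rewrite -row_mul Ml row0.
  exact: submxMl.
split=> //; first exact/nonneg_on_hull.
have : exists M : 'M[R]_(\rank (tight X l), n.+1),
    [/\ row_free M, M *m l = 0 & forall i, pos_hull X (row i M)].
  exists (rowsub (maxrankfun (tight X l)) (tight X l)); split.
  - exact: maxrowsub_free.
  - by rewrite mul_rowsub_mx tight_self; apply/matrixP => i j; rewrite !mxE.
  move=> i; rewrite row_rowsub row_tight; case: ifP => _; last exact: pos_hull0.
  exact: pos_hull_row.
by rewrite rk.
Qed.

Lemma hyperplane_sub m n (A : 'M[R]_(m, n.+1)) (B : 'M[R]_(n, n.+1))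
    (l : 'cV[R]_n.+1) : row_free B -> l != 0 -> B *m l = 0 -> A *m l = 0 -> A *m pinvmx B *m B = A.
Proof.
move=> freeB l0 Bl Al; apply: mulmxKpV.
have subK k (D : 'M[R]_(k, n.+1)) : D *m l = 0 -> (D <= kermx l)%MS.
  by move=> Dl; apply/sub_kermxP.
have rkK : \rank (kermx l) = n.
  by rewrite mxrank_ker -mxrank_tr rank_rV -(inj_eq (@trmx_inj _ _ _)) trmxK trmx0 l0 subn1.
have : (kermx l <= B)%MS.
  have := mxrank_leqif_sup (subK _ _ Bl).
  by rewrite rkK (eqP freeB) => -[_ <-].
exact/submx_trans/subK.
Qed.

(** The analogue for the dual cone of the limit of a single signed cone: rows with (X l)_i nonzero
    are decided by l, the tight rows by p. *)
Lemma nonneg_on_limit N n (X : 'M[R]_(N, n)) (l p : 'cV[R]_n) :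
  exists t0, forall t, t0 <= t ->
    nonneg_on X (p + t *: l) = nonneg_on X l && nonneg_on (tight X l) p.
Proof.
exists (1 + \sum_i `|(X *m p) i 0| / `|(X *m l) i 0|) => t t0_le.
have big i : (X *m l) i 0 != 0 -> `|(X *m p) i 0| < t * `|(X *m l) i 0|.
  move=> li; rewrite -ltr_pdivrMr ?normr_gt0 //.
  apply: lt_le_trans t0_le; rewrite (bigD1 i) //= addrCA ltrDl.
  apply: ltr_wpDr ltr01.
  by apply: sumr_ge0 => j _; apply: divr_ge0.
have cE i : (X *m (p + t *: l)) i 0 = (X *m p) i 0 + t * (X *m l) i 0.
  by rewrite mulmxDr -scalemxAr mxE [X in _ + X]mxE.
have sgP i : 0 < (X *m l) i 0 -> 0 < (X *m p) i 0 + t * (X *m l) i 0.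
  move=> h; have := big i (lt0r_neq0 h); rewrite (gtr0_norm h) => h1.
  by have := ler_norm (- (X *m p) i 0); rewrite normrN; lra.
have sgN i : (X *m l) i 0 < 0 -> (X *m p) i 0 + t * (X *m l) i 0 < 0.
  move=> h; have := big i (ltr0_neq0 h); rewrite (ltr0_norm h) => h1.
  by have := ler_norm ((X *m p) i 0); lra.
apply/forallP/andP => [h|[/forallP Xl /forallP Tp] i].
  split; apply/forallP => i; have := h i; rewrite cE.
    by apply: contraTT; rewrite -!ltNge => /sgN.
  by rewrite tight_mul; case: eqP => [->|//]; rewrite mulr0 addr0.
rewrite cE; have := Tp i; rewrite tight_mul; case: eqP => [->|/eqP li _].
  by rewrite mulr0 addr0.
by apply/ltW/sgP; rewrite lt_def li Xl.
Qed.

(** The generators of the face cut out by l, in the coordinates given by the rows of B. *)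
Definition link_rows N n (X : 'M[R]_(N, n.+1)) (B : 'M[R]_(n, n.+1)) l : 'M[R]_(N, n) :=
  tight X l *m pinvmx B.

(* The signed cones of [fam] add up, off their walls, to the indicator of the
   cone dual to the pointed full-dimensional cone generated by the rows of [X]. *)
Definition dual_decomposition N n (X : 'M[R]_(N, n)) (fam : seq (signed_cone R n)) :=
  [/\ row_full X,
      exists V0 : 'cV_n, forall i, row i X = 0 \/ 0 < (X *m V0) i 0,
      all (fun s => gens s \in unitmx) fam &
      forall p, all (fun s => off_walls s p) fam ->
        signed_count fam p = (nonneg_on X p)%:R].

Section Links.
Variables (N n : nat) (X : 'M[R]_(N, n.+1)) (fam : seq (signed_cone R n.+1)).
Variables (B : 'M[R]_(n, n.+1)) (l : 'cV[R]_n.+1).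
Hypotheses (fam_dual : dual_decomposition X fam).
Hypotheses (B_free : row_free B) (l_neq0 : l != 0) (Bl : B *m l = 0).

Lemma link_rows_mul : link_rows X B l *m B = tight X l.
Proof. by apply: (hyperplane_sub B_free l_neq0 Bl); apply: tight_self. Qed.

Lemma nonneg_on_pos : nonneg_on X l -> nonneg_on X (- l) = false.
Proof.
have [fullX _ _ _] := fam_dual; move=> /forallP Xl; apply/negP => /forallP XNl.
case/eqP: l_neq0; have /row_full_kerP := fullX; apply; apply/colP => i.
rewrite [RHS]mxE; apply/eqP; rewrite eq_le Xl andbT.
by have := XNl i; rewrite mulmxN mxE oppr_ge0.
Qed.

(** The two terms of the link are limits of the indicator of the dual cone in the directions l and -
    l. As X has full rank, l and - l cannot both lie in the dual cone, so at most one limit is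
    nonzero; the sign tells which. *)
Lemma signed_count_link p :
  all (fun s => off_walls s p) (link B l fam) ->
  signed_count (link B l fam) p =
  ((nonneg_on X l || nonneg_on X (- l)) && nonneg_on (link_rows X B l) p)%:R
    * (if nonneg_on X l then 1 else -1).
Proof.
have [fullX _ uV cnt] := fam_dual.
have [p' <-] : exists p', B *m p' = p.
  by exists (pinvmx B *m p); rewrite mulmxA (mulmxVp B_free) mul1mx.
move=> off; have [t1 h1] := link_limit B_free l_neq0 Bl uV off.
have [t2 h2] := nonneg_on_limit X l p'.
have [t3 h3] := nonneg_on_limit X (- l) p'.
pose t := Num.max t1 (Num.max t2 t3).
have le1 : t1 <= t by rewrite le_max lexx.
have le2 : t2 <= t by rewrite !le_max lexx orbT.
have le3 : t3 <= t by rewrite !le_max lexx !orbT.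
have [off1 off2 ->] := h1 t le1.
rewrite !cnt // h2 // -scalerN h3 // tightN -link_rows_mul.
have -> q : nonneg_on (link_rows X B l *m B) q = nonneg_on (link_rows X B l) (B *m q).
  by rewrite /nonneg_on mulmxA.
have [Xl|_] /= := boolP (nonneg_on X l); first by rewrite nonneg_on_pos // subr0 mulr1.
by rewrite sub0r mulrN1.
Qed.

Lemma facet_decomposition :
  facet (pos_hull X) l -> dual_decomposition (link_rows X B l) (link B l fam).
Proof.
have [fullX [V0 V0P] uV cnt] := fam_dual; case/facet_pos_hull => _ Xl rk.
split.
- rewrite /row_full eqn_leq rank_leq_col.
  apply: (@leq_trans (\rank (tight X l))); first by rewrite rk.
  by rewrite -link_rows_mul; apply: mxrankM_maxl.
- exists (B *m V0) => i; rewrite mulmxA link_rows_mul tight_mul.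
  case: ifP => Xi; last first.
    by left; rewrite /link_rows row_mul row_tight Xi mul0mx.
  case: (V0P i) => [X0|]; last by right.
  by left; rewrite /link_rows row_mul row_tight Xi X0 mul0mx.
- by apply/allP => s'; rewrite mem_cat => /orP [] /mapP [s sf ->];
    apply: link_gens_unit => //; apply: (allP uV).
by move=> p off; rewrite signed_count_link // Xl /= mulr1.
Qed.

Lemma facet_pos_hullE : facet (pos_hull X) l ->
  forall y, pos_hull X (y *m B) <-> pos_hull (link_rows X B l) y.
Proof.
case/facet_pos_hull => _ Xl _ y; split=> [KyB|[c [c0 ->]]].
  have [|c [c0 yB]] := pos_hull_tight Xl KyB; first by rewrite -mulmxA Bl mulmx0.
  exists c; split=> //; rewrite /link_rows mulmxA -yB.
  by rewrite -mulmxA (mulmxVp B_free) mulmx1.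
exists (\row_i if (X *m l) i 0 == 0 then c 0 i else 0); split.
  by move=> i; rewrite mxE; case: ifP.
rewrite -mulmxA link_rows_mul; apply/rowP => j; rewrite !mxE.
by apply: eq_bigr => i _; rewrite !mxE; case: ifP; rewrite ?mul0r ?mulr0.
Qed.

(** If neither l nor - l is supporting, both limits are zero. If one is, but not as a facet, the
    tight rows have rank less than n; a nonzero vector w orthogonal to them gives the invariance. *)
Lemma nonfacet_degenerate :
  ~ facet (pos_hull X) l -> ~ facet (pos_hull X) (- l) -> degenerate (link B l fam).
Proof.
move=> nf nf'; have [Xl|] := boolP (nonneg_on X l || nonneg_on X (- l)); last first.
  by move/negbTE => Xl; left=> p off; rewrite signed_count_link // Xl mul0r.
have rk : \rank (tight X l) <> n.
  move=> rk; case/orP: Xl => Xl; [apply: nf | apply: nf'];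
    by apply/facet_pos_hull; rewrite ?oppr_eq0 ?tightN.
have [w [w0 Tw]] : exists w : 'cV_n, w != 0 /\ link_rows X B l *m w = 0.
  apply: contrapT => /forallNP h; apply: rk; rewrite -link_rows_mul.
  rewrite mxrankMfree //; apply/eqP; apply/row_full_kerP => v Tv.
  by apply/eqP; apply: contrapT => /negP v0; apply: (h v).
right; exists w; split=> // p t off off'; rewrite !signed_count_link //.
congr ((_ && _)%:R * _); rewrite /nonneg_on; apply: eq_forallb => i.
by rewrite mulmxDr -scalemxAr Tw scaler0 addr0.
Qed.

End Links.

(** A supporting hyperplane is rotated about the rows it contains until it meets a new one. Each
    rotation raises the rank of the tight rows, up to n. *)
Lemma exists_facet N n (X : 'M[R]_(N, n.+1)) fam :
  dual_decomposition X fam -> exists l, facet (pos_hull X) l.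
Proof.
move=> [fullX [V0 V0P] _ _].
have step k : exists V : 'cV[R]_n.+1,
    [/\ V != 0, nonneg_on X V & (minn k n <= \rank (tight X V))%N].
  elim: k => [|k [V [V0' XV rk]]].
    exists V0; split=> //; last by rewrite min0n.
      apply/eqP => V00; have := fullX; rewrite /row_full; suff -> : X = 0 by rewrite mxrank0.
      apply/row_matrixP => i; rewrite row0; case: (V0P i) => //.
      by rewrite V00 mulmx0 mxE ltxx.
    apply/forallP => i; case: (V0P i) => [X0|/ltW //].
    by have := congr1 (fun M => M *m V0) X0; rewrite -row_mul mul0mx => /matrixP/(_ 0 0);
      rewrite !mxE => ->.
  have [lt_rk|ge_rk] := ltnP (\rank (tight X V)) n; last first.
    by exists V; split=> //; apply: leq_trans ge_rk; apply: geq_minr.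
  suff [V' [V'0 XV' lt]] : exists V' : 'cV[R]_n.+1,
      [/\ V' != 0, nonneg_on X V' & (\rank (tight X V) < \rank (tight X V'))%N].
    exists V'; split=> //; apply: leq_trans lt; apply: leq_trans (_ : (minn k n).+1 <= _)%N => //.
    by rewrite -minnSS leq_min geq_minl /= (leq_trans (geq_minr _ _)).
  have [B [freeB BV]] := exists_hyperplane_basis V0'.
  (* A direction of rotation: orthogonal to the tight rows, but not proportional to V. It exists
     because the rank is still less than n. *)
  have [w [Bw Tw]] : exists w : 'cV[R]_n.+1, B *m w != 0 /\ tight X V *m w = 0.
    apply: contrapT => /forallNP h; move: lt_rk; rewrite ltnNge => /negP; apply.
    have TB : tight X V *m pinvmx B *m B = tight X V.
      by apply: (hyperplane_sub freeB V0' BV); apply: tight_self.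
    rewrite -TB mxrankMfree //.
    have -> // : \rank (tight X V *m pinvmx B) = n.
    apply/eqP/row_full_kerP => v Tv.
    apply/eqP; apply: contrapT => /negP v0; apply: (h (pinvmx B *m v)).
    by rewrite mulmxA (mulmxVp freeB) mul1mx mulmxA Tv.
  have w_neq0 : w != 0 by apply: contraNneq Bw => ->; rewrite mulmx0.
  wlog [i0 Xw] : w Bw Tw w_neq0 / exists i, (X *m w) i 0 < 0.
    move=> wl; have [i Xi] : exists i, (X *m w) i 0 != 0.
      apply/existsP; apply: contraNT w_neq0 => /existsPn h; apply/eqP.
      have /row_full_kerP := fullX; apply; apply/colP => i; rewrite [RHS]mxE.
      by apply/eqP/negPn/h.
    have [neg|pos|/eqP] := ltgtP ((X *m w) i 0) 0; last by rewrite (negbTE Xi).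
      by apply: (wl w) => //; exists i.
    apply: (wl (- w)); rewrite ?mulmxN ?oppr_eq0 ?Tw ?oppr0 //.
    by exists i; rewrite mxE oppr_lt0.
  (* Ratio test: the least r over the rows with (X w)_i < 0 is the largest step that keeps V + r w
     nonnegative, and the minimizing row becomes tight. *)
  pose r i := (X *m V) i 0 / - (X *m w) i 0.
  have [i Xi imin] := @arg_minP _ _ _ i0 (fun i => (X *m w) i 0 < 0) r Xw.
  have Nw : 0 < - (X *m w) i 0 by rewrite oppr_gt0.
  have ri : 0 <= r i by rewrite divr_ge0 ?(forallP XV) // ltW.
  have cE j : (X *m (V + r i *: w)) j 0 = (X *m V) j 0 + r i * (X *m w) j 0.
    by rewrite mulmxDr -scalemxAr mxE [X in _ + X]mxE.
  exists (V + r i *: w); split.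
  - apply: contraNneq Bw => V'0; have := congr1 (mulmx B) V'0.
    rewrite mulmxDr BV add0r mulmx0 -scalemxAr => /eqP; rewrite scaler_eq0 => /orP [/eqP r0|//].
    by case/eqP: V0'; rewrite -V'0 r0 scale0r addr0.
  - apply/forallP => j; rewrite cE; have [Xj|Xj] := ltP ((X *m w) j 0) 0; last first.
      by rewrite addr_ge0 ?(forallP XV) // mulr_ge0.
    have := imin j Xj; rewrite {2}/r ler_pdivlMr ?oppr_gt0 // mulrN.
    by rewrite lerNl -subr_ge0 opprK addrC.
  have sub : (tight X V <= tight X (V + r i *: w))%MS.
    apply/row_subP => j; rewrite row_tight; case: eqP => [XVj|_]; last exact: sub0mx.
    have Xwj : (X *m w) j 0 = 0.
      by have /colP/(_ j) := Tw; rewrite tight_mul XVj eqxx => ->; rewrite mxE.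
    have <- : row j (tight X (V + r i *: w)) = row j X.
      by rewrite row_tight cE XVj Xwj mulr0 addr0 eqxx.
    exact: row_sub.
  have [le_rk eq_rk] := mxrank_leqif_sup sub.
  rewrite ltn_neqAle le_rk andbT eq_rk; apply/negP => /submxP [D DE].
  have : (tight X (V + r i *: w) *m w) i 0 = 0 by rewrite DE -mulmxA Tw mulmx0 mxE.
  rewrite tight_mul cE /r; have -> : (X *m V) i 0 + (X *m V) i 0 / - (X *m w) i 0 * (X *m w) i 0 = 0.
    by field; rewrite lt_eqF.
  by rewrite eqxx => /eqP; rewrite lt_eqF.
have [V [V_neq0 XV rk]] := step n; rewrite minnn in rk.
exists V; apply/facet_pos_hull; split=> //.
by apply/eqP; rewrite eqn_leq rank_tight_le.
Qed.

End GeneratedCones.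

Lemma cancel_pull (K : fieldType) (q x y u G : K) :
  q != 0 -> u * (x * (y * G)) = q^-1 * x * y * (q * u * G).
Proof. by move=> q0; field. Qed.

(** * Canonical forms of polytopes *)

Section DualFormIsCanonical.
Variable R : realType.

Local Notation aff v := (to_frac (affine_poly v)).
Local Notation inner := (lift ord0 ord0).

Definition dual_form n (fam : seq (signed_cone R n.+1)) : ratfun R n :=
  fam_form (@rconst R n) (fun v => aff v) fam.

Lemma rconst_eq0 n (c : R) : (rconst n c == 0) = (c == 0).
Proof. exact: fmorph_eq0. Qed.

Lemma form_in_chartZ n (g : 'M[R]_n.+1) c (w : ratfun R n) : g \in unitmx ->
  form_in_chart g (rconst n c * w) = rconst n c * form_in_chart g w.
Proof.
move=> ug; rewrite !form_in_chartE // [RHS]mulrA; congr (_ * _).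
apply: rat_comp_eq => //; apply: specializesM; first exact: specializes_rconst.
exact: specializes_rat_comp.
Qed.

Definition restrict_rmorph n : {rmorphism mpoly n.+1 R -> ratfun R n} :=
  @to_frac R n \o affine_subst (row' inner 1%:M).

Lemma restrict_rmorph_affine n (v : 'cV[R]_n.+2) :
  restrict_rmorph n (affine_poly v) = aff (row' inner 1%:M *m v).
Proof. by rewrite /= affine_subst_affine // row'1_col0. Qed.

Lemma restrict_rmorphE n (p : mpoly n.+1 R) :
  restrict_rmorph n p = to_frac (restrict_poly p).
Proof. by rewrite /= restrict_polyE. Qed.

Lemma rvar_neq0 n (i : 'I_n) : rvar R i != 0.
Proof.
rewrite to_frac_eq0 -affine_poly_delta1 affine_poly_eq0.
by apply/eqP => /colP/(_ (lift ord0 i)) /eqP; rewrite !mxE !eqxx oner_eq0.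
Qed.

Lemma is_residueP n (f : ratfun R n.+1) r :
  is_residue f r <-> specializes (restrict_rmorph n) (rvar R ord0 * f) r.
Proof.
split=> [[p [q [-> q0 ->]]]|[p [q [e q0 ->]]]]; exists p, q.
  split; last by rewrite !restrict_rmorphE.
    by rewrite mulVKf // rvar_neq0.
  by rewrite restrict_rmorphE to_frac_eq0.
split; last by rewrite !restrict_rmorphE.
  by rewrite -e mulKf // rvar_neq0.
by rewrite -to_frac_eq0 -restrict_rmorphE.
Qed.

Lemma canonical_form_neq0 d C o (w : ratfun R d) : o != 0 -> canonical_form C o w -> w != 0.
Proof.
move=> o0; case: d C w => [|d] C w /=; last by case.
move=> [x [_ x0 ->]]; rewrite rconst_eq0 sgr_eq0 mulf_neq0 //.
by apply: contraNneq x0 => e; apply/eqP/rowP => i; rewrite ord1 e mxE.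
Qed.

Lemma norm_sqr_gt0 n (l : 'cV[R]_n) : l != 0 -> 0 < (l^T *m l) 0 0.
Proof.
move=> l0; rewrite lt_def mxE sumr_ge0 ?andbT => [|i _]; last first.
  by rewrite mxE -expr2 sqr_ge0.
apply: contraNneq l0 => /eqP; rewrite psumr_eq0 => [/allP h|i _]; last first.
  by rewrite mxE -expr2 sqr_ge0.
apply/eqP/colP => i; have := h i; rewrite mem_index_enum => /(_ isT).
by rewrite !mxE -expr2 sqrf_eq0 => /eqP.
Qed.

Lemma exists_facet_chart n (l : 'cV[R]_n.+2) : l != 0 -> exists g, facet_chart l g.
Proof.
move=> l0; have [B [freeB Bl]] := exists_hyperplane_basis l0.
exists (insert_row inner l^T B); split.
- by apply: (insert_row_unit _ freeB Bl); rewrite gt_eqF // norm_sqr_gt0.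
- by rewrite row'_insert_row.
by rewrite row_insert_row norm_sqr_gt0.
Qed.

Lemma facet_chart_free n (l : 'cV[R]_n.+2) g :
  facet_chart l g -> row_free (row' inner g).
Proof. by case=> ug _ _; apply: row'_unit_free. Qed.

Lemma facet_chart_mul n (l : 'cV[R]_n.+2) g : facet_chart l g ->
  g *m l = (row inner g *m l) 0 0 *: delta_mx inner 0.
Proof.
move=> [_ Bl _]; apply/colP => i; rewrite -row_mul [RHS]mxE [row _ _ _ _]mxE.
rewrite [delta_mx _ _ _ _]mxE andbT; case: (eqVneq i inner) => [->|ii].
  by rewrite mulr1.
rewrite mulr0; rewrite eq_sym in ii; have [i' -> _] := unlift_some ii.
by move: Bl; rewrite row'Esub mul_rowsub_mx => /colP/(_ i'); rewrite !mxE.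
Qed.

(** In a facet chart, l is u_1 times ql = (inward row) *m l > 0, and this scale cancels the |ql| in
    the volume of the link. The chart contributes det g and the volume 1 / |det g|; their product is
    the sign by which the orientation of the facet changes. *)
Lemma dual_form_residue n N (X : 'M[R]_(N, n.+2)) fam o l g :
  dual_decomposition X fam -> l != 0 -> facet_chart l g ->
  is_residue (form_in_chart g (rconst n.+1 (Num.sg o) * dual_form fam))
    (rconst n (Num.sg (o * \det g)) * dual_form (link (row' inner g) l fam)).
Proof.
move=> [_ _ uV _] l0 gl; have [ug Bl ql] := gl.
rewrite form_in_chartZ // form_in_chart_fam //; apply/is_residueP.
set G := fam_form _ _ _; set ql' := (row inner g *m l) 0 0 in ql.
have := @fam_form_specializes R n g g inner (row' inner 1%:M) l (restrict_rmorph n)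
  ug ug _ Bl l0 (@restrict_rmorph_affine n) _ fam uV.
rewrite -/G -/ql'; set D := fam_form _ _ _ => sp.
have {}sp : specializes (restrict_rmorph n) (aff (g *m l) * G)
   (rconst n (`|ql'| / `|\det g|) * D).
  apply: sp; first by rewrite row'Esub mul_rowsub_mx mul1mx.
  by move=> c; rewrite /= affine_substC.
have -> : rvar R ord0 * (rconst n.+1 (Num.sg o) * (rconst n.+1 (\det g) * G)) =
    rconst n.+1 (ql'^-1 * Num.sg o * \det g) * (aff (g *m l) * G).
  rewrite facet_chart_mul // -/ql' affine_polyZ to_fracZ affine_poly_delta1.
  rewrite -[to_frac _]/(rvar R ord0) !rmorphM fmorphV.
  have : rconst n.+1 ql' != 0 by rewrite rconst_eq0 gt_eqF.
  exact: cancel_pull.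
have -> : rconst n (Num.sg (o * \det g)) * dual_form (link (row' inner g) l fam) =
    rconst n (ql'^-1 * Num.sg o * \det g) * (rconst n (`|ql'| / `|\det g|) * D).
  rewrite mulrA -rmorphM; congr (rconst _ _ * _).
  have g0 : `|\det g| != 0 by rewrite normr_eq0 -unitfE -unitmxE.
  rewrite sgrM (gtr0_norm ql) {2}(numEsg (\det g)).
  by field; rewrite g0 gt_eqF.
apply: specializesM => //.
have := specializes_tofrac (restrict_rmorph n) (mpolyC n.+1 (ql'^-1 * Num.sg o * \det g)).
by rewrite /= affine_substC.
Qed.

End DualFormIsCanonical.

Section DualFormPoles.
Variable R : realType.

Local Notation aff v := (to_frac (affine_poly v)).

Lemma fam_form_denominator n (ev : 'cV[R]_n.+1 -> 'cV[R]_n.+1) (fam : seq (signed_cone R n.+1)) :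
  all (fun L => L != 0) [seq ev (col j (gens s)) | s <- fam, j <- enum 'I_n.+1] ->
  exists N : mpoly n R, fam_form (@rconst R n) (fun v => aff (ev v)) fam *
    to_frac (\prod_(L <- [seq ev (col j (gens s)) | s <- fam, j <- enum 'I_n.+1])
       affine_poly L) = to_frac N.
Proof.
rewrite /fam_form; elim: fam => [|s fam IH] /=.
  by exists 0; rewrite big_nil mul0r rmorph0.
rewrite all_cat => /andP [/allP nz /IH [N NE]].
rewrite big_cons big_cat /= big_map big_enum /= rmorphM mulrDl.
set P := \prod_(L <- _) _ in NE *; set P1 := \prod_(j < _) _.
have [M ME] : exists M, cone_form (@rconst R n) (fun v => aff (ev v)) s * to_frac P1 = to_frac M.
  rewrite /cone_form; case: ifP => _; last by exists 0; rewrite mul0r rmorph0.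
  exists (mpolyC n (weight s * `|\det (gens s)|)).
  have -> : to_frac P1 = \prod_j aff (ev (col j (gens s))) by rewrite rmorph_prod.
  rewrite mulfVK //; apply/prodf_neq0 => j _; apply: affine_frac_neq0; apply: nz.
  by rewrite map_f ?mem_enum.
exists (M * P + N * P1).
by rewrite rmorphD !rmorphM /= -ME -NE; ring.
Qed.

Lemma scaled_pole n (c : R) (f : ratfun R n) q k :
  c != 0 -> pole_of_order (rconst n c * f) q k -> pole_of_order f q k.
Proof.
move=> c0 [a [b [fE na nb]]]; exists (c^-1 *: a), b; split=> //.
  rewrite to_fracZ -mulrA -fE mulrA -rmorphM mulVf // rmorph1 mul1r.
  by [].
by case=> a' e; apply: na; exists (c *: a'); rewrite -scalerAl -e scalerA mulfV // scale1r.
Qed.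

Lemma dual_form_pole n N (X : 'M[R]_(N, n.+2)) fam (g : 'M[R]_n.+2) c q k :
  dual_decomposition X fam -> g \in unitmx -> c != 0 ->
  irreducible_mpoly q -> (0 < k)%N ->
  pole_of_order (rconst n.+1 c * fam_form (@rconst R n.+1) (fun v => aff (g *m v)) fam) q k ->
  k = 1%N /\ exists l e, [/\ facet (pos_hull X) l, e != 0 & q = e *: affine_poly (g *m l)].
Proof.
move=> datum ug c0 irr k0 /(scaled_pole c0) pole.
have [fullX _ uV _] := datum.
set F := fam_form _ _ _ in pole.
set Ls := [seq g *m col j (gens s) | s <- fam, j <- enum 'I_n.+2].
have Ls0 : all (fun L => L != 0) Ls.
  apply/allP => _ /allpairsP [[s j] [/= sf _ ->]].
  by apply: unitmx_mul_neq0 => //; apply: col_unit_neq0; apply: (allP uV).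
have [P PE] := @fam_form_denominator _ (fun v => g *m v) fam Ls0.
rewrite -/Ls -/F in PE.
have [a [b [FE na nb]]] := pole.
have b0 : b != 0.
  by apply/eqP => b0; apply: nb; exists 0; rewrite b0 mul0r.
have q0 : q != 0.
  apply/eqP => q0; have [_ /(_ 0 0)] := irr.
  by rewrite mulr0 q0 => /(_ erefl); rewrite unitr0; case.
have [|L [J [e [LLs J0 LJ e0 qE]]]] :=
    @irreducible_factor_affine R n Ls q a (P * q ^+ k.-1 * b) irr na Ls0.
  have -> : P * q ^+ k.-1 * b * q = P * (q ^+ k * b).
    by rewrite -[in RHS](prednK k0) exprSr; ring.
  have D0 : to_frac (q ^+ k * b) != 0 by rewrite to_frac_eq0 mulf_neq0 // expf_neq0.
  apply: to_frac_inj; rewrite [LHS]rmorphM [RHS]rmorphM.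
  by move: PE; rewrite FE mulrAC => /(canRL (mulfVK D0)).
have [[s j] [/= sf _ LE]] := allpairsP LLs.
set l := col j (gens s) in LE.
have l0 : l != 0 by apply: col_unit_neq0; apply: (allP uV).
pose B := hyper_proj L J *m g.
have Bl : B *m l = 0 by rewrite /B -mulmxA -LE hyper_proj_self.
have freeB : row_free B.
  apply/row_freeP; exists (invmx g *m col' J 1%:M).
  by rewrite /B -mulmxA (mulmxA g) mulmxV // mul1mx hyper_proj_col'.
(* Completes B to an invertible matrix, for the comparison of volumes; the row l^T is transverse
   because l^T *m l > 0. *)
pose g' := insert_row ord0 l^T B.
have ug' : g' \in unitmx.
  by apply: (insert_row_unit _ freeB Bl); rewrite gt_eqF // norm_sqr_gt0.
have gB : row' ord0 g' = B by apply: row'_insert_row.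
have := @fam_form_specializes R n g g' ord0 (hyper_proj L J) l (hyper_rmorph L J)
  ug ug' _ _ l0 (@hyper_rmorph_affine R n L J J0) _ fam uV.
rewrite gB -/F -LE => /(_ erefl Bl) sp.
have phiC c' : hyper_rmorph L J (mpolyC n.+1 c') = rconst n c'.
  by rewrite /= affine_substC.
move: pole; rewrite qE => pole.
have [-> v0] := pole_specializes J0 LJ e0 k0 pole (sp phiC).
split=> //.
have FL0 : fam_form (@rconst R n) (fun v => aff v) (link B l fam) != 0.
  by apply: contraNneq v0 => ->; rewrite mulr0.
have [fl|nfl] := pselect (facet (pos_hull X) l).
  by exists l, e; rewrite LE.
(* Generators of the family may lie outside the dual cone, so the inward normal of the facet can be
   - l. *)
have [fl|nfl'] := pselect (facet (pos_hull X) (- l)).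
  exists (- l), (- e); rewrite oppr_eq0; split=> //.
  by rewrite LE mulmxN -[- (g *m l)]scaleN1r affine_polyZ scalerA mulrN1 opprK.
case/eqP: FL0; apply: fam_form_eq0.
- exact: affine_frac_linear.
- by apply/allP => s'; rewrite mem_cat => /orP [] /mapP [s1 s1f ->];
    apply: link_gens_unit => //; apply: (allP uV).
- move=> s' j'; rewrite mem_cat => /orP [] /mapP [s1 s1f ->];
    apply/affine_frac_neq0/col_unit_neq0/link_gens_unit => //; exact: (allP uV).
exact: (nonfacet_degenerate datum freeB l0 Bl).
Qed.

End DualFormPoles.

Section DualFormCanonical.
Variable R : realType.

Local Notation aff v := (to_frac (affine_poly v)).
Local Notation inner := (lift ord0 ord0).

Lemma pole_scaled n (c : R) (f : ratfun R n) q k :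
  c != 0 -> pole_of_order f q k -> pole_of_order (rconst n c * f) q k.
Proof.
move=> c0 h; apply: (@scaled_pole _ _ c^-1); rewrite ?invr_eq0 //.
by rewrite mulrA -rmorphM mulVf // rmorph1 mul1r.
Qed.

Lemma dual_form_pole_facet n N (X : 'M[R]_(N, n.+2)) fam (g : 'M[R]_n.+2) c l e :
  dual_decomposition X fam -> g \in unitmx -> c != 0 -> e != 0 ->
  irreducible_mpoly (e *: affine_poly (g *m l)) -> facet (pos_hull X) l ->
  (forall (B : 'M[R]_(n.+1, n.+2)), row_free B -> B *m l = 0 ->
     dual_form (link B l fam) != 0) ->
  pole_of_order (rconst n.+1 c * fam_form (@rconst R n.+1) (fun v => aff (g *m v)) fam)
    (e *: affine_poly (g *m l)) 1.
Proof.
move=> [fullX _ uV _] ug c0 e0 irr [l0 _ _] nz; apply: pole_scaled => //.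
set F := fam_form _ _ _; set L := g *m l.
have [J [J0 LJ]] : exists J, J != ord0 /\ L J 0 != 0.
  by apply: irreducible_affine_nonconst irr; apply: unitmx_mul_neq0.
pose B := hyper_proj L J *m g.
have Bl : B *m l = 0 by rewrite /B -mulmxA hyper_proj_self.
have freeB : row_free B.
  apply/row_freeP; exists (invmx g *m col' J 1%:M).
  by rewrite /B -mulmxA (mulmxA g) mulmxV // mul1mx hyper_proj_col'.
pose g' := insert_row ord0 l^T B.
have ql : (l^T *m l) 0 0 != 0 by rewrite gt_eqF // norm_sqr_gt0.
have ug' : g' \in unitmx by apply: (insert_row_unit _ freeB Bl).
have gB : row' ord0 g' = B by apply: row'_insert_row.
have phiC c' : hyper_rmorph L J (mpolyC n.+1 c') = rconst n c'.
  by rewrite /= affine_substC.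
have := @fam_form_specializes R n g g' ord0 (hyper_proj L J) l (hyper_rmorph L J)
  ug ug' _ _ l0 (@hyper_rmorph_affine R n L J J0) phiC fam uV.
rewrite gB -/F => /(_ erefl Bl) sp.
apply: (specializes_pole J0 LJ e0 _ sp).
apply: mulf_neq0; last exact: nz.
rewrite rconst_eq0 mulf_neq0 ?invr_eq0 ?normr_eq0 //; last by rewrite -unitfE -unitmxE.
by rewrite /g' row_insert_row.
Qed.

Lemma coords1 (s : signed_cone R 1) p j :
  gens s \in unitmx -> coords s p j 0 = p 0 0 / gens s 0 0.
Proof.
move=> uV; have v0 : gens s 0 0 != 0.
  by move: uV; rewrite unitmxE det_mx11 unitfE.
rewrite ord1; apply: (canRL (mulfK v0)).
by rewrite mulrC -[p in RHS](mulKVmx uV) [in RHS]mxE big_ord1.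
Qed.

(** In dimension 1 a ray has the form |v| / v, a sign, and contains exactly one of x and - x. A line
    contains both and drops out of the difference, in agreement with its form 0. *)
Lemma dual_form1 (fam : seq (signed_cone R 1)) (x : R) :
  x != 0 -> all (fun s => gens s \in unitmx) fam ->
  dual_form fam =
  rconst 0 (Num.sg x * (signed_count fam x%:M - signed_count fam (- x)%:M)).
Proof.
move=> x0 /allP uV; rewrite /dual_form /fam_form /signed_count -sumrB mulr_sumr.
rewrite rmorph_sum big_seq [RHS]big_seq; apply: eq_bigr => s /uV us.
have v0 : gens s 0 0 != 0 by move: us; rewrite unitmxE det_mx11 unitfE.
have inE' y : in_cone s y%:M = (0 \in bounded_dirs s) ==> (0 < y / gens s 0 0).
  apply/forallP/idP => [/(_ 0)|h j]; rewrite ?ord1 coords1 // mxE eqxx mulr1n //.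
rewrite /= !inE' /cone_form.
have -> : (bounded_dirs s == [set: 'I_1]%SET) = (0 \in bounded_dirs s).
  apply/eqP/idP => [->|h]; first by rewrite inE.
  by apply/setP => j; rewrite ord1 h inE.
case: (0 \in _) => /=; last by rewrite subrr mulr0 rmorph0.
rewrite big_ord1 det_mx11.
have -> : affine_poly (col 0 (gens s)) = mpolyC 0 (gens s 0 0).
  by rewrite /affine_poly big_ord0 addr0 mxE.
rewrite -fmorph_div; congr (rconst _ _).
rewrite mulNr oppr_gt0 -mulrBr mulrCA -mulrA; congr (_ * _).
have -> : (0 < x / gens s 0 0)%R%:R - (x / gens s 0 0 < 0)%R%:R = Num.sg (x / gens s 0 0) :> R.
  have [h|h|->] := ltgtP (x / gens s 0 0) 0.
  - by rewrite ltr0_sg // sub0r.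
  - by rewrite gtr0_sg // subr0.
  by rewrite sgr0 subrr.
rewrite sgrM mulrA -expr2 sqr_sg x0 mul1r sgrV.
by apply: (mulIf v0); rewrite divfK // -normrEsg.
Qed.

Lemma dual_form_canonical0 N (X : 'M[R]_(N, 1)) fam o : o != 0 ->
  dual_decomposition X fam ->
  canonical_form (pos_hull X) o (rconst 0 (Num.sg o) * dual_form fam).
Proof.
move=> o0 [fullX [V0 V0P] uV cnt].
have [i Xi] : exists i, X i 0 != 0.
  apply/existsP; apply: contraTT fullX => /existsPn h.
  suff -> : X = 0 by rewrite /row_full mxrank0.
  by apply/matrixP => i j; rewrite ord1 mxE; apply/eqP/negPn/h.
exists (row i X); rewrite mxE; split.
- exact: pos_hull_row.
- by apply: contraNneq Xi => /rowP/(_ 0); rewrite !mxE => ->.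
have V00 k : X k 0 != 0 -> 0 < X k 0 * V0 0 0.
  move=> Xk; case: (V0P k) => [/rowP/(_ 0)/eqP|]; first by rewrite !mxE (negbTE Xk).
  by rewrite mxE big_ord1.
have same k : 0 <= X k 0 * X i 0.
  have [->|Xk] := eqVneq (X k 0) 0; first by rewrite mul0r.
  have := mulr_gt0 (V00 k Xk) (V00 i Xi); rewrite mulrACA -expr2 => h.
  by rewrite ltW // -(pmulr_lgt0 _ (_ : 0 < V0 0 0 ^+ 2)) // lt_def sqr_ge0 andbT;
    apply: contraTneq h => ->; rewrite mulr0 ltxx.
have off y : y != 0 -> all (fun s => off_walls s y%:M) fam.
  move=> y0; apply/allP => s /(allP uV) us; apply/forallP => j.
  rewrite coords1 // mxE eqxx mulr1n mulf_neq0 // invr_eq0.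
  by move: us; rewrite unitmxE det_mx11 unitfE.
rewrite (dual_form1 Xi uV) !cnt ?off ?oppr_eq0 // -rmorphM sgrM; congr (rconst _ (_ * _)).
have -> : nonneg_on X (X i 0)%:M = true.
  by apply/forallP => k; rewrite mxE big_ord1 !mxE eqxx mulr1n.
have -> : nonneg_on X (- X i 0)%:M = false.
  apply/negP => /forallP/(_ i); rewrite mxE big_ord1 !mxE eqxx mulr1n mulrN oppr_ge0.
  by rewrite -expr2 leNgt lt_def sqr_ge0 sqrf_eq0 Xi.
by rewrite subr0 mulr1.
Qed.

Lemma pos_hull_link n N (X : 'M[R]_(N, n.+2)) l g :
  facet (pos_hull X) l -> facet_chart l g ->
  facet_cone (pos_hull X) g = pos_hull (link_rows X (row' inner g) l).
Proof.
move=> fl gl; have [ug Bl _] := gl; have [l0 _ _] := fl.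
apply/funext => y; apply/propext.
exact: (facet_pos_hullE (facet_chart_free gl) l0 Bl fl).
Qed.

Lemma dual_form_canonical d N (X : 'M[R]_(N, d.+1)) fam o : o != 0 ->
  dual_decomposition X fam ->
  canonical_form (pos_hull X) o (rconst d (Num.sg o) * dual_form fam).
Proof.
elim: d N X fam o => [|d IH] N X fam o o0 datum; first exact: dual_form_canonical0.
have [fullX _ uV _] := datum.
(* By induction the form of a facet is canonical, hence nonzero. This serves twice: to show that the
   form is nonzero, and that every facet really is a pole. *)
have link_canonical l B : facet (pos_hull X) l -> row_free B -> B *m l = 0 ->
    dual_form (link B l fam) != 0.
  move=> fl freeB Bl; have [l0 _ _] := fl.
  have /(IH _ _ _ 1 (oner_neq0 _)) := facet_decomposition datum freeB l0 Bl fl.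
  by rewrite sgr1 rmorph1 mul1r; apply: canonical_form_neq0; apply: oner_neq0.
have so0 : Num.sg o != 0 by rewrite sgr_eq0.
split.
- have [l fl] := exists_facet datum; have [l0 _ _] := fl.
  have [g gl] := exists_facet_chart l0; have [ug Bl _] := gl.
  have := dual_form_residue o datum l0 gl; set w := _ * dual_form fam => res.
  apply/eqP => w0; move: res; rewrite w0 form_in_chart0 // => /is_residueP.
  rewrite mulr0 => /(specializes_uniq (specializes0 _)) /esym/eqP.
  rewrite mulf_eq0 rconst_eq0 sgr_eq0 mulf_eq0 (negbTE o0) /=.
  rewrite (negbTE (link_canonical _ _ fl (facet_chart_free gl) Bl)) orbF.
  by move: ug; rewrite unitmxE unitfE => /negbTE ->.
- move=> g q k ug irr k0.
  have c0 : Num.sg o * \det g != 0 by rewrite mulf_neq0 // -unitfE -unitmxE.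
  rewrite form_in_chartZ // form_in_chart_fam // mulrA -rmorphM; split.
    exact: (dual_form_pole datum).
  move=> [-> [l [c [fl cn0 qE]]]]; rewrite qE in irr *.
  apply: (dual_form_pole_facet datum) => // B; exact: link_canonical.
move=> l g fl gl; have [l0 _ _] := fl; have [ug Bl _] := gl.
exists (rconst d (Num.sg (o * \det g)) * dual_form (link (row' inner g) l fam)).
  exact: (dual_form_residue o datum l0 gl).
rewrite (pos_hull_link fl gl); apply: IH; last first.
  exact: (facet_decomposition datum (facet_chart_free gl) l0 Bl fl).
by rewrite mulf_neq0 // -unitfE -unitmxE.
Qed.

End DualFormCanonical.

(** * Uniqueness of canonical forms *)

Section Factorization.
Variables (R : realType) (n : nat).
Implicit Types (a b p q : mpoly n R) (f : ratfun R n).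

Lemma nonunit_msize p : p != 0 -> p \isn't a GRing.unit -> (1 < mmeasure mdeg p)%N.
Proof.
move=> p0; apply: contraR; rewrite -leqNgt => /msize1_polyC pE.
apply/andP; split; first exact/eqP.
by rewrite unitfE -(mpolyC_eq0 n) -pE.
Qed.

Lemma msize_mul_lt p q : p != 0 -> q != 0 -> q \isn't a GRing.unit ->
  (mmeasure mdeg p < mmeasure mdeg (p * q))%N.
Proof.
move=> p0 q0 /(nonunit_msize q0) sq; rewrite msizeM //.
have : (0 < mmeasure mdeg p)%N by rewrite lt0n msize_poly_eq0.
by move: sq; case: (mmeasure mdeg q) => [|[|k]] // _; case: (mmeasure mdeg p) => // r _;
  rewrite !addnS /= ltnS leq_addr.
Qed.

Lemma exists_irreducible_factor p : p != 0 -> p \isn't a GRing.unit ->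
  exists2 q, irreducible_mpoly q & poly_dvd q p.
Proof.
have [m] := ubnP (mmeasure mdeg p); elim: m p => // m IH p.
rewrite ltnS => le_m p0 up.
have [irr|nirr] := pselect (irreducible_mpoly p).
  by exists p => //; exists 1; rewrite mul1r.
have [a [b [pE ua ub]]] : exists a b, [/\ p = a * b, a \isn't a GRing.unit & b \isn't a GRing.unit].
  apply: contrapT => /forallNP h; apply: nirr; split=> // a b pE.
  have [ua|ua] := boolP (a \is a GRing.unit); first by left.
  by right; apply: contraT => ub; case: (h a); exists b.
have a0 : a != 0 by apply: contraNneq p0 => a0; rewrite pE a0 mul0r.
have b0 : b != 0 by apply: contraNneq p0 => b0; rewrite pE b0 mulr0.
have [|q irr [c aE]] := IH a _ a0 ua.
  by apply: leq_trans le_m; rewrite pE msize_mul_lt.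
by exists q => //; exists (c * b); rewrite pE aE mulrAC.
Qed.

Lemma factor_out q p : p != 0 -> q \isn't a GRing.unit ->
  exists k p', p = q ^+ k * p' /\ ~ poly_dvd q p'.
Proof.
move=> p0 uq; have [m] := ubnP (mmeasure mdeg p); elim: m p p0 => // m IH p p0.
rewrite ltnS => le_m; have [[p' pE]|nq] := pselect (poly_dvd q p); last first.
  by exists 0%N, p; rewrite mul1r.
have p'0 : p' != 0 by apply: contraNneq p0 => e; rewrite pE e mul0r.
have q0 : q != 0 by apply: contraNneq p0 => e; rewrite pE e mulr0.
have [|k [p'' [p'E nq]]] := IH p' p'0.
  by apply: leq_trans le_m; rewrite pE msize_mul_lt.
by exists k.+1, p''; rewrite pE p'E exprSr mulrAC.
Qed.

(** Cancelling a common irreducible factor lowers the size of the denominator. Absence of common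
    irreducible factors is enough to read the pole orders off the denominator. *)
Lemma reduced_fraction f : exists a b, [/\ b != 0, f = to_frac a / to_frac b &
  forall q, irreducible_mpoly q -> poly_dvd q b -> ~ poly_dvd q a].
Proof.
have : exists a b, b != 0 /\ f = to_frac a / to_frac b.
  exists (numerator f), (denominator f); split; first exact: denominator_neq0.
  exact: fraction_num_den.
move=> [a [b [b0 fE]]]; have [m] := ubnP (mmeasure mdeg b).
elim: m a b b0 fE => // m IH a b b0 fE; rewrite ltnS => le_m.
have [[q [irr [b' bE] [a' aE]]]|none] :=
    pselect (exists q, [/\ irreducible_mpoly q, poly_dvd q b & poly_dvd q a]); last first.
  by exists a, b; split=> // q irr qb qa; apply: none; exists q.
have [uq _] := irr.
have b'0 : b' != 0 by apply: contraNneq b0 => e; rewrite bE e mul0r.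
have q0 : q != 0 by apply: contraNneq b0 => e; rewrite bE e mulr0.
apply: (IH a' b') => //; last by apply: leq_trans le_m; rewrite bE msize_mul_lt.
rewrite fE aE bE !rmorphM -mulf_div mulfV ?mulr1 //.
by rewrite to_frac_eq0.
Qed.

Lemma reduced_pole a b q : b != 0 -> irreducible_mpoly q -> ~ poly_dvd q a ->
  poly_dvd q b -> exists k b', [/\ (0 < k)%N, b = q ^+ k * b', ~ poly_dvd q b' &
    pole_of_order (to_frac a / to_frac b) q k].
Proof.
move=> b0 [uq _] na qb; have [k [b' [bE nb]]] := factor_out b0 uq.
have k0 : (0 < k)%N.
  by case: k bE => // bE; case: nb; rewrite -[b']mul1r -(expr0 q) -bE.
by exists k, b'; split=> //; exists a, b'; rewrite bE.
Qed.

End Factorization.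

Lemma residue_rearrange (K : fieldType) (c q u A d m : K) k : A != 0 -> d != 0 ->
  c * (q * u / A * m) = u * (c * (d / A ^+ k.+2)) * (q * d^-1 * A ^+ k.+1 * m).
Proof.
move=> A0 d0; rewrite !exprS; field; rewrite A0 d0 /= expf_neq0 //.
Qed.

Section Uniqueness.
Variable R : realType.

Local Notation aff v := (to_frac (affine_poly v)).
Local Notation inner := (lift ord0 ord0).

(** The map u -> [(1, u) *m B]. With B the rows of a facet chart other than the inward one, it
    parametrizes the hyperplane of the facet by the coordinates in which the residue is taken. *)
Definition param_map m n (B : 'M[R]_(m.+1, n.+1)) (i : 'I_n) : ratfun R m :=
  aff (col (lift ord0 i) B) / aff (col ord0 B).

Lemma param_subst_affine m n (B : 'M[R]_(m.+1, n.+1)) v : col ord0 B != 0 ->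
  poly_subst (param_map B) (affine_poly v) = aff (B *m v) / aff (col ord0 B).
Proof.
move=> B0; have b0 : aff (col ord0 B) != 0 by apply: affine_frac_neq0.
rewrite (rmorph_affine (poly_subst (param_map B))) /= poly_substC.
rewrite affine_poly_mulmx rmorph_sum big_ord_recl mulrDl /= to_fracZ mulfK //.
congr (_ + _); rewrite mulr_suml; apply: eq_bigr => j _ /=.
by rewrite poly_substC poly_substX to_fracZ mulrA.
Qed.

Lemma param_subst_incl m n (B : 'M[R]_(m.+1, n.+1)) (C : 'M[R]_(n.+1, m.+1)) p :
  col ord0 B != 0 -> col ord0 C = delta_mx ord0 0 ->
  poly_subst (param_map B) (affine_subst C p) = poly_subst (chart_map (B *m C)) p.
Proof.
move=> B0 C0.
rewrite -[LHS]/((poly_subst (param_map B) \o affine_subst C) p) rmorph_mpolyE.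
apply: eq_bigr => mm _; congr (_ * _).
  by rewrite /= affine_substC poly_substC.
apply: eq_bigr => i _; congr (_ ^+ _); rewrite /= /affine_subst mmapX mmap1U.
rewrite param_subst_affine // /chart_map.
have colBC j : col j (B *m C) = B *m col j C by rewrite !colE mulmxA.
by rewrite !colBC C0 -colE.
Qed.

(* The hyperplane of l is not the hyperplane at infinity of the chart. *)
Definition nonconstant_at n (l : 'cV[R]_n.+1) := exists J, J != ord0 /\ l J 0 != 0.

(** Modulo l, p equals its reduction that avoids the variable J. On such polynomials the
    parametrization acts as the chart [B *m C] of the hyperplane, and charts are injective. *)
Lemma param_kernel n (B : 'M[R]_(n.+1, n.+2)) l p :
  row_free B -> B *m l = 0 -> nonconstant_at l -> col ord0 B != 0 ->
  poly_subst (param_map B) p = 0 -> poly_dvd (affine_poly l) p.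
Proof.
move=> freeB Bl [J [J0 lJ]] B0 p0.
have l0 : l != 0 by apply: contraNneq lJ => ->; rewrite mxE.
pose C : 'M[R]_(n.+2, n.+1) := col' J 1%:M.
have C0 : col ord0 C = delta_mx ord0 0 by apply: hyper_incl_col0.
have uBC : B *m C \in unitmx.
  apply: unitmx_ker => v; rewrite -mulmxA => /(row_free_ker freeB l0 Bl) [a aE].
  have a0 : a = 0.
    have /colP/(_ J) := aE; rewrite [RHS]mxE mxE big1 => [/esym/eqP|i _].
      by rewrite mulf_eq0 (negbTE lJ) orbF => /eqP.
    by rewrite !mxE (negbTE (neq_lift J i)) mul0r.
  by rewrite -[v]mul1mx -(hyper_proj_col' l J) -mulmxA aE a0 scale0r mulmx0.
apply: (hyper_kernel J0 lJ); rewrite /=.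
have [a aE] := hyper_decompose J0 lJ p.
have /eqP := congr1 (poly_subst (param_map B)) aE.
rewrite rmorphB rmorphM /= param_subst_affine // Bl affine_poly0 rmorph0 mul0r mulr0 p0.
rewrite sub0r oppr_eq0 param_subst_incl // chart_subst_eq0 // => /eqP ->.
by rewrite rmorph0.
Qed.

Lemma restrict_kernel n (p : mpoly n.+1 R) :
  restrict_rmorph R n p = 0 -> poly_dvd (mpolyX R (mnm1 ord0)) p.
Proof.
move=> p0; rewrite -affine_poly_delta1.
have J0 : inner != ord0 :> 'I_n.+2 by [].
have lJ : (delta_mx inner 0 : 'cV[R]_n.+2) inner 0 != 0 by rewrite mxE !eqxx oner_neq0.
apply: (hyper_kernel J0 lJ); rewrite -[RHS]p0 /=; congr (to_frac (affine_subst _ p)).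
apply/matrixP => i j; rewrite !mxE big_ord1 !mxE.
have -> : (lift inner i == inner) = false by rewrite eq_sym (negbTE (neq_lift _ _)).
by rewrite !mul0r mulr0 subr0.
Qed.

Lemma restrict_spec_rconst n c : specializes (restrict_rmorph R n) (rconst n.+1 c) (rconst n c).
Proof.
have := specializes_tofrac (restrict_rmorph R n) (mpolyC n.+1 c).
by rewrite /= affine_substC.
Qed.

Lemma restrict_spec_affine n (v : 'cV[R]_n.+2) :
  specializes (restrict_rmorph R n) (aff v) (aff (row' inner 1%:M *m v)).
Proof. by rewrite -restrict_rmorph_affine; apply: specializes_tofrac. Qed.

(** Pulled back to the chart g, N is u_1 times the form, multiplied by a factor regular along {u_1 =
    0}. A zero residue thus makes N vanish on the hyperplane of l. *)
Lemma residue0_dvd n (l : 'cV[R]_n.+2) g D N M :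
  facet_chart l g -> nonconstant_at l -> is_residue (form_in_chart g D) 0 ->
  D * to_frac (affine_poly l * M) = to_frac N -> poly_dvd (affine_poly l) N.
Proof.
move=> gl lJ /is_residueP res DN; have [ug Bl ql] := gl.
have l0 : l != 0 by case: lJ => J [_]; apply: contraNneq => ->; rewrite mxE.
set B := row' inner g in Bl; have freeB : row_free B := facet_chart_free gl.
(* The hyperplane of l is not the one at infinity, so the denominator of its parametrization is not
   zero. *)
have B0 : col ord0 B != 0.
  case: lJ => J [J0 lJ]; apply: contraNneq lJ; rewrite colE.
  case/(row_free_ker freeB l0 Bl) => a aE.
  have a0 : a != 0.
    apply/eqP => a0; have /colP/(_ ord0) := aE.
    by rewrite a0 scale0r !mxE eqxx => /eqP; rewrite oner_eq0.
  have /colP/(_ J) := aE; rewrite !mxE (negbTE J0) => /esym/eqP.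
  by rewrite mulf_eq0 (negbTE a0).
apply: (param_kernel freeB Bl lJ B0).
have QgB : row' inner 1%:M *m g = B by rewrite /B !row'Esub mul_rowsub_mx mul1mx.
have colB j : row' inner 1%:M *m col j g = col j B by rewrite !colE mulmxA QgB.
have b0 : aff (col ord0 B) != 0 by apply: affine_frac_neq0.
have spt i : specializes (restrict_rmorph R n) (chart_map g i) (param_map B i).
  apply: specializesM; first by rewrite -colB; apply: restrict_spec_affine.
  apply: specializesV => //; rewrite -colB; apply: restrict_spec_affine.
have spp p : specializes (restrict_rmorph R n) (poly_subst (chart_map g) p)
    (poly_subst (param_map B) p).
  have := specializes_poly_subst p spt; congr specializes.
  by apply: eq_bigr => mm _; rewrite /= affine_substC.
apply: (specializes_uniq (spp N)).
have e : poly_subst (chart_map g) N =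
    rat_comp (chart_map g) D * poly_subst (chart_map g) (affine_poly l * M).
  apply: (specializes_uniq (specializes_tofrac (poly_subst (chart_map g)) N)).
  rewrite -[FracField.tofrac N]/(to_frac N) -DN; apply: specializesM.
    exact: specializes_rat_comp.
  exact: specializes_tofrac.
have A0 : aff (col ord0 g) != 0 by apply/affine_frac_neq0/col_unit_neq0.
have d0 : rconst n.+1 (\det g) != 0 by rewrite rconst_eq0 -unitfE -unitmxE.
have -> : poly_subst (chart_map g) N =
   (rvar R ord0 * form_in_chart g D) *
   (rconst n.+1 ((row inner g *m l) 0 0) * (rconst n.+1 (\det g))^-1 * aff (col ord0 g) ^+ n.+1 *
      poly_subst (chart_map g) M).
  rewrite e form_in_chartE // rmorphM /= chart_subst_affine // facet_chart_mul //.
  rewrite affine_polyZ to_fracZ affine_poly_delta1 -[to_frac (mpolyX _ _)]/(rvar R ord0).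
  by rewrite (residue_rearrange _ _ _ _ n A0 d0).
rewrite -[X in specializes _ _ X](mul0r (rconst n ((row inner g *m l) 0 0) *
  (rconst n (\det g))^-1 * aff (col ord0 B) ^+ n.+1 * poly_subst (param_map B) M)).
apply: specializesM => //; apply: specializesM; last exact: spp.
apply: specializesM; last first.
  by apply: specializesX; rewrite -colB; apply: restrict_spec_affine.
apply: specializesM; first exact: restrict_spec_rconst.
apply: specializesV; last exact: restrict_spec_rconst.
by rewrite rconst_eq0 -unitfE -unitmxE.
Qed.

End Uniqueness.

Lemma monomial_rearrange (K : fieldType) (u P : K) a b c : u != 0 ->
  (u ^+ a)^-1 * (P * (u ^+ b)^-1) * (u ^+ c * (u ^+ b * u ^+ a)) = P * u ^+ c.
Proof.
move=> u0; have ua : u ^+ a != 0 by rewrite expf_neq0.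
have ub : u ^+ b != 0 by rewrite expf_neq0.
by field; rewrite ua ub.
Qed.

Lemma degree_rearrange (K : fieldType) (p u d : K) k e : u != 0 -> d != 0 ->
  p * u ^+ e = u * (p * (d / u ^+ k.+2)) * (d^-1 * u ^+ (k + e).+1).
Proof.
move=> u0 d0; rewrite -addSn exprD !exprS.
have uk : u ^+ k != 0 by rewrite expf_neq0.
by field; rewrite u0 d0 uk.
Qed.

(** * Linear denominators, and behaviour at infinity *)

Section HomogeneousForms.
Variable R : realType.

Local Notation aff v := (to_frac (affine_poly v)).
Local Notation inner := (lift ord0 ord0).

Lemma product_of_affine n (P : 'cV[R]_n.+2 -> Prop) (b : mpoly n.+1 R) : b != 0 ->
  (forall q, irreducible_mpoly q -> poly_dvd q b ->
     exists l c, [/\ P l, c != 0 & q = c *: affine_poly l]) ->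
  exists c ls, [/\ c != 0, b = c *: \prod_(l <- ls) affine_poly l &
    forall l, l \in ls -> P l /\ nonconstant_at l].
Proof.
have [m] := ubnP (mmeasure mdeg b); elim: m b => // m IH b; rewrite ltnS => le_m b0 irrb.
have [|ub] := boolP (b \is a GRing.unit).
  by case/mpoly_unitP => c c0 ->; exists c, [::]; rewrite big_nil -mul_mpolyC mulr1.
have [q irr qb] := exists_irreducible_factor b0 ub.
have [b' bE] := qb; have [uq _] := irr.
have b'0 : b' != 0 by apply: contraNneq b0 => e; rewrite bE e mul0r.
have q0 : q != 0 by apply: contraNneq b0 => e; rewrite bE e mulr0.
have [|//|q' irr' [c' c'E]|c [ls [c0 b'E lsP]]] := IH b'.
- by apply: leq_trans le_m; rewrite bE msize_mul_lt.
- by apply: irrb => //; exists (c' * q); rewrite bE c'E mulrAC.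
have [l [e [Pl e0 qE]]] := irrb q irr qb.
have lJ : nonconstant_at l.
  rewrite qE in irr; apply: irreducible_affine_nonconst irr.
  by apply: contraNneq q0 => l0; rewrite qE l0 affine_poly0 scaler0.
exists (c * e), (l :: ls); rewrite mulf_neq0 //; split=> //.
  by rewrite big_cons bE b'E qE -!mul_mpolyC mpolyCM; ring.
by move=> l'; rewrite inE => /orP [/eqP ->|/lsP].
Qed.

Lemma linear_denominator n (P : 'cV[R]_n.+2 -> Prop) (w : ratfun R n.+1) :
  (forall q k, irreducible_mpoly q -> (0 < k)%N -> pole_of_order w q k ->
     exists l c, [/\ P l, c != 0 & q = c *: affine_poly l]) ->
  exists ls N, (forall l, l \in ls -> P l /\ nonconstant_at l) /\
    w * to_frac (\prod_(l <- ls) affine_poly l) = to_frac N.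
Proof.
move=> poles; have [a [b [b0 wE red]]] := reduced_fraction w.
have [q irr qb|c [ls [c0 bE lsP]]] := @product_of_affine _ P b b0.
  have [k [b' [k0 _ _ pole]]] := reduced_pole b0 irr (red q irr qb) qb.
  by rewrite -wE in pole; apply: (poles q k).
exists ls, (c^-1 *: a); split=> //.
have e : \prod_(l <- ls) affine_poly l = c^-1 *: b by rewrite bE scalerA mulVf // scale1r.
rewrite e wE !to_fracZ mulrCA mulfVK // to_frac_eq0 //.
Qed.

Lemma simple_pole_regular n (f : ratfun R n.+1) :
  (forall k, (0 < k)%N -> pole_of_order f (mpolyX R (mnm1 ord0)) k -> k = 1%N) ->
  exists v, specializes (restrict_rmorph R n) (rvar R ord0 * f) v.
Proof.
move=> poles; have [a [b [b0 fE red]]] := reduced_fraction f.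
set X := mpolyX R (mnm1 ord0) in poles.
have irr : irreducible_mpoly X.
  rewrite /X -affine_poly_delta1; apply: (@affine_irreducible _ _ _ inner) => //.
  by rewrite mxE !eqxx oner_neq0.
have regular p q : ~ poly_dvd X q ->
    exists v, specializes (restrict_rmorph R n) (to_frac p / to_frac q) v.
  move=> nq; exists (restrict_rmorph R n p / restrict_rmorph R n q), p, q; split=> //.
  by apply/eqP => /restrict_kernel.
have [Xb|nXb] := pselect (poly_dvd X b); last first.
  have [v vP] := regular (X * a) b nXb.
  by exists v; rewrite fE mulrA -[rvar R ord0]/(to_frac X) -rmorphM.
have [k [b' [k0 bE nb' pole]]] := reduced_pole b0 irr (red X irr Xb) Xb.
rewrite -fE in pole; have k1 := poles k k0 pole.
have [v vP] := regular a b' nb'.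
exists v; suff -> : rvar R ord0 * f = to_frac a / to_frac b' by [].
rewrite fE bE k1 expr1 rmorphM invfM mulrCA -[rvar R ord0]/(to_frac X).
by rewrite mulVKf // /X; apply: rvar_neq0.
Qed.

(* The chart of P^d in which the hyperplane at infinity is {u_1 = 0}. *)
Definition swap_chart n : 'M[R]_n.+2 := tperm_mx ord0 inner.

Lemma swap_chart_unit n : swap_chart n \in unitmx.
Proof. by rewrite /swap_chart /tperm_mx unitmx_perm. Qed.

Lemma col_swap_chart n j : col j (swap_chart n) = delta_mx (tperm ord0 inner j) 0.
Proof.
apply/colP => i; rewrite !mxE /tperm_mx andbT; congr (_%:R); congr nat_of_bool.
by rewrite -(inj_eq (@perm_inj _ (tperm ord0 inner))) tpermK.
Qed.

Lemma swap_chart_col0 n : aff (col ord0 (swap_chart n)) = rvar R ord0.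
Proof. by rewrite col_swap_chart tpermL affine_poly_delta1. Qed.

Lemma swap_chart_map0 n : chart_map (swap_chart n) ord0 = (rvar R ord0)^-1.
Proof.
rewrite /chart_map swap_chart_col0 col_swap_chart tpermR affine_poly_delta0.
by rewrite rmorph1 mul1r.
Qed.

Lemma swap_chart_map1 n (j : 'I_n) :
  chart_map (swap_chart n) (lift ord0 j) = rvar R (lift ord0 j) / rvar R ord0.
Proof.
rewrite /chart_map swap_chart_col0 col_swap_chart tpermD //.
by rewrite affine_poly_delta1.
Qed.

(** The exponent that remains when a monomial is read on the hyperplane at infinity. Monomials of
    equal degree keep distinct tails, so no terms of the top-degree part can merge. *)
Definition tail_mnm n (m : multinom n.+1) : multinom n :=
  Multinom [tuple m (lift ord0 j) | j < n].

Lemma tail_mnmE n (m : multinom n.+1) j : tail_mnm m j = m (lift ord0 j).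
Proof. by rewrite /tail_mnm multinomE tnth_mktuple. Qed.

Lemma mdeg_tail n (m : multinom n.+1) : mdeg m = (m ord0 + mdeg (tail_mnm m))%N.
Proof.
rewrite !mdegE big_ord_recl; congr (_ + _)%N.
by apply: eq_bigr => j _; rewrite tail_mnmE.
Qed.

Lemma mdeg_tail_inj n (m m' : multinom n.+1) :
  mdeg m = mdeg m' -> tail_mnm m = tail_mnm m' -> m = m'.
Proof.
move=> dm tm; apply/mnmP => i; case: (unliftP ord0 i) => [j ->|->].
  by rewrite -!tail_mnmE tm.
by move: dm; rewrite !mdeg_tail tm => /eqP; rewrite eqn_add2r => /eqP.
Qed.

Lemma restrict_spec_rvar0 n : specializes (restrict_rmorph R n) (rvar R ord0) 0.
Proof.
have := restrict_spec_affine (delta_mx inner 0 : 'cV[R]_n.+2).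
rewrite affine_poly_delta1 [X in aff X](_ : _ = 0) ?affine_poly0 ?rmorph0 //.
apply/colP => i; rewrite row'Esub mul_rowsub_mx mul1mx !mxE.
by rewrite eq_sym (negbTE (neq_lift inner i)).
Qed.

Lemma restrict_spec_rvar n (j : 'I_n) :
  specializes (restrict_rmorph R n) (rvar R (lift ord0 j)) (rvar R j).
Proof.
have := restrict_spec_affine (delta_mx (lift ord0 (lift ord0 j)) 0 : 'cV[R]_n.+2).
rewrite affine_poly_delta1 (_ : _ *m _ = delta_mx (lift ord0 j) 0).
  by rewrite affine_poly_delta1.
apply/colP => i; rewrite row'Esub mul_rowsub_mx mul1mx !mxE !andbT.
congr (_%:R); congr nat_of_bool; rewrite -!val_eqE /= /bump /=.
by case: (nat_of_ord i).
Qed.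

(** In the swapped chart a monomial of degree k is u_1^-k times its tail; after multiplication by
    u_1^e, only degree e survives on {u_1 = 0}. *)
Lemma top_monomial_specializes n (m : multinom n.+1) e : (mdeg m <= e)%N ->
  specializes (restrict_rmorph R n)
    (\prod_i chart_map (swap_chart n) i ^+ m i * rvar R ord0 ^+ e)
    (to_frac (mpolyX R (tail_mnm m)) * (mdeg m == e)%:R).
Proof.
move=> le_e; have u0 : rvar R (@ord0 n) != 0 by apply: rvar_neq0.
have -> : \prod_i chart_map (swap_chart n) i ^+ m i * rvar R ord0 ^+ e =
    \prod_j rvar R (lift ord0 j) ^+ m (lift ord0 j) * rvar R ord0 ^+ (e - mdeg m).
  rewrite big_ord_recl swap_chart_map0.
  rewrite (eq_bigr (fun j => rvar R (lift ord0 j) ^+ m (lift ord0 j) *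
      (rvar R ord0 ^+ m (lift ord0 j))^-1)); last first.
    by move=> j _; rewrite swap_chart_map1 expr_div_n.
  rewrite big_split /= prodfV prodrXr.
  have -> : (\sum_(j < n) m (lift ord0 j) = mdeg m - m ord0)%N.
    by rewrite [mdeg m]mdegE big_ord_recl addKn.
  have le0 : (m ord0 <= mdeg m)%N by rewrite mdeg_tail leq_addr.
  rewrite -{1}(subnK le_e) -{3}(subnK le0) !exprD exprVn.
  exact: monomial_rearrange.
apply: specializesM.
  rewrite mpolyXE_id rmorph_prod; apply: specializes_prod => j _.
  rewrite tail_mnmE rmorphXn; apply: specializesX; exact: restrict_spec_rvar.
rewrite (_ : (mdeg m == e)%:R = 0 ^+ (e - mdeg m)); last first.
  by rewrite expr0n subn_eq0 eqn_leq le_e.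
by apply: specializesX; apply: restrict_spec_rvar0.
Qed.

(** For N of degree e, the substitution gives a pole of order e at infinity and the Jacobian n + 2
    more, while regularity is assumed after multiplication by a single u_1. Multiplying by the
    remaining u_1^(n + e + 1) shows that the top-degree part of N is zero. *)
Lemma polynomial_form_zero n (N : mpoly n.+1 R) v :
  specializes (restrict_rmorph R n)
    (rvar R ord0 * form_in_chart (swap_chart n) (to_frac N)) v -> N = 0.
Proof.
move=> sp; apply/eqP; apply: contraT => N0.
pose e := mdeg (mlead N); have us := swap_chart_unit n.
have u0 : rvar R (@ord0 n) != 0 by apply: rvar_neq0.
have d0 : rconst n.+1 (\det (swap_chart n)) != 0.
  by rewrite rconst_eq0 -unitfE -unitmxE.
(* The top-degree part of N on the hyperplane at infinity; the leading monomial has maximal total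
   degree. *)
pose G : mpoly n R := \sum_(m <- msupp N) mcoeff m N *: (mpolyX R (tail_mnm m) *+ (mdeg m == e)).
have spG : specializes (restrict_rmorph R n)
    (poly_subst (chart_map (swap_chart n)) N * rvar R ord0 ^+ e) (to_frac G).
  rewrite /G rmorph_sum /poly_subst /mmap mulr_suml.
  rewrite big_seq [X in specializes _ _ X]big_seq; apply: specializes_sum => m mN.
  rewrite /= to_fracZ -mulrA; apply: specializesM; first exact: restrict_spec_rconst.
  rewrite rmorphMn -mulr_natr; apply: top_monomial_specializes.
  by rewrite -ltnS mlead_deg // msize_mdeg_lt.
have G0 : G = 0.
  apply: to_frac_inj; rewrite rmorph0; apply: (specializes_uniq spG).
  have -> : poly_subst (chart_map (swap_chart n)) N * rvar R ord0 ^+ e =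
     (rvar R ord0 * form_in_chart (swap_chart n) (to_frac N)) *
     ((rconst n.+1 (\det (swap_chart n)))^-1 * rvar R ord0 ^+ (n + e).+1).
    rewrite form_in_chartE // swap_chart_col0.
    rewrite (rat_comp_eq us (specializes_tofrac (poly_subst (chart_map (swap_chart n))) N)).
    have := degree_rearrange (poly_subst (chart_map (swap_chart n)) N) n e u0 d0.
    by [].
  rewrite -[X in specializes _ _ X](mulr0 v); apply: specializesM => //.
  rewrite -[X in specializes _ _ X](mulr0 (rconst n (\det (swap_chart n)))^-1).
  apply: specializesM.
    apply: specializesV; last exact: restrict_spec_rconst.
    by rewrite rconst_eq0 -unitfE -unitmxE.
  have e0 : 0 = 0 ^+ (n + e).+1 :> ratfun R n by rewrite expr0n.
  rewrite [X in specializes _ _ X]e0.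
  by apply: specializesX; apply: restrict_spec_rvar0.
have := congr1 (mcoeff (tail_mnm (mlead N))) G0.
rewrite /G mcoeff0 raddf_sum (bigD1_seq (mlead N)) ?msupp_uniq ?mlead_supp //=.
rewrite eqxx mulr1n mcoeffZ mcoeffX eqxx mulr1 big_seq_cond big1 ?addr0 => [/eqP|m].
  by rewrite mleadc_eq0 (negbTE N0).
case/andP => mN neq; rewrite mcoeffZ mcoeffMn mcoeffX.
have [dm|_] := eqVneq (mdeg m) e; last by rewrite mulr0n mulr0.
have [tm|_] := eqVneq (tail_mnm m) (tail_mnm (mlead N)); last by rewrite mul0rn mulr0.
by rewrite (mdeg_tail_inj dm tm) eqxx in neq.
Qed.

End HomogeneousForms.

Lemma common_denominator (K : comNzRingType) (w w' a b : K) :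
  w * (a * b) - w' * (a * b) = w * a * b - w' * b * a.
Proof. by ring. Qed.

Section CanonicalFormUnique.
Variable R : realType.

Local Notation aff v := (to_frac (affine_poly v)).
Local Notation inner := (lift ord0 ord0).

(** Factors are cancelled one at a time. The divisibility hypothesis allows any cofactor M, so it
    applies again when a hyperplane is repeated in [ls]. *)
Lemma cancel_linear_denominator n (P : 'cV[R]_n.+2 -> Prop) (D : ratfun R n.+1)
    (ls : seq 'cV[R]_n.+2) (N : mpoly n.+1 R) :
  (forall l M N', P l -> nonconstant_at l ->
     D * to_frac (affine_poly l * M) = to_frac N' -> poly_dvd (affine_poly l) N') ->
  (forall l, l \in ls -> P l /\ nonconstant_at l) ->
  D * to_frac (\prod_(l <- ls) affine_poly l) = to_frac N ->
  exists N', D = to_frac N'.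
Proof.
move=> dvd; elim: ls N => [|l ls IH] N lsP.
  by rewrite big_nil rmorph1 mulr1 => ->; exists N.
rewrite big_cons => DN; have [Pl lJ] := lsP l (mem_head _ _).
have [N' NE] := dvd _ _ _ Pl lJ DN.
apply: (IH N') => [l' l'ls|]; first by apply: lsP; rewrite inE l'ls orbT.
have l0 : aff l != 0.
  by apply: affine_frac_neq0; case: lJ => J [_]; apply: contraNneq => ->; rewrite mxE.
by apply: (mulfI l0); rewrite mulrCA -rmorphM DN NE rmorphM mulrC.
Qed.

(** Pointedness is used in dimension 0, where it fixes the sign of the chosen point; the functional
    V0 restricts to every facet. It is the residues that the induction compares. *)
Lemma canonical_form_uniq d C o (w w' : ratfun R d) :
  o != 0 ->
  (exists V0 : 'cV[R]_d.+1, forall x, C x -> x != 0 -> 0 < (x *m V0) 0 0) ->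
  canonical_form C o w -> canonical_form C o w' -> w = w'.
Proof.
elim: d C o w w' => [|n IH] C o w w' o0 [V0 V0P].
  move=> [x [Cx x0 ->]] [y [Cy y0 ->]]; congr (rconst _ _); rewrite !sgrM; congr (_ * _).
  have sV z : C z -> z != 0 -> Num.sg (z 0 0) = Num.sg (V0 0 0).
    move=> Cz z0; have := V0P z Cz z0; rewrite mxE big_ord1 => h.
    have [V|V|V] := ltgtP (V0 0 0) 0.
    - by rewrite (ltr0_sg V); move: h; rewrite nmulr_lgt0 // => /ltr0_sg.
    - by rewrite (gtr0_sg V); move: h; rewrite pmulr_lgt0 // => /gtr0_sg.
    by move: h; rewrite V mulr0 ltxx.
  by rewrite !sV.
move=> [w0 poles res] [w0' poles' res'].
pose P l := facet C l.
have chart1 := unitmx1 R n.+2.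
have lin (f : ratfun R n.+1) :
  (forall (g : 'M[R]_n.+2) (q : mpoly n.+1 R) (k : nat),
     g \in unitmx -> irreducible_mpoly q -> (0 < k)%N ->
     pole_of_order (form_in_chart g f) q k <->
     k = 1%N /\ exists l (c : R), [/\ facet C l, c != 0 & q = c *: affine_poly (g *m l)]) ->
  exists ls N, (forall l, l \in ls -> P l /\ nonconstant_at l) /\
    f * to_frac (\prod_(l <- ls) affine_poly l) = to_frac N.
  move=> fP; apply: linear_denominator => q k irr k0 pole.
  have [|_ [l [c [fl c0 qE]]]] := (fP 1%:M q k chart1 irr k0).1.
    by rewrite form_in_chart1.
  by exists l, c; rewrite mul1mx in qE.
(* The standard chart does not see poles at infinity; in the swapped chart they have order at most
   one. *)
have reg (f : ratfun R n.+1) :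
  (forall (g : 'M[R]_n.+2) (q : mpoly n.+1 R) (k : nat),
     g \in unitmx -> irreducible_mpoly q -> (0 < k)%N ->
     pole_of_order (form_in_chart g f) q k <->
     k = 1%N /\ exists l (c : R), [/\ facet C l, c != 0 & q = c *: affine_poly (g *m l)]) ->
  exists v, specializes (restrict_rmorph R n)
    (rvar R ord0 * form_in_chart (swap_chart R n) f) v.
  move=> fP; apply: simple_pole_regular => k k0 pole.
  have irr : irreducible_mpoly (mpolyX R (mnm1 (@ord0 n))).
    rewrite -affine_poly_delta1; apply: (@affine_irreducible _ _ _ inner) => //.
    by rewrite mxE !eqxx oner_neq0.
  by have [] := (fP _ _ k (swap_chart_unit R n) irr k0).1 pole.
have [ls [N [lsP NE]]] := lin w poles.
have [ls' [N' [lsP' NE']]] := lin w' poles'.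
have [v sp] := reg w poles; have [v' sp'] := reg w' poles'.
have [|||M DE] := @cancel_linear_denominator n P (w - w') (ls ++ ls')
    (N * \prod_(l <- ls') affine_poly l - N' * \prod_(l <- ls) affine_poly l).
- move=> l A B fl lJ; have l0 : l != 0 by case: fl.
  have [g gl] := exists_facet_chart l0; have [ug Bl _] := gl.
  have [r rw cr] := res l g fl gl; have [r' rw' cr'] := res' l g fl gl.
  apply: (residue0_dvd gl lJ); rewrite form_in_chartB //.
  have rr : r = r'.
    apply: (IH _ _ _ _ _ _ cr cr').
      by rewrite mulf_neq0 // -unitfE -unitmxE.
    exists (row' inner g *m V0) => y Cy y0; rewrite mulmxA; apply: V0P => //.
    apply: contraNneq y0 => yB.
    by rewrite -[y]mulmx1 -(mulmxVp (facet_chart_free gl)) mulmxA yB mul0mx.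
  apply/is_residueP; rewrite mulrBr -[X in specializes _ _ X](subrr r) {2}rr.
  by apply: specializesB; apply/is_residueP.
- by move=> l; rewrite mem_cat => /orP [/lsP|/lsP'].
- rewrite big_cat rmorphM mulrBl rmorphB !rmorphM /= -NE -NE'.
  exact: common_denominator.
apply/eqP; rewrite -subr_eq0 DE; apply/eqP.
have := specializesB sp sp'; rewrite -mulrBr -form_in_chartB ?swap_chart_unit // DE.
by move/polynomial_form_zero ->; rewrite rmorph0.
Qed.

End CanonicalFormUnique.

(** * Cones over polyhedra *)

Section DoubleDescription.
Variable R : realFieldType.

(** Generators are indexed by a finite type, so that an elimination step can index the new ones by
    pairs and single generators. *)
Definition finite_hull (I : finType) n (X : I -> 'rV[R]_n) (x : 'rV[R]_n) : Prop :=
  exists c : I -> R, (forall i, 0 <= c i) /\ x = \sum_i c i *: X i.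

Lemma orthant_hull n (x : 'rV[R]_n) :
  finite_hull (fun u : bool * 'I_n => (-1) ^+ u.1 *: delta_mx 0 u.2) x.
Proof.
exists (fun u : bool * 'I_n => Num.max 0 ((-1) ^+ u.1 * x 0 u.2)); split=> [u|].
  by rewrite le_max lexx.
rewrite [LHS]row_sum_delta.
rewrite -(pair_big xpredT xpredT (fun (b : bool) (j : 'I_n) =>
   Num.max 0 ((-1) ^+ b * x 0 j) *: ((-1) ^+ b *: delta_mx 0 j))) /=.
rewrite big_bool /= -big_split; apply: eq_bigr => j _ /=.
rewrite !scalerA -scalerDl; congr (_ *: _).
rewrite expr1 expr0 mulN1r mul1r mulr1 mulrN1.
have [h|h] := leP 0 (x 0 j).
  by rewrite max_l ?oppr_le0 // oppr0 add0r.
by rewrite max_r ?oppr_ge0 ?ltW // opprK addr0.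
Qed.

Lemma psumr_eq0_mul (I : finType) (P : pred I) (c h : I -> R) i :
  (forall i, P i -> 0 <= c i * h i) -> \sum_(i | P i) c i * h i = 0 -> P i -> h i != 0 ->
  c i = 0.
Proof.
move=> ch /eqP; rewrite psumr_eq0 // => /allP/(_ i); rewrite mem_index_enum.
by move=> /(_ isT)/implyP h0 Pi hi; have := h0 Pi; rewrite mulf_eq0 (negbTE hi) orbF => /eqP.
Qed.

(* One step of Fourier-Motzkin elimination, on generators: the generators on the
   nonnegative side of h, and the points where the segments joining generators
   on the two sides meet the hyperplane of h. *)
Definition halfspace_gens (I : finType) n (X : I -> 'rV[R]_n) (h : 'cV[R]_n)
    (u : I * I + I) : 'rV[R]_n :=
  let ht i := (X i *m h) 0 0 in
  match u with
  | inl (i, j) => if (0 <= ht i) && (ht j < 0) then ht i *: X j - ht j *: X i else 0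
  | inr i => if 0 <= ht i then X i else 0
  end.

(** Let p be the total height of the nonnegative part of the combination x, and q the total depth of
    its negative part; then q <= p. Mixing each negative generator with all nonnegative ones in
    proportion to their heights uses up the fraction q / p of the nonnegative part, and the rest
    remains. *)
Lemma halfspace_hull (I : finType) n (X : I -> 'rV[R]_n) (h : 'cV[R]_n) x :
  finite_hull (halfspace_gens X h) x <-> finite_hull X x /\ 0 <= (x *m h) 0 0.
Proof.
pose ht i := (X i *m h) 0 0; pose Y := halfspace_gens X h; rewrite -/Y.
have sumh (J : finType) (Z : J -> 'rV[R]_n) (c : J -> R) :
    ((\sum_j c j *: Z j) *m h) 0 0 = \sum_j c j * (Z j *m h) 0 0.
  rewrite mulmx_suml summxE; apply: eq_bigr => j _.
  by rewrite -scalemxAl mxE.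
split=> [[c [c0 xE]]|[[c [c0 xE]] xh]].
  have Yh u : 0 <= (Y u *m h) 0 0.
    case: u => [[i j]|i] /=; case: ifP => hi; try by rewrite ?mul0mx ?mxE.
      by rewrite mulmxBl -!scalemxAl mxE [X in X + _]mxE [X in _ + X]mxE
           [X in _ + - X]mxE mulrC subrr.
    exact: hi.
  split; last by rewrite xE sumh; apply: sumr_ge0 => u _; apply: mulr_ge0.
  have hullD y z : finite_hull X y -> finite_hull X z -> finite_hull X (y + z).
    move=> [a [a0 ->]] [b [b0 ->]]; exists (fun i => a i + b i).
    split=> [i|]; first by rewrite addr_ge0.
    by rewrite -big_split; apply: eq_bigr => i _; rewrite scalerDl.
  have hull0 : finite_hull X 0.
    by exists (fun=> 0); split=> //; rewrite big1 // => i _; rewrite scale0r.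
  have hullZ k y : 0 <= k -> finite_hull X y -> finite_hull X (k *: y).
    move=> k0 [a [a0 ->]]; exists (fun i => k * a i); split=> [i|]; first exact: mulr_ge0.
    by rewrite scaler_sumr; apply: eq_bigr => i _; rewrite scalerA.
  have hullX i : finite_hull X (X i).
    exists (fun j => (j == i)%:R); split=> [j|]; first exact: ler0n.
    rewrite (bigD1 i) //= eqxx scale1r big1 ?addr0 // => j /negbTE ->.
    by rewrite scale0r.
  rewrite xE; apply: big_ind => // u _; apply: (hullZ) => //.
  case: u => [[i j]|i] /=; case: ifP => // /andP [hi hj].
  by rewrite -scaleNr; apply: (hullD); apply: (hullZ) => //; rewrite oppr_ge0 ltW.
pose p := \sum_(i | 0 <= ht i) c i * ht i.
pose q := \sum_(j | ~~ (0 <= ht j)) c j * - ht j.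
have p0 : 0 <= p by apply: sumr_ge0 => i hi; apply: mulr_ge0.
have q0' j : ~~ (0 <= ht j) -> 0 <= c j * - ht j.
  by rewrite -ltNge => hj; rewrite mulr_ge0 // oppr_ge0 ltW.
have q0 : 0 <= q by apply: sumr_ge0.
have qp : q <= p.
  move: xh; rewrite xE sumh (bigID (fun i => 0 <= ht i)) /= -/p.
  rewrite -[X in _ + X]opprK -sumrN; under [X in _ - X]eq_bigr do rewrite -mulrN.
  by rewrite -/q subr_ge0.
have xE' : x = \sum_(i | 0 <= ht i) c i *: X i + \sum_(j | ~~ (0 <= ht j)) c j *: X j.
  by rewrite xE (bigID (fun i => 0 <= ht i)).
exists (fun u => match u with
  | inl (i, j) => if (0 <= ht i) && (ht j < 0) then c i * c j / p else 0
  | inr i => if 0 <= ht i then c i * (1 - q / p) else 0 end); split.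
  case=> [[i j]|i]; case: ifP => // hi; first by rewrite divr_ge0 ?mulr_ge0.
  rewrite mulr_ge0 // subr_ge0; have [->|pn0] := eqVneq p 0; first by rewrite invr0 mulr0.
  by rewrite ler_pdivrMr ?mul1r // lt_def pn0.
rewrite big_sumType /=.
have -> : \sum_(i : I) (if 0 <= ht i then c i * (1 - q / p) else 0) *: (if 0 <= ht i then X i else 0) =
    \sum_(i | 0 <= ht i) (c i * (1 - q / p)) *: X i.
  by rewrite [RHS]big_mkcond; apply: eq_bigr => i _; case: ifP; rewrite ?scale0r.
have -> : \sum_(u : I * I) (let: (i, j) := u in
      if (0 <= ht i) && (ht j < 0) then c i * c j / p else 0) *: Y (inl u) =
   \sum_(i | 0 <= ht i) \sum_(j | ~~ (0 <= ht j)) (c i * c j / p) *: (ht i *: X j - ht j *: X i).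
  rewrite pair_big_dep [RHS]big_mkcond; apply: eq_bigr => -[i j] _ /=.
  by rewrite -ltNge; case: ifP => _; rewrite ?scale0r.
(* For p = 0 also q = 0, hence the negative generators have coefficient 0; division by p gives 0
   here. *)
have [pz|pn0] := eqVneq p 0.
  have qz : q = 0 by apply/eqP; rewrite eq_le q0 -{1}pz qp.
  rewrite [X in X + _]big1 => [|i hi]; last first.
    by rewrite big1 // => j hj; rewrite pz invr0 mulr0 scale0r.
  rewrite add0r qz mul0r subr0; under eq_bigr do rewrite mulr1.
  rewrite xE' [X in _ + X]big1 ?addr0 // => j hj.
  rewrite (psumr_eq0_mul q0' qz hj) ?scale0r // oppr_eq0.
  by move: hj; apply: contraNneq => ->.
have inner i : 0 <= ht i ->
    \sum_(j | ~~ (0 <= ht j)) (c i * c j / p) *: (ht i *: X j - ht j *: X i) =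
    (c i * ht i / p) *: (\sum_(j | ~~ (0 <= ht j)) c j *: X j) + (c i * q / p) *: X i.
  move=> hi; rewrite scaler_sumr /q mulr_sumr mulr_suml scaler_suml -big_split.
  apply: eq_bigr => j _ /=; rewrite scalerBr !scalerA -scaleNr.
  by congr (_ *: _ + _ *: _); ring.
rewrite (eq_bigr _ inner) big_split /= -scaler_suml -mulr_suml -/p divff // scale1r.
rewrite xE' -addrA [LHS]addrC; congr (_ + _); rewrite -big_split; apply: eq_bigr => i _ /=.
by rewrite -scalerDl; congr (_ *: _); field.
Qed.

Lemma polyhedral_cone_hull n (hs : seq 'cV[R]_n) :
  exists (I : finType) (X : I -> 'rV[R]_n), forall x,
    finite_hull X x <-> (forall h, h \in hs -> 0 <= (x *m h) 0 0).
Proof.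
elim: hs => [|h hs [I [X XP]]].
  exists (bool * 'I_n)%type, (fun u : bool * 'I_n => (-1) ^+ u.1 *: delta_mx 0 u.2) => x.
  by split=> // _; apply: orthant_hull.
exists (I * I + I)%type, (halfspace_gens X h) => x; rewrite halfspace_hull XP.
split=> [[Xh xh] h'|hP]; first by rewrite inE => /orP [/eqP ->|/Xh].
by split=> [h' h'hs|]; apply: hP; rewrite inE ?eqxx // h'hs orbT.
Qed.

End DoubleDescription.

Lemma finite_hull_pos_hull (R : realType) (I : finType) n (X : I -> 'rV[R]_n) x :
  finite_hull X x <-> pos_hull (\matrix_(i < #|I|) X (enum_val i)) x.
Proof.
set X' := (\matrix_(i < _) _); split=> [[c [c0 ->]]|[c [c0 ->]]].
  exists (\row_i c (enum_val i)); split=> [i|]; first by rewrite mxE.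
  rewrite mulmx_sum_row (reindex (@enum_val I I)) /=; last first.
    by exists enum_rank => i _; [apply: enum_valK | apply: enum_rankK].
  by apply: eq_bigr => i _; rewrite mxE rowK.
exists (fun i => c 0 (enum_rank i)); split=> [i //|].
rewrite mulmx_sum_row [RHS](reindex (@enum_val I I)) /=; last first.
  by exists enum_rank => i _; [apply: enum_valK | apply: enum_rankK].
by apply: eq_bigr => i _; rewrite enum_valK rowK.
Qed.

(** * The closed cone over a polyhedron *)

Section ProjectiveClosure.
Variable R : realType.
Local Open Scope classical_set_scope.

Lemma continuous_sum (T : topologicalType) (I : Type) (r : seq I) (f : I -> T -> R) :
  (forall i, continuous (f i)) -> continuous (fun x => \sum_(i <- r) f i x).
Proof.
move=> cf; elim: r => [|i r IH] x.
  have -> : (fun x : T => \sum_(i <- [::]) f i x) = cst 0.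
    by apply/funext => y; rewrite big_nil.
  exact: cst_continuous.
have -> : (fun x : T => \sum_(j <- i :: r) f j x) = (fun x => f i x + \sum_(j <- r) f j x).
  by apply/funext => y; rewrite big_cons.
by apply: cvgD; [exact: cf | exact: IH].
Qed.

Lemma mulmx_col_continuous n (V : 'cV[R]_n.+1) :
  continuous (fun x : 'rV[R]_n.+1 => (x *m V) 0 0).
Proof.
have -> : (fun x : 'rV[R]_n.+1 => (x *m V) 0 0) = (fun x => \sum_i x 0 i * V i 0).
  by apply/funext => x; rewrite mxE.
apply: continuous_sum => i x.
apply: (@continuousM _ _ (fun y : 'rV[R]_n.+1 => y 0 i) (cst (V i 0))).
  exact: coord_continuous.
exact: cst_continuous.
Qed.

Lemma closure_halfspace n (A : set 'rV[R]_n.+1) (V : 'cV[R]_n.+1) :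
  (forall x, A x -> 0 <= (x *m V) 0 0) -> forall x, closure A x -> 0 <= (x *m V) 0 0.
Proof.
move=> AV x Ax; pose S := (fun x : 'rV[R]_n.+1 => (x *m V) 0 0) @^-1` [set y | 0 <= y].
have clo : closed S.
  apply: closed_comp; last exact: closed_ge.
  by move=> y _; apply: mulmx_col_continuous.
have : closure S x by apply: closureS Ax.
by rewrite -((closure_id S).1 clo).
Qed.

Lemma closure_ray n (A : set 'rV[R]_n.+1) (x v : 'rV[R]_n.+1) :
  (forall e, 0 < e -> A (x + e *: v)) -> closure A x.
Proof.
move=> Av B Bx.
have cv : (x + e *: v) @[e --> (0 : R)^'+] --> x.
  rewrite -[X in _ --> X]addr0 -(scale0r v); apply: cvgD; first exact: cvg_cst.
  apply: cvgZr_tmp; apply: cvg_at_right_filter; exact: cvg_id.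
have := cv B Bx; rewrite nbhs_simpl /= => nB.
near (0 : R)^'+ => e.
exists (x + e *: v); split; first by apply: Av; near: e; apply: nbhs_right_gt.
by near: e.
Unshelve. all: by end_near.
Qed.

Lemma row_col_mul d (t s : R) (z : 'rV[R]_d) (v : 'cV[R]_d) :
  ((row_mx t%:M z : 'rV[R]_d.+1) *m (col_mx s%:M v : 'cV[R]_d.+1)) 0 0 =
  t * s + (z *m v) 0 0.
Proof.
by rewrite (mul_row_col t%:M z s%:M v) mxE -scalar_mxM mxE eqxx mulr1n.
Qed.

Lemma lift_pt_mul d (z : 'rV[R]_d) (s : R) (v : 'cV[R]_d) :
  (lift_pt z *m (col_mx s%:M v : 'cV[R]_d.+1)) 0 0 = s + (z *m v) 0 0.
Proof.
by rewrite -[lift_pt z]/(row_mx 1%:M z : 'rV[R]_d.+1) row_col_mul mul1r.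
Qed.

Lemma proj_closure_pos d (P : set 'rV[R]_d) (V : 'cV[R]_d.+1) :
  (forall z, P z -> 0 <= (lift_pt z *m V) 0 0) ->
  forall x, proj_closure P x -> 0 <= (x *m V) 0 0.
Proof.
move=> PV; apply: closure_halfspace => _ [t [z [t0 Pz ->]]].
by rewrite -scalemxAl mxE mulr_ge0 ?PV // ltW.
Qed.

Lemma proj_closure_lift d (P : set 'rV[R]_d) z : P z -> proj_closure P (lift_pt z).
Proof.
by move=> Pz; apply: subset_closure; exists 1, z; rewrite scale1r; split.
Qed.

(** The inequalities are those of P made homogeneous, together with t >= 0. A solution x, even with
    t = 0, is the limit of x + e * (1, y0) for a point y0 of P, and these points lie over P. *)
Lemma proj_closure_polyhedron d (P : set 'rV[R]_d) :
  polyhedron P -> P !=set0 ->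
  exists hs : seq 'cV[R]_d.+1, forall x,
    proj_closure P x <-> (forall h, h \in hs -> 0 <= (x *m h) 0 0).
Proof.
move=> [m [A [b PE]]] [y0 Py0].
pose hk k : 'cV[R]_d.+1 := col_mx (b k 0)%:M (- (row k A)^T).
pose e0 : 'cV[R]_d.+1 := col_mx 1%:M (0 : 'cV[R]_d).
have PE' y : P y <-> forall k, 0 <= (lift_pt y *m hk k) 0 0.
  have eq k : (lift_pt y *m hk k) 0 0 = b k 0 - (A *m y^T) k 0.
    rewrite lift_pt_mul mulmxN mxE; congr (_ - _).
    by rewrite !mxE; apply: eq_bigr => j _; rewrite !mxE mulrC.
  by rewrite PE; split=> h k; have := h k; rewrite eq subr_ge0.
exists (e0 :: [seq hk k | k <- enum 'I_m]) => x; split=> [Kx h|hx].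
  rewrite inE => /orP [/eqP ->|/mapP [k _ ->]]; move: x Kx.
    by apply: proj_closure_pos => z _; rewrite lift_pt_mul mulmx0 mxE addr0 ler01.
  by apply: proj_closure_pos => z /PE'.
pose t : R := (x : 'rV[R]_(1 + d)) 0 (lshift d 0).
pose y : 'rV[R]_d := rsubmx (x : 'rV[R]_(1 + d)).
have xE : x = row_mx t%:M y.
  have -> : t%:M = lsubmx (x : 'rV[R]_(1 + d)).
    by apply/matrixP => i j; rewrite !ord1 !mxE eqxx mulr1n.
  by rewrite /y hsubmxK.
have t0 : 0 <= t.
  have := hx e0 (mem_head _ _); rewrite xE row_col_mul mulmx0 mxE addr0 mulr1.
  by [].
have step (u : R) z : P z -> 0 < t + u -> 0 <= u ->
    exists t' z', [/\ 0 < t', P z' & x + u *: lift_pt z = t' *: lift_pt z'].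
  move=> Pz tu u0; exists (t + u), ((t + u)^-1 *: (y + u *: z)).
  have eq : x + u *: lift_pt z = (t + u) *: lift_pt ((t + u)^-1 *: (y + u *: z)).
    have eq' : row_mx t%:M y + u *: row_mx (1 : 'M[R]_1) z =
        (t + u) *: row_mx (1 : 'M[R]_1) ((t + u)^-1 *: (y + u *: z)).
      rewrite !scale_row_mx scalerA mulfV ?gt_eqF // scale1r add_row_mx.
      have -> // : t%:M + u *: (1 : 'M[R]_1) = (t + u) *: 1.
      by apply/matrixP => i j; rewrite !ord1 !mxE eqxx !mulr1n !mulr1.
    by rewrite xE; exact: eq'.
  split=> //; apply/PE' => k.
  rewrite -(pmulr_rge0 _ tu); have -> : (t + u) * (lift_pt ((t + u)^-1 *: (y + u *: z)) *m hk k) 0 0 =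
     ((x + u *: lift_pt z) *m hk k) 0 0 by rewrite eq -scalemxAl [RHS]mxE.
  rewrite mulmxDl -scalemxAl mxE [X in _ + X]mxE addr_ge0 //.
    by apply: hx; rewrite inE map_f ?orbT // mem_enum.
  by apply: mulr_ge0 => //; apply: (PE' z).1.
apply: (@closure_ray _ _ _ (lift_pt y0)) => e e_gt0.
have [|t' [z' [h1 h2 h3]]] := step e y0 Py0 _ (ltW e_gt0).
  by rewrite ltr_wpDl.
by exists t', z'.
Qed.

End ProjectiveClosure.

(** * The dual cone and the normal fan *)

Section NormalFan.
Variables (R : realType) (d : nat).
Implicit Types (P : set 'rV[R]_d) (v y : 'rV[R]_d).
Local Open Scope classical_set_scope.

Lemma dotpC v y : dotp v y = dotp y v.
Proof. by rewrite /dotp !mxE; apply: eq_bigr => i _; rewrite !mxE mulrC. Qed.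

Lemma lift_pt_dotp y s v :
  (lift_pt y *m (col_mx s%:M v^T : 'cV[R]_d.+1)) 0 0 = s + dotp v y.
Proof. by rewrite lift_pt_mul dotpC. Qed.

Definition minimizer P v y := P y /\ forall y', P y' -> dotp v y <= dotp v y'.

Lemma support_fun_minimizer P v y :
  minimizer P v y -> support_fun P v = (- dotp v y)%:E.
Proof.
move=> [Py ymin]; rewrite /support_fun EFinN; congr (- _)%E.
apply/eqP; rewrite eq_le; apply/andP; split.
  by apply: ereal_inf_lbound; exists y.
by apply/ereal_infP => _ [y' Py' <-]; rewrite lee_fin; apply: ymin.
Qed.

Lemma minimizer_of_support P v y : P y ->
  support_fun P v = (- dotp v y)%:E -> minimizer P v y.
Proof.
move=> Py; rewrite /support_fun EFinN => /oppe_inj e; split=> // y' Py'.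
by rewrite -lee_fin -e; apply: ereal_inf_lbound; exists y'.
Qed.

Lemma normal_cone_minimizer P C : normal_fan P C ->
  exists y, forall v, C v -> minimizer P v y.
Proof.
move=> [F [[y Fy] [u [c [_ FE]]]] <-]; exists y => v Cv.
by apply: minimizer_of_support; [move: Fy; rewrite FE => -[] | apply: Cv].
Qed.

Lemma minimizer_normal_fan P v y : minimizer P v y -> (\bigcup_(C in normal_fan P) C) v.
Proof.
move=> [Py ymin]; pose F := [set y' | P y' /\ dotp v y' = dotp v y].
exists (normal_cone P F).
  by exists F => //; split; [exists y | exists v, (dotp v y)].
by move=> y' [Py' e]; rewrite e; apply: support_fun_minimizer.
Qed.

Lemma row_mx_split (x : 'rV[R]_d.+1) : exists t (z : 'rV[R]_d), x = row_mx t%:M z.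
Proof.
exists ((x : 'rV[R]_(1 + d)) 0 (lshift d 0)), (rsubmx (x : 'rV[R]_(1 + d))).
have -> : ((x : 'rV[R]_(1 + d)) 0 (lshift d 0))%:M = lsubmx (x : 'rV[R]_(1 + d)).
  by apply/matrixP => i j; rewrite !ord1 !mxE eqxx mulr1n.
by rewrite hsubmxK.
Qed.

Lemma proj_closure_lift_inv P z : polyhedron P -> proj_closure P (lift_pt z) -> P z.
Proof.
move=> [m [A [b PE]]] Kz; rewrite PE => k.
have eq y : (lift_pt y *m (col_mx (b k 0)%:M (- (row k A)^T) : 'cV[R]_d.+1)) 0 0 =
    b k 0 - (A *m y^T) k 0.
  rewrite lift_pt_mul mulmxN mxE; congr (_ - _).
  by rewrite !mxE; apply: eq_bigr => j _; rewrite !mxE mulrC.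
rewrite -subr_ge0 -eq; apply: proj_closure_pos Kz => y.
by rewrite PE eq subr_ge0 => /(_ k).
Qed.

(** Rows of X with positive first coordinate are multiples of lifted points of P, the others are
    recession directions. Nonnegativity of (s, v) makes v nonnegative on the latter, so the minimum
    is found among finitely many points. *)
Lemma exists_minimizer P N (X : 'M[R]_(N, d.+1)) s v :
  (forall x, proj_closure P x <-> pos_hull X x) -> polyhedron P -> P !=set0 ->
  nonneg_on X (col_mx s%:M v^T : 'cV[R]_d.+1) -> exists y, minimizer P v y.
Proof.
move=> KX polyP [y0 Py0] /forallP Xp.
pose t i : R := (X *m (col_mx 1%:M (0 : 'cV[R]_d) : 'cV[R]_d.+1)) i 0.
pose r i : R := (X *m (col_mx 0%:M v^T : 'cV[R]_d.+1)) i 0.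
have rowsE i : exists z : 'rV[R]_d, [/\ row i X = row_mx (t i)%:M z, r i = dotp v z &
    0 <= t i * s + dotp v z].
  have [t' [z Xi]] := row_mx_split (row i X).
  have tE : t i = t'.
    have -> : t i = (row i X *m (col_mx 1%:M (0 : 'cV[R]_d) : 'cV[R]_d.+1)) 0 0.
      by rewrite -row_mul mxE.
    by rewrite Xi row_col_mul mulmx0 mxE addr0 mulr1.
  exists z; rewrite tE; split=> //.
    have -> : r i = (row i X *m (col_mx 0%:M v^T : 'cV[R]_d.+1)) 0 0.
      by rewrite -row_mul mxE.
    by rewrite Xi row_col_mul mulr0 add0r dotpC.
  have := Xp i; have -> : (X *m (col_mx s%:M v^T : 'cV[R]_d.+1)) i 0 =
      (row i X *m (col_mx s%:M v^T : 'cV[R]_d.+1)) 0 0 by rewrite -row_mul [RHS]mxE.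
  by rewrite Xi row_col_mul dotpC.
have t0 i : 0 <= t i.
  have : proj_closure P (row i X) by apply/KX/pos_hull_row.
  move/(@proj_closure_pos _ _ P (col_mx 1%:M (0 : 'cV[R]_d))).
  rewrite -row_mul mxE; apply => z _.
  by rewrite lift_pt_mul mulmx0 mxE addr0 ler01.
have sums y (c : 'rV_N) : lift_pt y = c *m X ->
    \sum_i c 0 i * t i = 1 /\ \sum_i c 0 i * r i = dotp v y.
  move=> e; split.
    have := lift_pt_mul y 1 (0 : 'cV[R]_d); rewrite e -mulmxA mxE => ->.
    by rewrite mulmx0 mxE addr0.
  by have := lift_pt_dotp y 0 v; rewrite e -mulmxA mxE => ->; rewrite add0r.
have [i0 ti0] : exists i, 0 < t i.
  have [c [_ /sums [c1 _]]] := (KX _).1 (proj_closure_lift Py0).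
  apply/existsP; apply: contraT => /existsPn h; move/eqP: c1.
  rewrite big1 ?(eq_sym 0) ?oner_eq0 // => i _.
  have -> : t i = 0 by apply/eqP; rewrite eq_le t0 andbT leNgt.
  by rewrite mulr0.
(* The value of v at the point of P below row i is r i / t i. *)
have [i ti imin] := @arg_minP _ _ _ i0 (fun i => 0 < t i) (fun i => r i / t i) ti0.
have [z [Xi ri _]] := rowsE i.
have ye : lift_pt ((t i)^-1 *: z) = (t i)^-1 *: row i X.
  have e : (t i)^-1 *: row_mx (t i)%:M z = row_mx (1 : 'M[R]_1) ((t i)^-1 *: z).
    by rewrite scale_row_mx scale_scalar_mx mulVf ?gt_eqF.
  by rewrite Xi; symmetry; exact: e.
exists ((t i)^-1 *: z); split.
  apply: proj_closure_lift_inv => //; apply/KX; rewrite ye.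
  exists ((t i)^-1 *: delta_mx 0 i); split; last by rewrite -scalemxAl -rowE.
  by move=> j; rewrite !mxE mulr_ge0 ?ler0n // invr_ge0.
have -> : dotp v ((t i)^-1 *: z) = r i / t i.
  by rewrite ri /dotp linearZ -scalemxAr mxE mulrC.
move=> y' /proj_closure_lift/KX [c [c0 /sums [c1 <-]]].
rewrite -[leLHS]mul1r -c1 mulr_suml; apply: ler_sum => j _.
rewrite -mulrA ler_wpM2l //.
have [z' [_ rj pos]] := rowsE j; have := t0 j; rewrite le_eqVlt => /orP [/eqP tj|tj].
  by move: pos; rewrite -tj !mul0r add0r -rj.
by rewrite mulrC -ler_pdivlMr //; apply: imin.
Qed.

End NormalFan.

(** * The triangulated normal fan as a decomposition of the dual cone *)

Section FanDecomposition.
Variables (R : realType) (d : nat).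
Implicit Types (P : set 'rV[R]_d) (v y : 'rV[R]_d) (M : 'M[R]_d).
Local Open Scope classical_set_scope.

Local Notation height P v := (fine (support_fun P v)).

Definition fan_gens P M : 'M[R]_d.+1 :=
  block_mx (1%:M : 'M[R]_1) (\row_j height P (row j M)) 0 M^T.

Definition fan_family P m (T : 'I_m -> 'M[R]_d) : seq (signed_cone R d.+1) :=
  [seq (1, fan_gens P (T i), [set: 'I_d.+1]%SET) | i <- enum 'I_m].

Lemma det_fan_gens P M : \det (fan_gens P M) = \det M.
Proof.
have := det_ublock (1%:M : 'M[R]_1) (\row_j height P (row j M)) M^T.
by rewrite det1 mul1r det_tr.
Qed.

Lemma fan_gens_mul P M (s : R) (a : 'rV[R]_d) :
  fan_gens P M *m (col_mx s%:M a^T : 'cV[R]_d.+1) =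
  col_mx (s + \sum_j a 0 j * height P (row j M))%:M (a *m M)^T.
Proof.
apply: (etrans (mul_block_col (1%:M : 'M[R]_1) _ 0 M^T s%:M a^T)).
rewrite mul1mx mul0mx add0r trmx_mul.
have -> // : s%:M + (\row_j height P (row j M)) *m a^T =
    (s + \sum_j a 0 j * height P (row j M))%:M.
apply/matrixP => i j; rewrite !ord1 !mxE eqxx !mulr1n; congr (_ + _).
by apply: eq_bigr => k _; rewrite !mxE mulrC.
Qed.

Lemma col_mx_head (s : R) v : (col_mx s%:M v^T : 'cV[R]_d.+1) ord0 0 = s.
Proof.
have -> : (ord0 : 'I_d.+1) = lshift d (ord0 : 'I_1) by apply: val_inj.
by rewrite (col_mxEu s%:M v^T) mxE mulr1n.
Qed.

Lemma col_mx_tail (s : R) v j : (col_mx s%:M v^T : 'cV[R]_d.+1) (lift ord0 j) 0 = v 0 j.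
Proof.
have -> : (lift ord0 j : 'I_d.+1) = rshift 1 j by apply: val_inj.
by rewrite (col_mxEd s%:M v^T) mxE.
Qed.

Lemma col_mx_delta0 : col_mx 1%:M (0 : 'cV[R]_d) = delta_mx ord0 0 :> 'cV[R]_d.+1.
Proof.
apply/matrixP => i j; rewrite [LHS]mxE [RHS]mxE !ord1 andbT.
case: splitP => k ik; rewrite mxE.
  have -> : i = ord0 by apply: val_inj; rewrite /= ik (ord1 k).
  by rewrite (ord1 k) !eqxx.
suff /negbTE -> : i != ord0 by [].
by apply/eqP => i0; rewrite i0 in ik.
Qed.

Lemma col_fan_gens0 P M : col ord0 (fan_gens P M) = delta_mx ord0 0.
Proof.
rewrite colE -col_mx_delta0.
have -> : (0 : 'cV[R]_d) = (0 : 'rV[R]_d)^T by rewrite trmx0.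
rewrite fan_gens_mul mul0mx big1 ?addr0 // => j _.
by rewrite mxE mul0r.
Qed.

Lemma col_fan_gens1 P M j :
  col (lift ord0 j) (fan_gens P M) = col_mx (height P (row j M))%:M (row j M)^T.
Proof.
have e : col_mx 0%:M (delta_mx 0 j : 'rV[R]_d)^T = delta_mx (lift ord0 j) 0 :> 'cV[R]_d.+1.
  apply/matrixP => i k; rewrite [LHS]mxE [RHS]mxE !ord1 andbT.
  case: splitP => r ir; rewrite !mxE ?mul0rn.
    suff /negbTE -> : i != lift ord0 j by [].
    by apply/eqP => ij; rewrite ij (ord1 r) in ir.
  have -> : i = lift ord0 r by apply: val_inj; rewrite /= ir.
  by rewrite (inj_eq (@lift_inj _ _)).
rewrite colE -e fan_gens_mul add0r -rowE (bigD1 j) //= mxE !eqxx mul1r big1 ?addr0 // => k kj.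
by rewrite mxE (negbTE kj) mul0r.
Qed.

(** The extra generator e_0 is the constant 1 in the denominator and leaves the determinant
    unchanged. *)
Lemma dual_form_fan P m (T : 'I_m -> 'M[R]_d) :
  dual_form (fan_family P T) = dual_volume P T.
Proof.
rewrite /dual_form /fam_form /fan_family big_map big_enum; apply: eq_bigr => i _.
rewrite /cone_form eqxx /weight /gens /= mul1r det_fan_gens; congr (_ / _).
rewrite big_ord_recl col_fan_gens0.
rewrite affine_poly_delta0 rmorph1 mul1r.
by apply: eq_bigr => j _; rewrite col_fan_gens1.
Qed.

Section Decomposition.
Variables (P : set 'rV[R]_d) (m : nat) (T : 'I_m -> 'M[R]_d).
Variables (N : nat) (X : 'M[R]_(N, d.+1)).
Hypotheses (P_polyhedron : polyhedron P) (P_full : full_dimensional P).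
Hypothesis T_triangulation : fan_triangulation P T.
Hypothesis KX : forall x, proj_closure P x <-> pos_hull X x.

Lemma fan_gens_unit i : fan_gens P (T i) \in unitmx.
Proof. by have [uT _ _ _ _] := T_triangulation; rewrite unitmxE det_fan_gens -unitmxE. Qed.

(** (h_P(v), v) is nonnegative over P by the definition of the support function, hence on the closed
    cone. Since v lies in a cone of the fan, the minimum is attained and h_P(v) is finite. *)
Lemma fan_gens_nonneg i k j : 0 <= (X *m fan_gens P (T i)) k j.
Proof.
have [_ rays _ _ _] := T_triangulation.
have : proj_closure P (row k X) by apply/KX/pos_hull_row.
have -> : (X *m fan_gens P (T i)) k j = (row k X *m col j (fan_gens P (T i))) 0 0.
  by rewrite colE mulmxA -colE -row_mul !mxE.
apply: proj_closure_pos => z Pz; case: (unliftP ord0 j) => [j' ->|->].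
  rewrite col_fan_gens1 lift_pt_dotp.
  have [y ymin] := normal_cone_minimizer (rays i j').
  have rT : minimizer P (row j' (T i)) y.
    by apply: ymin; exists 1; rewrite ?scale1r ?ler01 //= ler01.
  by rewrite (support_fun_minimizer rT) /= addrC subr_ge0; apply: rT.2.
by rewrite col_fan_gens0 -col_mx_delta0 lift_pt_mul mulmx0 mxE addr0 ler01.
Qed.

Lemma fan_cone_nonneg i p :
  in_cone (1, fan_gens P (T i), [set: 'I_d.+1]%SET) p -> nonneg_on X p.
Proof.
move=> /forallP pin; apply/forallP => k.
rewrite -[p](mulKVmx (fan_gens_unit i)) (mulmxA X) mxE; apply: sumr_ge0 => j _.
apply: mulr_ge0; first exact: fan_gens_nonneg.
by have := pin j; rewrite inE /= => /ltW.
Qed.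

Lemma col_mx_split (p : 'cV[R]_d.+1) : exists s v, p = col_mx s%:M v^T.
Proof.
have [s [v pE]] := row_mx_split p^T; exists s, v.
have e : (row_mx s%:M v : 'rV[R]_(1 + d))^T = col_mx s%:M v^T.
  by rewrite tr_row_mx tr_scalar_mx.
by rewrite -[p]trmxK pE; exact: e.
Qed.

Lemma simplicial_cone_mul i (a : 'rV[R]_d) : (forall j, 0 <= a 0 j) ->
  simplicial_cone (T i) (a *m T i).
Proof.
by move=> a0; exists a => // j; split=> //; rewrite finset.in_setT.
Qed.

(** One point y1 of P minimizes all vectors of a normal cone, so h_P is linear on it. Hence (s, v)
    is (s + <v, y1>) e_0 plus the combination of lifted rays with the coordinates of v. All
    coefficients are nonnegative, and positive off the walls. *)
Lemma nonneg_fan_cone p : nonneg_on X p ->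
  all (fun s => off_walls s p) (fan_family P T) ->
  exists i, in_cone (1, fan_gens P (T i), [set: 'I_d.+1]%SET) p.
Proof.
have [uT _ sub cover _] := T_triangulation.
have [s [v ->]] := col_mx_split p; move=> Xp off.
have P0 : P !=set0 by have [y [M [Py _ _]]] := P_full; exists y.
have [y ymin] := exists_minimizer KX P_polyhedron P0 Xp.
have := minimizer_normal_fan ymin; rewrite -cover => -[i _ vTi].
have [C nC TC] := sub i; have [y1 y1min] := normal_cone_minimizer nC.
have {ymin y} vmin := y1min v (TC _ vTi).
have [a vE a0] := vTi; exists i.
have hv : dotp v y1 = - \sum_j a 0 j * height P (row j (T i)).
  have rmin j : minimizer P (row j (T i)) y1.
    apply/y1min/TC; rewrite rowE; apply: simplicial_cone_mul => j'.
    by rewrite mxE ler0n.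
  rewrite {1}vE /dotp -mulmxA mxE -sumrN; apply: eq_bigr => j _.
  by rewrite (support_fun_minimizer (rmin j)) /= mulrN opprK /dotp -row_mul [in RHS]mxE.
have s_ge : 0 <= s + dotp v y1.
  rewrite -lift_pt_dotp; move/nonneg_on_hull: Xp; apply.
  by apply/KX/proj_closure_lift; case: vmin.
have pE : col_mx s%:M v^T = fan_gens P (T i) *m (col_mx (s + dotp v y1)%:M a^T : 'cV[R]_d.+1).
  by rewrite fan_gens_mul hv subrK -vE.
have offi : off_walls (1, fan_gens P (T i), [set: 'I_d.+1]%SET) (col_mx s%:M v^T : 'cV[R]_d.+1).
  by apply: (allP off); rewrite map_f // mem_enum.
apply/forallP => j; rewrite inE /=; have /forallP/(_ j) := offi.
rewrite lt_def => -> /=; rewrite pE /coords mulKmx ?fan_gens_unit //.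
case: (unliftP ord0 j) => [j' ->|->].
  by rewrite col_mx_tail; have [] := a0 j'.
by rewrite col_mx_head.
Qed.

(** A common interior point lies in a common face of the two simplicial cones. A face containing an
    interior point is the whole cone, so the cones coincide, against their distinctness. *)
Lemma fan_cone_inj i i' p :
  in_cone (1, fan_gens P (T i), [set: 'I_d.+1]%SET) p ->
  in_cone (1, fan_gens P (T i'), [set: 'I_d.+1]%SET) p -> i = i'.
Proof.
have [uT _ _ _ disj] := T_triangulation.
have interior k : in_cone (1, fan_gens P (T k), [set: 'I_d.+1]%SET) p ->
    exists s (a : 'rV[R]_d), (forall j, 0 < a 0 j) /\ p = col_mx s%:M (a *m T k)^T.
  move=> /forallP pin; have [s [a cE]] := col_mx_split (coords (1, fan_gens P (T k), [set: 'I_d.+1]%SET) p).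
  have pE : p = fan_gens P (T k) *m (col_mx s%:M a^T : 'cV[R]_d.+1).
    by rewrite -cE /coords mulKVmx // fan_gens_unit.
  exists (s + \sum_j a 0 j * height P (row j (T k))), a.
  rewrite {1}pE fan_gens_mul; split=> // j.
  by have := pin (lift ord0 j); rewrite inE cE col_mx_tail.
move=> /interior [s [a [a0 pE]]] /interior [s' [a' [a'0 pE']]].
have e : a *m T i = a' *m T i'.
  by apply/rowP => j; rewrite -(col_mx_tail s) -pE pE' col_mx_tail.
apply/eqP; apply: contrapT => /negP ii'.
have [ne [I [I' [eI eI']]]] := disj i i' ii'.
have inI : (simplicial_cone (T i) `&` simplicial_cone (T i')) (a *m T i).
  split; first by apply: simplicial_cone_mul => j; apply: ltW.
  by rewrite e; apply: simplicial_cone_mul => j; apply: ltW.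
have full k (b : 'rV[R]_d) J : (forall j, 0 < b 0 j) -> subcone (T k) J (b *m T k) ->
    subcone (T k) J = simplicial_cone (T k).
  move=> b0 [c bc cJ]; have {}bc : b = c by apply: (can_inj (mulmxK (uT k))).
  rewrite /simplicial_cone; congr subcone; apply/setP => j; rewrite finset.in_setT.
  by apply: contraT => jJ; have := b0 j; rewrite bc; have [_ /(_ jJ) ->] := cJ j; rewrite ltxx.
apply: ne; rewrite -(full i a I a0) -?eI // eI'.
by apply: (full i' a'); rewrite // -e -eI'.
Qed.

Lemma fan_signed_count p : all (fun s => off_walls s p) (fan_family P T) ->
  signed_count (fan_family P T) p = (nonneg_on X p)%:R.
Proof.
move=> off; rewrite /signed_count /fan_family big_map big_enum /=.
have [Xp|nXp] := boolP (nonneg_on X p); last first.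
  rewrite big1 // => i _; rewrite /weight /= mul1r.
  by case: (boolP (in_cone _ p)) => // /fan_cone_nonneg; rewrite (negbTE nXp).
have [i pi] := nonneg_fan_cone Xp off.
rewrite (bigD1 i) //= pi /weight /= mulr1 big1 ?addr0 // => i' ii'.
case: (boolP (in_cone _ p)) => [pi'|]; last by rewrite mulr0.
by case/eqP: ii'; apply: (fan_cone_inj pi').
Qed.

Lemma fan_nonempty : exists i : 'I_m, True.
Proof.
have [_ _ _ cover _] := T_triangulation; have [y [M [Py _ _]]] := P_full.
have : (\bigcup_(C in normal_fan P) C) 0.
  apply: (@minimizer_normal_fan _ _ _ _ y); split=> // y' _.
  by rewrite /dotp !mul0mx.
by rewrite -cover => -[i _ _]; exists i.
Qed.

Lemma fan_dual_decomposition : dual_decomposition X (fan_family P T).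
Proof.
split; last exact: fan_signed_count.
- apply/row_full_kerP => V XV.
  have KV x : proj_closure P x -> x *m V = 0.
    by move=> /KX [c [_ ->]]; rewrite -mulmxA XV mulmx0.
  have [y [M [Py PM uM]]] := P_full.
  have [s [v VE]] := col_mx_split V.
  have lE z : P z -> s + dotp v z = 0.
    by move=> Pz; rewrite -lift_pt_dotp -VE KV ?mxE //; apply: proj_closure_lift.
  have Mv : M *m v^T = 0.
    apply/colP => i; have := lE _ (PM i); rewrite dotpC /dotp mulmxDl mxE addrA.
    rewrite -[(y *m _) 0 0]/(dotp y v) -dotpC lE // add0r -row_mul mxE => ->.
    by rewrite mxE.
  have v0 : v = 0.
    by apply: trmx_inj; rewrite -(mulKmx uM v^T) Mv mulmx0 trmx0.
  have s0 : s = 0 by have := lE y Py; rewrite v0 /dotp mul0mx mxE addr0.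
  by rewrite VE s0 v0; apply/colP => i; case: (unliftP ord0 i) => [j ->|->];
    rewrite ?col_mx_head ?col_mx_tail !mxE.
(* The sum of the generators of one cone is interior to the dual cone: a row of X orthogonal to all
   these generators would be 0. *)
- have [i _] := fan_nonempty; exists (fan_gens P (T i) *m const_mx 1) => k.
  have [->|X0] := eqVneq (row k X) 0; [by left | right].
  have sum_gt0 : 0 < \sum_j (X *m fan_gens P (T i)) k j.
    rewrite lt_def sumr_ge0 ?andbT => [|j _]; last exact: fan_gens_nonneg.
    apply: contraNneq X0 => /eqP; rewrite psumr_eq0 => [/allP h|j _]; last exact: fan_gens_nonneg.
    rewrite -(mulmxK (fan_gens_unit i) (row k X)) -row_mul.
    have -> : row k (X *m fan_gens P (T i)) = 0.
      apply/rowP => j; rewrite [LHS]mxE [RHS]mxE; apply/eqP.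
      by have := h j; rewrite mem_index_enum => /(_ isT).
    by rewrite mul0mx.
  by rewrite mulmxA mxE; under eq_bigr do rewrite [const_mx _ _ _]mxE mulr1.
by apply/allP => _ /mapP [i _ ->]; apply: fan_gens_unit.
Qed.

End Decomposition.

End FanDecomposition.

Section Pointed.
Variables (R : realType) (d : nat).

Lemma dual_decomposition_pointed N (X : 'M[R]_(N, d.+1)) fam :
  dual_decomposition X fam ->
  exists V0 : 'cV[R]_d.+1, forall x, pos_hull X x -> x != 0 -> 0 < (x *m V0) 0 0.
Proof.
move=> [_ [V0 XV0] _ _]; exists V0 => _ [c [c0 ->]] x0.
have terms_ge0 i : 0 <= c 0 i * (X *m V0) i 0.
  apply: mulr_ge0 => //; case: (XV0 i) => [Xi|/ltW //].
  have -> : (X *m V0) i 0 = (row i X *m V0) 0 0 by rewrite -row_mul [RHS]mxE.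
  by rewrite Xi mul0mx mxE.
rewrite -mulmxA mxE lt_def sumr_ge0 ?andbT //.
apply: contraNneq x0 => /eqP; rewrite psumr_eq0 // => /allP s0.
rewrite mulmx_sum_row big1 // => i _.
have /eqP := s0 i (mem_index_enum i); case: (XV0 i) => [-> _|Xi /eqP].
  by rewrite scaler0.
by rewrite /= mulf_eq0 (gt_eqF Xi) orbF => /eqP ->; rewrite scale0r.
Qed.

End Pointed.

Local Open Scope classical_set_scope.

Theorem theorem5p3 (R : realType) (d : nat) (P : set 'rV[R]_d)
    (m : nat) (T : 'I_m -> 'M[R]_d)
    (P_polyhedron : polyhedron P)
    (P_full : full_dimensional P)
    (P_no_line : contains_no_line P)
    (T_triangulation : fan_triangulation P T)
    (Omega : ratfun R d) :
  canonical_form (proj_closure P) 1 Omega <-> Omega = dual_volume P T.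
Proof.
have [hs hsP] : exists hs : seq 'cV[R]_d.+1, forall x,
    proj_closure P x <-> (forall h, h \in hs -> 0 <= (x *m h) 0 0).
  apply: proj_closure_polyhedron => //.
  by have [y [M [Py _ _]]] := P_full; exists y.
have [I [X0 X0P]] := polyhedral_cone_hull hs.
pose X := \matrix_(i < #|I|) X0 (enum_val i).
have KX x : proj_closure P x <-> pos_hull X x.
  split=> [/hsP/X0P/finite_hull_pos_hull //|].
  by move=> /finite_hull_pos_hull/X0P/hsP.
have KE : proj_closure P = pos_hull X by apply/seteqP; split=> x /KX.
have datum := fan_dual_decomposition P_polyhedron P_full T_triangulation KX.
have exists_form : canonical_form (proj_closure P) 1 (dual_volume P T).
  have := dual_form_canonical (oner_neq0 R) datum.
  by rewrite sgr1 dual_form_fan KE /rconst mpolyC1 rmorph1 mul1r.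
split=> [can|-> //].
apply: (canonical_form_uniq (oner_neq0 R) _ can exists_form).
by rewrite KE; apply: dual_decomposition_pointed datum.
Qed.
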